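(* Let $n\ge 1$, $b>-1$, $1<p<\infty$, let $u$ be a weight on $\mathbb{B}_n$, and let $\mathcal{B}_b=S_{n+1+b,b}^{+}$ be the Berezin transform $$\mathcal{B}_bf(z)=(1-|z|^2)^{n+1+b}\int_{\mathbb{B}_n}\frac{f(w)}{|1-z\overline{w}|^{2(n+1+b)}}\,dv_b(w).$$ Then $$[u]_{C_{p,b}}^{\frac{1}{2p}}\lesssim\|\mathcal{B}_b:L_b^p(u)\to L_b^p(u)\|\lesssim [u]_{C_{p,b}}^{\max\{1,\frac{1}{p-1}\}},$$ with implied constants not depending on $u$.
   Context: $\mathbb{B}_n$ is the open unit ball of $\mathbb{C}^n$, $dV$ is Lebesgue measure, $z\overline{w}=\sum_{i=1}^n z^i\overline{w}^i$, and for $t>-1$, $dv_t(z)=c_t(1-|z|^2)^t\,dV(z)$ with $c_t$ chosen so that $\int_{\mathbb{B}_n}dv_t=1$. A weight is a positive locally integrable function on $\mathbb{B}_n$. $L_b^p(u)$ is the space of $f$ with $\|f\|_{L_b^p(u)}^p=\int_{\mathbb{B}_n}|f|^pu\,dv_b<\infty$; the operator norm is $+\infty$ if the operator is not bounded. Carleson tents: $T_z=\{w\in\mathbb{B}_n:|1-\overline{w}\frac{z}{|z|}|<1-|z|\}$ for $z\in\mathbb{B}_n\setminus\{0\}$, and $T_0=\mathbb{B}_n$. With $p'=p/(p-1)$ and $\sigma=u^{-p'/p}$, the $C_{p,b}$ characteristic is $$[u]_{C_{p,b}}=\sup_{z\in\mathbb{B}_n}\left(\frac{\int_{T_z}\sigma\,dv_b}{\int_{T_z}dv_b}\right)^{p-1}\frac{\int_{T_z}u\,dv_{p(n+1+b)+b}}{\int_{T_z}dv_{p(n+1+b)+b}}.$$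 $A\lesssim B$ means $A\le CB$ with $C>0$ depending only on $n,b,p$. *)

(* Defs.v *)
From HB Require Import structures.
From mathcomp Require Import all_boot all_order all_algebra.
From mathcomp Require Import complex.
From mathcomp Require Import all_classical all_reals all_analysis measurable_realfun.

Set Implicit Arguments.
Unset Strict Implicit.
Unset Printing Implicit Defensive.

Import Order.TTheory GRing.Theory Num.Theory.
Import ComplexField.Normc.
Import numFieldNormedType.Exports.

Local Open Scope classical_set_scope.
Local Open Scope ring_scope.
Local Open Scope complex_scope.

(* Gives 'rV[R[i]]_n the product of the usual topology of C. *)
HB.instance Definition _ (R : rcfType) := PseudoPointedMetric.copy R[i] R[i]^o.

(* Borel sigma-algebra of C, transported from R * R. *)
Definition complex_display : measure_display. Proof. exact. Qed.

Section measurable_complex.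
Variable R : realType.

Local Notation RR := (measurableTypeR R * measurableTypeR R)%type.

Definition complex_pair (z : R[i]) : RR := (complex.Re z, complex.Im z).
Definition pair_complex (x : RR) : R[i] := x.1 +i* x.2.

Definition measurable_complex : set (set R[i]) :=
  preimage_set_system [set: R[i]] complex_pair measurable.

Let sC : sigma_algebra [set: R[i]] measurable_complex.
Proof. exact/sigma_algebra_preimage/sigma_algebra_measurable. Qed.

Let mC0 : measurable_complex set0. Proof. by case: sC. Qed.
Let mCC A : measurable_complex A -> measurable_complex (~` A).
Proof. by case: sC => _ + _ => /[apply]; rewrite setTD. Qed.
Let mCU (F : (set R[i])^nat) :
  (forall i, measurable_complex (F i)) -> measurable_complex (\bigcup_i F i).
Proof. by case: sC => _ _; exact. Qed.

HB.instance Definition _ := @isMeasurable.Build complex_display R[i]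
  measurable_complex mC0 mCC mCU.
End measurable_complex.

Section measurable_complex_theory.
Variable R : realType.

Lemma pair_complexK : cancel (@pair_complex R) (@complex_pair R).
Proof. by case. Qed.

Lemma measurable_complex_pair : measurable_fun [set: R[i]] (@complex_pair R).
Proof. by move=> _ Y mY; exists Y. Qed.

Lemma measurable_pair_complex :
  measurable_fun [set: measurableTypeR R * measurableTypeR R] (@pair_complex R).
Proof.
move=> _ _ [Y mY <-]; rewrite !setTI.
by have -> : @pair_complex R @^-1` (@complex_pair R @^-1` Y) = Y
  by apply/seteqP; split => -[].
Qed.

Lemma measurable_Re : measurable_fun [set: R[i]] (@complex.Re R).
Proof. exact: measurableT_comp measurable_fst measurable_complex_pair. Qed.

Lemma measurable_Im : measurable_fun [set: R[i]] (@complex.Im R).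
Proof. exact: measurableT_comp measurable_snd measurable_complex_pair. Qed.

Lemma measurable_normc : measurable_fun [set: R[i]] (@normc R).
Proof.
have -> : @normc R = fun z : R[i] =>
    (complex.Re z ^+ 2 + complex.Im z ^+ 2) `^ 2^-1.
  by apply/funext => -[a b] /=; rewrite powR12_sqrt// addr_ge0// sqr_ge0.
apply: (measurableT_comp (measurable_powR _)); apply: measurable_funD.
  by apply: measurable_funX; exact: measurable_Re.
by apply: measurable_funX; exact: measurable_Im.
Qed.

End measurable_complex_theory.

(* Borel sigma-algebra of C^n, generated by the coordinate functions. *)
Definition rV_display (d : measure_display) : measure_display.
Proof. exact. Qed.

Section measurable_rV.
Context {d : measure_display} {T : measurableType d}.
Variable n : nat.

Definition rV_coord (i : 'I_n) (v : 'rV[T]_n) : T := v ord0 i.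

Let mr0 : g_sigma_preimage rV_coord set0.
Proof. exact: sigma_algebra0. Qed.
Let mrC A : g_sigma_preimage rV_coord A -> g_sigma_preimage rV_coord (~` A).
Proof. exact: sigma_algebraC. Qed.
Let mrU (F : (set 'rV[T]_n)^nat) : (forall i, g_sigma_preimage rV_coord (F i)) ->
  g_sigma_preimage rV_coord (\bigcup_i F i).
Proof. exact: sigma_algebra_bigcup. Qed.

HB.instance Definition _ := @isMeasurable.Build (rV_display d)
  'rV[T]_n (g_sigma_preimage rV_coord) mr0 mrC mrU.

End measurable_rV.

Section measurable_rV_theory.
Context {d : measure_display} {T : measurableType d}.

Lemma measurable_rV_coord n (i : 'I_n) :
  measurable_fun [set: 'rV[T]_n] (fun v : 'rV[T]_n => v ord0 i).
Proof.
move=> _ Y mY; rewrite setTI; apply: sub_sigma_algebra => /=.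
rewrite -bigcup_seq/=; exists i => /=; first by rewrite mem_index_enum.
by exists Y => //; rewrite setTI.
Qed.

Lemma measurable_fun_rV d' (S : measurableType d') n (f : S -> 'rV[T]_n) :
  (forall i, measurable_fun [set: S] (fun x => f x ord0 i)) ->
  measurable_fun [set: S] f.
Proof.
move=> mf _ A; move: A.
suff : g_sigma_preimage (@rV_coord _ T n) `<=`
    image_set_system [set: S] f measurable by [].
apply: smallest_sub.
  exact/sigma_algebra_image/sigma_algebra_measurable.
move=> A; rewrite -bigcup_seq/= => -[i _ [B mB <-]].
by rewrite setTI; exact: mf.
Qed.

Definition rV_cons n (x : T * 'rV[T]_n) : 'rV[T]_n.+1 :=
  \row_i if unlift ord0 i is Some j then x.2 ord0 j else x.1.

Definition rV_uncons n (v : 'rV[T]_n.+1) : T * 'rV[T]_n :=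
  (v ord0 ord0, \row_j v ord0 (lift ord0 j)).

Lemma rV_consK n : cancel (@rV_cons n) (@rV_uncons n).
Proof.
move=> [x v]; rewrite /rV_uncons; congr pair; first by rewrite mxE unlift_none.
by apply/rowP => j; rewrite !mxE liftK.
Qed.

Lemma measurable_rV_cons n : measurable_fun [set: T * 'rV[T]_n] (@rV_cons n).
Proof.
apply: measurable_fun_rV => i; under eq_fun do rewrite mxE.
case: unliftP => [j _|_]; last exact: measurable_fst.
exact: (measurableT_comp (measurable_rV_coord j) measurable_snd).
Qed.

Lemma measurable_rV_uncons n :
  measurable_fun [set: 'rV[T]_n.+1] (@rV_uncons n).
Proof.
apply: measurable_fun_pair => /=; first exact: measurable_rV_coord.
apply: measurable_fun_rV => i; under eq_fun do rewrite mxE.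
exact: measurable_rV_coord.
Qed.

End measurable_rV_theory.

(* Both sigma-finiteness lemmas are proved here because the library's canonical
   sigma-finite structure on products of sigma-finite measures is shadowed by
   the one on products of subprobabilities. *)
Lemma sigma_finite_product d1 d2 (T1 : measurableType d1)
    (T2 : measurableType d2) (R : realType)
    (m1 : {sigma_finite_measure set T1 -> \bar R})
    (m2 : {sigma_finite_measure set T2 -> \bar R}) :
  sigma_finite [set: T1 * T2] (m1 \x m2)%E.
Proof.
have /sigma_finiteP[F [TF ndF Foo]] := sigma_finiteT m1.
have /sigma_finiteP[G [TG ndG Goo]] := sigma_finiteT m2.
exists (fun n => F n `*` G n).
 rewrite -setXTT TF TG predeqE => -[x y]; split.
    move=> [/= [n _ Fnx] [k _ Gky]]; exists (maxn n k) => //; split.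
    - by move: x Fnx; exact/subsetPset/ndF/leq_maxl.
    - by move: y Gky; exact/subsetPset/ndG/leq_maxr.
  by move=> [n _ []/= ? ?]; split; exists n.
move=> k; have [? ?] := Foo k; have [? ?] := Goo k.
split; first exact: measurableX.
by rewrite product_measure1E// lte_mul_pinfty// ge0_fin_numE.
Qed.

Lemma sigma_finite_pushforward d d' (T1 : measurableType d)
    (T2 : measurableType d') (R : realType) (mu : set T1 -> \bar R)
    (f : T1 -> T2) (g : T2 -> T1) :
  sigma_finite [set: T1] mu -> measurable_fun [set: T2] g -> cancel f g ->
  sigma_finite [set: T2] (pushforward mu f).
Proof.
move=> [F FT Foo] mg fK.
exists (fun i => g @^-1` F i).
  by rewrite -preimage_bigcup -FT preimage_setT.
move=> i; have [mF muF] := Foo i; split.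
  by rewrite -[X in measurable X]setTI; exact: mg.
rewrite /pushforward -comp_preimage (_ : g \o f = id) ?preimage_id//.
by apply/funext => x /=; rewrite fK.
Qed.

Section lebesgue_C.
Variable R : realType.
Local Open Scope ereal_scope.

Definition lebesgue_C : set R[i] -> \bar R :=
  pushforward (lebesgue_measure \x lebesgue_measure) (@pair_complex R).

Let m0 : lebesgue_C set0 = 0.
Proof. by rewrite /lebesgue_C /pushforward preimage_set0 measure0. Qed.
Let mge0 A : 0 <= lebesgue_C A.
Proof. by rewrite /lebesgue_C /pushforward measure_ge0. Qed.
Let msigma : semi_sigma_additive lebesgue_C.
Proof.
move=> F mF tF mUF; rewrite /lebesgue_C /pushforward preimage_bigcup.
apply: measure_semi_sigma_additive.
- by move=> n; rewrite -[X in measurable X]setTI; exact: measurable_pair_complex.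
- apply/trivIsetP => /= i j _ _ ij; rewrite -preimage_setI.
  by move/trivIsetP : tF => /(_ _ _ _ _ ij) ->//; rewrite preimage_set0.
- rewrite -preimage_bigcup -[X in measurable X]setTI.
  exact: measurable_pair_complex.
Qed.
HB.instance Definition _ := isMeasure.Build _ _ _ lebesgue_C m0 mge0 msigma.

Let msfinite : sigma_finite [set: R[i]] lebesgue_C.
Proof.
exact: (sigma_finite_pushforward
  (sigma_finite_product (@lebesgue_measure R) (@lebesgue_measure R))
  (@measurable_complex_pair R) (@pair_complexK R)).
Qed.
HB.instance Definition _ :=
  Measure_isSigmaFinite.Build _ _ _ lebesgue_C msfinite.

End lebesgue_C.

Section lebesgue_cons.
Variables (R : realType) (n : nat).
Variable mu : {sigma_finite_measure set 'rV[R[i]]_n -> \bar R}.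
Local Open Scope ereal_scope.

Definition lebesgue_cons : set 'rV[R[i]]_n.+1 -> \bar R :=
  pushforward (@lebesgue_C R \x mu) (@rV_cons _ _ n).

Let m0 : lebesgue_cons set0 = 0.
Proof. by rewrite /lebesgue_cons /pushforward preimage_set0 measure0. Qed.
Let mge0 A : 0 <= lebesgue_cons A.
Proof. by rewrite /lebesgue_cons /pushforward measure_ge0. Qed.
Let msigma : semi_sigma_additive lebesgue_cons.
Proof.
move=> F mF tF mUF; rewrite /lebesgue_cons /pushforward preimage_bigcup.
apply: measure_semi_sigma_additive.
- by move=> k; rewrite -[X in measurable X]setTI; exact: measurable_rV_cons.
- apply/trivIsetP => /= i j _ _ ij; rewrite -preimage_setI.
  by move/trivIsetP : tF => /(_ _ _ _ _ ij) ->//; rewrite preimage_set0.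
- by rewrite -preimage_bigcup -[X in measurable X]setTI; exact: measurable_rV_cons.
Qed.
HB.instance Definition _ := isMeasure.Build _ _ _ lebesgue_cons m0 mge0 msigma.

Let msfinite : sigma_finite [set: 'rV[R[i]]_n.+1] lebesgue_cons.
Proof.
exact: (sigma_finite_pushforward (sigma_finite_product (@lebesgue_C R) mu)
  (@measurable_rV_uncons _ _ n) (@rV_consK _ _ n)).
Qed.
HB.instance Definition _ :=
  Measure_isSigmaFinite.Build _ _ _ lebesgue_cons msfinite.

End lebesgue_cons.

(* Lebesgue measure of R^(2n), by recursion on n via C^(n+1) = C * C^n. *)
Fixpoint lebesgue_Cn (R : realType) (n : nat) :
    {sigma_finite_measure set 'rV[R[i]]_n -> \bar R} :=
  match n with
  | 0 => \d_(0 : 'rV[R[i]]_0)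
  | n'.+1 => lebesgue_cons (lebesgue_Cn R n')
  end.

Section unit_ball.
Variable R : realType.

Definition hdot n (z w : 'rV[R[i]]_n) : R[i] :=
  \sum_(i < n) z ord0 i * (w ord0 i)^*.

(* The Euclidean norm; the norm `|z| of the library is the sup norm. *)
Definition hnorm n (z : 'rV[R[i]]_n) : R :=
  Num.sqrt (\sum_(i < n) normc (z ord0 i) ^+ 2).

Definition unit_ball n : set 'rV[R[i]]_n := [set z | hnorm z < 1].

Lemma measurable_hnorm n : measurable_fun [set: 'rV[R[i]]_n] (@hnorm n).
Proof.
have -> : @hnorm n = fun z : 'rV[R[i]]_n =>
    (\sum_(i < n) normc (z ord0 i) ^+ 2) `^ 2^-1.
  apply/funext => z; rewrite /hnorm powR12_sqrt// sumr_ge0// => i _.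
  exact: sqr_ge0.
apply: (measurableT_comp (measurable_powR _)); apply: measurable_sum => i.
apply: measurable_funX.
exact: (measurableT_comp (@measurable_normc R) (measurable_rV_coord i)).
Qed.

Lemma measurable_unit_ball n : measurable (@unit_ball n).
Proof.
rewrite (_ : @unit_ball n = [set: _] `&` @hnorm n @^-1` `]-oo, 1[%classic).
  by apply: measurable_hnorm.
by apply/seteqP; split => z; rewrite /unit_ball /= in_itv/=; [split|case].
Qed.

End unit_ball.
Arguments unit_ball {R n}.

(* The probability measure dv_t = c_t (1 - |z|^2)^t dV on the unit ball, seen
   as a measure on C^n that vanishes outside the ball. *)
Section weighted_volume.
Variables (R : realType) (n : nat) (t : R).
Local Open Scope ereal_scope.

Definition vol_const : R :=
  (fine (\int[lebesgue_Cn R n]_(z in unit_ball)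
           ((1 - hnorm z ^+ 2) `^ t)%:E))^-1.

Definition vol_density (z : 'rV[R[i]]_n) : R :=
  vol_const * (1 - hnorm z ^+ 2) `^ t.

Definition vol : set 'rV[R[i]]_n -> \bar R := fun A =>
  \int[lebesgue_Cn R n]_(z in A `&` unit_ball) (vol_density z)%:E.

Lemma vol_density_ge0 z : (0 <= vol_density z)%R.
Proof.
rewrite mulr_ge0 ?powR_ge0// invr_ge0 fine_ge0// integral_ge0// => x _.
by rewrite lee_fin powR_ge0.
Qed.

Lemma measurable_vol_density :
  measurable_fun [set: 'rV[R[i]]_n] vol_density.
Proof.
apply: measurable_funM => //; apply: (measurableT_comp (measurable_powR _)).
by apply: measurable_funB => //; apply: measurable_funX; exact: measurable_hnorm.
Qed.

Let vol0 : vol set0 = 0.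
Proof. by rewrite /vol set0I integral_set0. Qed.
Let vol_ge0 A : 0 <= vol A.
Proof. by apply: integral_ge0 => z _; rewrite lee_fin vol_density_ge0. Qed.
Let vol_sigma_additive : semi_sigma_additive vol.
Proof.
move=> F mF tF mUF; rewrite /vol setI_bigcupl ge0_integral_bigcup//; first last.
- by apply/trivIsetP => i j _ _ ij; move/trivIsetP : tF => /(_ i j I I ij) FF;
    rewrite setIACA FF// set0I.
- by move=> z _; rewrite lee_fin vol_density_ge0.
- apply/measurable_funTS/measurable_EFinP; exact: measurable_vol_density.
- by move=> k; apply: measurableI => //; exact: measurable_unit_ball.
apply: is_cvg_ereal_nneg_natsum_cond => k _ _.
by apply: integral_ge0 => z _; rewrite lee_fin vol_density_ge0.
Qed.

HB.instance Definition _ := isMeasure.Build _ _ _ vol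
  vol0 vol_ge0 vol_sigma_additive.

End weighted_volume.
Arguments vol {R n} t.

Section complex_integral.
Context d (T : measurableType d) (R : realType).
Variables (mu : {measure set T -> \bar R}) (D : set T) (f : T -> R[i]).

Definition cintegrable : Prop :=
  measurable_fun D f /\ (\int[mu]_(x in D) (normc (f x))%:E < +oo)%E.

Definition cintegral : R[i] :=
  (\int[mu]_(x in D) complex.Re (f x)) +i* (\int[mu]_(x in D) complex.Im (f x)).

End complex_integral.

Section berezin.
Variables (R : realType) (n : nat).
Implicit Types (b p : R) (u : 'rV[R[i]]_n -> R) (f : 'rV[R[i]]_n -> R[i]).

Definition weight u : Prop :=
  [/\ forall z, unit_ball z -> 0 < u z,
      measurable_fun unit_ball u &
      forall K : set 'rV[R[i]]_n, compact K -> K `<=` unit_ball ->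
        (\int[lebesgue_Cn R n]_(z in K) (u z)%:E < +oo)%E].

Definition Lp_integral b p u f : \bar R :=
  (\int[vol b]_(z in unit_ball) (normc (f z) `^ p * u z)%:E)%E.

Definition Lp_space b p u : set ('rV[R[i]]_n -> R[i]) :=
  [set f | measurable_fun unit_ball f /\ (Lp_integral b p u f < +oo)%E].

Definition Lp_norm b p u f : \bar R := (Lp_integral b p u f `^ p^-1)%E.

(* The least C with ||T f|| <= C ||f||, and +oo (the infimum of the empty set)
   if T is not bounded. T is total in Rocq, so the set dom of the functions f
   for which T f is really defined is an extra argument: if the space is not
   contained in dom, then T is not a bounded operator on it. *)
Definition Lp_operator_norm b p u (dom : set ('rV[R[i]]_n -> R[i]))
    (T : ('rV[R[i]]_n -> R[i]) -> 'rV[R[i]]_n -> R[i]) : \bar R :=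
  ereal_inf [set C%:E | C in [set C : R | 0 <= C /\
    forall f, Lp_space b p u f ->
      [/\ dom f, Lp_space b p u (T f) &
          (Lp_norm b p u (T f) <= C%:E * Lp_norm b p u f)%E]]].

Definition berezin_integrand b f (z w : 'rV[R[i]]_n) : R[i] :=
  f w / (normc (1 - hdot z w) `^ (2 * (n%:R + 1 + b)))%:C.

Definition berezin b f (z : 'rV[R[i]]_n) : R[i] :=
  ((1 - hnorm z ^+ 2) `^ (n%:R + 1 + b))%:C *
  cintegral (vol b) unit_ball (berezin_integrand b f z).

(* The functions whose transform is an absolutely convergent integral. *)
Definition berezin_dom b : set ('rV[R[i]]_n -> R[i]) :=
  [set f | forall z, unit_ball z ->
     cintegrable (vol b) unit_ball (berezin_integrand b f z)].

Definition berezin_norm b p u : \bar R :=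
  Lp_operator_norm b p u (berezin_dom b) (berezin b).

Definition carleson_tent (z : 'rV[R[i]]_n) : set 'rV[R[i]]_n :=
  if z == 0 then unit_ball
  else [set w | unit_ball w /\
          normc (1 - hdot ((hnorm z)^-1%:C *: z) w) < 1 - hnorm z].

Definition dual_weight p u (z : 'rV[R[i]]_n) : R :=
  let p' := p / (p - 1) in u z `^ (- (p' / p)).

Definition average t (A : set 'rV[R[i]]_n) (g : 'rV[R[i]]_n -> R) : \bar R :=
  ((\int[vol t]_(z in A) (g z)%:E) / (\int[vol t]_(z in A) 1))%E.

Definition Cpb_char p b u : \bar R :=
  ereal_sup [set (average b (carleson_tent z) (dual_weight p u) `^ (p - 1) *
                 average (p * (n%:R + 1 + b) + b) (carleson_tent z) u)%E
            | z in unit_ball].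

End berezin.

(* Main.v *)
From HB Require Import structures.
Require Import Defs.
From mathcomp Require Import all_boot all_order all_algebra.
From mathcomp Require Import complex.
From mathcomp Require Import all_classical all_reals all_analysis.
From mathcomp Require Import measurable_realfun lra ring.

Set Implicit Arguments.
Unset Strict Implicit.
Unset Printing Implicit Defensive.

Import Order.TTheory GRing.Theory Num.Theory.
Import numFieldNormedType.Exports.

Local Open Scope classical_set_scope.
Local Open Scope ring_scope.

(* Write N = n+1+b, d(z,w) = |1 - <z,w>| and rho(z) = 1 - |z|^2, and let T(z) be
   the set of w with d(w,z) < s rho(z).

   Upper bound.  The kernel d(z,w)^(-2N) is at most a constant times the integral
   over zeta of rho(zeta)^(-3N) 1[z, w in T(zeta)] dv_b, because the zeta whose
   tent contains both z and w and whose height is at most d(z,w) have volume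
   comparable to d(z,w)^N.  No dyadic tents are needed: the bilinear form of the
   transform is at most the integral of rho^(-3N) (int_T f sigma) (int_T g U),
   where U = u rho^(pN).  When p >= 2 the characteristic, together with Hoelder's
   inequality on the upper part E(zeta) of T(zeta), where sigma^(p-1) U is
   comparable to rho(zeta)^(pN), turns this into an integral of averages of f and g
   against the measures sigma(E) and U(E), and the Carleson embedding theorem (weak
   type by a Vitali selection, then a layer-cake integration) finishes the proof.
   When p < 2 one exchanges (sigma, p) and (U, p'), which turns the
   characteristic K into K^(1/(p-1)).

   Lower bound.  Testing on sigma 1_T gives [u] <= C ||B||^p, and Hoelder's
   inequality on the whole ball gives [u] >= c > 0; hence
   [u]^(1/2p) <= c^(-1/2p) [u]^(1/p) <= C' ||B||. *)

(** * Measure-theoretic preliminaries *)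

(** The tents range over all points of the ball and overlap without bound, and a weight need not be
    doubling. The two difficulties are separated. Averages are divided by the mass of an 18-fold
    dilated tent, which is what a Vitali covering controls and what the characteristic still bounds;
    the measures in the embedding live on cores, whose overlap stays bounded even when integrated
    over all centres. Two absorptions need finiteness in advance: the upper bound divides by a power
    of the norm of the transform, the lower bound by the dual mass of a tent. Both therefore work on
    truncations and end with monotone convergence. The geometry enters only through the record
    [tent_space]. Its volume bounds rest on the shape of a cap of radius r at a boundary point a:
    size r in the complex line of a, size sqrt r in the complex directions orthogonal to a, height
    at most 2r. *)

Section integral_powR.
Context {R : realType}.
Local Notation mu := (@lebesgue_measure R).

Lemma integral_powR_cc (t e A : R) : -1 < t -> 0 < e -> e < A ->
  (\int[mu]_(y in `[e, A]) (y `^ t)%:E =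
   (A `^ (t + 1) / (t + 1) - e `^ (t + 1) / (t + 1))%:E)%E.
Proof.
move=> t1 e0 eA.
have t1' : t + 1 != 0 by rewrite gt_eqF// -ltrBlDr sub0r.
pose F (y : R) := (t + 1)^-1 * y `^ (t + 1).
have dF (x : R) : 0 < x -> is_derive x 1 F (x `^ t).
  move=> x0; have := is_derive1_powR (t + 1) x0.
  rewrite addrK => /(is_deriveZ (t + 1)^-1); rewrite [X in is_derive _ _ _ X](_ : _ = x `^ t)//.
  by rewrite /GRing.scale/= mulrA mulVf// mul1r.
have cp (s x : R) : 0 < x -> {for x, continuous (@powR R ^~ s)}.
  move=> x0; apply: differentiable_continuous; apply/derivable1_diffP.
  by apply: derivable_powR; rewrite in_itv/= x0.
rewrite (@continuous_FTC2 _ _ F)//.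
- by rewrite -EFinB /F ![_^-1 * _]mulrC.
- apply/continuous_in_subspaceT => x /set_mem/=; rewrite in_itv/= => /andP[ex _].
  by apply: cp; exact: lt_le_trans ex.
- have cF x : 0 < x -> {for x, continuous F}.
    by move=> x0; apply: continuousM; [exact: cst_continuous|exact: cp].
  split => [x||].
  + rewrite in_itv/= => /andP[ex _].
    by have [] := dF _ (lt_trans e0 ex).
  + by apply: cvg_at_right_filter; apply: cF.
  + by apply: cvg_at_left_filter; apply: cF; exact: lt_trans eA.
- move=> x; rewrite in_itv/= => /andP[ex _].
  by rewrite derive1E; have [_ ->] := dF _ (lt_trans e0 ex).
Qed.

Lemma integral_powR (t A : R) : -1 < t -> 0 <= A ->
  (\int[mu]_(y in `]0%R, A[) (y `^ t)%:E = (A `^ (t + 1) / (t + 1))%:E)%E.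
Proof.
move=> t1; rewrite le_eqVlt => /predU1P[<-|A0].
  rewrite set_itv_ge ?bnd_simp ?ltxx// integral_set0 powR0 ?mul0r//.
  by rewrite gt_eqF// -ltrBlDr sub0r.
have t1' : 0 < t + 1 by rewrite -ltrBlDr sub0r.
(* The divisor [n.+2] exceeds 1 for every n, so that no interval degenerates and [integral_powR_cc]
   applies. *)
pose F n := `[A / n.+2%:R, A]%classic.
have mp D : measurable_fun D (EFin \o (@powR R ^~ t)).
  by apply: measurable_funTS; apply/measurable_EFinP; exact: measurable_powR.
have := @ge0_nondecreasing_set_cvg_integral _ (measurableTypeR R) R F (EFin \o (@powR R ^~ t)) (lebesgue_measure : {measure set (measurableTypeR R) -> \bar R}).
have ndF : nondecreasing_seq F.
  move=> m n mn; apply/subsetPset => x; rewrite /F/= !in_itv/= => /andP[h ->].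
  rewrite andbT (le_trans _ h)// ler_pM2l// lef_pV2 ?posrE ?ltr0n//.
  by rewrite ler_nat !ltnS.
move=> /(_ ndF (fun=> measurable_itv _) (fun=> mp _)) => cv.
have {}cv := cv (fun i x _ => powR_ge0 x t).
have FU : \bigcup_i F i = `]0, A]%classic.
  apply/seteqP; split => [x [n _]|x]; rewrite /F/= ?in_itv/= => /andP[h1 h2].
    by rewrite h2 andbT (lt_le_trans _ h1)// divr_gt0// ltr0n.
  have xA : 0 <= A / x by rewrite divr_ge0// ltW.
  exists (Num.truncn (A / x)) => //=; rewrite in_itv/= h2 andbT.
  rewrite ler_pdivrMr ?ltr0n// -ler_pdivrMl// mulrC.
  by rewrite (le_trans (ltW (truncnS_gt _)))// ler_nat.
rewrite FU in cv.
have -> : (\int[mu]_(y in `]0%R, A[) (y `^ t)%:E = \int[mu]_(y in `]0%R, A]) (y `^ t)%:E)%E.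
  by rewrite -integral_itv_bndo_bndc//; exact: mp.
apply: (cvg_unique _ cv) => //.
have E n : (\int[mu]_(y in F n) (y `^ t)%:E =
   (A `^ (t + 1) / (t + 1) - (A / n.+2%:R) `^ (t + 1) / (t + 1))%:E)%E.
  rewrite integral_powR_cc ?divr_gt0//.
  by rewrite ltr_pdivrMr// ltr_pMr// ltr1n.
apply: (@cvg_trans _ ((fun n : nat => (A `^ (t + 1) / (t + 1) -
    (A / n.+2%:R) `^ (t + 1) / (t + 1))%:E) @ \oo)).
  by apply: near_eq_cvg; apply: nearW => n; exact/esym/E.
apply: cvg_EFin; first by apply: nearW.
rewrite -[X in _ --> X]subr0; apply: cvgB; first exact: cvg_cst.
rewrite -[X in _ --> X](mul0r (t + 1)^-1); apply: cvgMl.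
have h : (A / n.+2%:R : R) @[n --> \oo] --> (0 : R)^'+.
  have h0 : (A / n.+2%:R : R) @[n --> \oo] --> (0 : R).
    rewrite -[X in _ --> X](mulr0 A); apply: cvgMr.
    have := @cvg_harmonic R; rewrite -cvg_shiftS; apply: cvg_trans.
    by apply: near_eq_cvg; apply: nearW.
  move=> P hP; have {}hP : \forall x \near (0 : R), 0 < x -> P x by exact: hP.
  have {}h0 : \forall n \near \oo, 0 < A / n.+2%:R -> P (A / n.+2%:R) := h0 _ hP.
  suff : \forall n \near \oo, P (A / n.+2%:R) by [].
  apply: filterS h0 => n; apply.
  by rewrite divr_gt0.
exact: (@cvg_comp _ _ _ (fun n : nat => A / n.+2%:R) (@powR R ^~ (t + 1)) _ _ _ h (powR_cvg0 t1')).
Qed.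
End integral_powR.

Section measure_extra.
Context d (T : measurableType d) (R : realType).
Implicit Types mu nu : {measure set T -> \bar R}.

Lemma measurable_set_ltr (f g : T -> R) : measurable_fun [set: T] f ->
  measurable_fun [set: T] g -> measurable [set x | f x < g x].
Proof.
move=> mf mg; have := measurable_fun_ltr mf mg => /(_ measurableT [set true] I).
by rewrite setTI.
Qed.

Lemma measurable_set_ler (f g : T -> R) : measurable_fun [set: T] f ->
  measurable_fun [set: T] g -> measurable [set x | f x <= g x].
Proof.
move=> mf mg; have := measurable_fun_ler mf mg => /(_ measurableT [set true] I).
by rewrite setTI.
Qed.

Lemma integral_mul_indic mu (A : set T) (h : T -> R) :
  (\int[mu]_x (h x * \1_A x)%:E = \int[mu]_(x in A) (h x)%:E)%E.
Proof.
rewrite [RHS]integral_mkcond; apply: eq_integral => x _.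
by rewrite patchE indicE; case: ifPn => _; rewrite ?mulr1 ?mulr0.
Qed.

Lemma ge0_hoelder mu (f g : T -> R) (p q : R) :
  measurable_fun [set: T] f -> measurable_fun [set: T] g ->
  (forall x, 0 <= f x) -> (forall x, 0 <= g x) ->
  0 < p -> 0 < q -> p^-1 + q^-1 = 1 ->
  (\int[mu]_x (f x * g x)%:E <=
   (\int[mu]_x (f x `^ p)%:E) `^ p^-1 * (\int[mu]_x (g x `^ q)%:E) `^ q^-1)%E.
Proof.
move=> mf mg f0 g0 p0 q0 pq.
have LE (h : T -> R) (r : R) : (forall x, 0 <= h x) ->
    0 < r -> Lnorm mu r%:E (EFin \o h) = ((\int[mu]_x (h x `^ r)%:E) `^ r^-1)%E.
  move=> h0 r0; rewrite -[LHS](poweRe1 (Lnorm_ge0 _ _ _)) -(mulfV (lt0r_neq0 r0)).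
  have e : (\int[mu]_x `|(EFin \o h) x| `^ r = \int[mu]_x (h x `^ r)%:E)%E.
    by apply: eq_integral => x _; rewrite /comp/= ger0_norm.
  rewrite poweRrM -[RHS](congr1 (fun y => y `^ r^-1)%E e).
  by rewrite (powR_Lnorm _ _ (lt0r_neq0 r0)).
have := hoelder mu mf mg p0 q0 pq; rewrite (LE f)// (LE g)// Lnorm1.
rewrite (@eq_integral _ _ _ mu setT (fun x => (f x * g x)%:E)) => [//|x _].
by rewrite /comp/= ger0_norm// mulr_ge0.
Qed.

Import HBNNSimple.

(** Both sides are monotone limits along the simple approximations of [f], and for an indicator the
    identity is the hypothesis on [nu]. It serves to pass from [vol] to Lebesgue measure. *)
Lemma ge0_integral_density mu nu (g : T -> R) :
  measurable_fun [set: T] g -> (forall x, 0 <= g x) ->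
  (forall A, measurable A -> nu A = \int[mu]_(x in A) (g x)%:E)%E ->
  forall f : T -> \bar R, measurable_fun [set: T] f -> (forall x, 0 <= f x)%E ->
  (\int[nu]_x f x = \int[mu]_x (f x * (g x)%:E))%E.
Proof.
move=> mg g0 nuE f mf f0.
pose h := nnsfun_approx measurableT mf.
have -> : (\int[nu]_x f x =
    lim (\int[nu]_x (EFin \o h n) x @[n --> \oo]))%E.
  have fE x : f x = lim ((EFin \o h n) x @[n --> \oo]).
    by apply/esym/cvg_lim => //; exact: cvg_nnsfun_approx.
  under eq_integral => x _ do rewrite fE.
  apply: monotone_convergence => //.
  - by move=> n; apply/measurable_EFinP.
  - by move=> n x _ //=; rewrite lee_fin.
  - by move=> x _ a b ab; rewrite lee_fin; exact/lefP/nd_nnsfun_approx.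
have -> : (\int[mu]_x (f x * (g x)%:E) =
    lim (\int[mu]_x ((EFin \o h n) x * (g x)%:E) @[n --> \oo]))%E.
  have fg x : (f x * (g x)%:E = lim (((EFin \o h n) x * (g x)%:E) @[n --> \oo]))%E.
    by apply/esym/cvg_lim => //; apply: cvgeZr => //; exact: cvg_nnsfun_approx.
  under eq_integral => x _ do rewrite fg.
  apply: monotone_convergence => //.
  - by move=> n; apply/emeasurable_funM; exact/measurable_EFinP.
  - by move=> n x Ex /=; rewrite mule_ge0 ?lee_fin.
  - by move=> x Ex a b ab/=; rewrite lee_wpmul2r ?lee_fin//; exact/lefP/nd_nnsfun_approx.
suff suf n : (\int[mu]_x ((EFin \o h n) x * (g x)%:E) =
    \int[nu]_x (EFin \o h n) x)%E by under eq_fun do rewrite -suf.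
transitivity (\int[nu]_x
   (\sum_(y \in range (h n)) (y * \1_(h n @^-1` [set y]) x)%:E))%E; last first.
  by apply: eq_integral => t tE; rewrite /= fimfunE -fsumEFin.
have indich m r : measurable_fun [set: T] (fun x => (r * \1_(h m @^-1` [set r]) x)%:E).
  by apply: (measurable_comp measurableT) => //; exact: measurable_funM.
rewrite ge0_integral_fsum//; last by move=> m y _; exact: nnfun_muleindic_ge0.
transitivity (\int[mu]_x (\sum_(y \in range (h n))
    (y * \1_(h n @^-1` [set y]) x)%:E * (g x)%:E))%E.
  under [RHS]eq_integral => x xE.
    rewrite -ge0_mule_fsuml => [|y]; last exact: nnfun_muleindic_ge0.
    rewrite fsumEFin // -(fimfunE _ x); over.
  by [].
rewrite ge0_integral_fsum//; last 2 first.
- by move=> y; apply: emeasurable_funM => //; exact/measurable_EFinP.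
- by move=> m y _; rewrite mule_ge0 ?lee_fin// -lee_fin nnfun_muleindic_ge0.
apply: eq_fsbigr => r rhn.
have r0 : 0 <= r by move: rhn; rewrite inE => -[t _ <-].
under [RHS]eq_integral do rewrite EFinM.
rewrite [RHS]ge0_integralZl//.
rewrite integral_indic// setIT nuE//.
under eq_integral do rewrite EFinM -muleA.
rewrite ge0_integralZl//; last 2 first.
- by apply: emeasurable_funM; apply/measurable_EFinP => //; exact: measurable_indic.
- by move=> t _; rewrite mule_ge0 ?lee_fin.
congr (_ * _)%E; rewrite -integral_mul_indic.
by apply: eq_integral => x _; rewrite -EFinM mulrC.
exact/measurable_EFinP/measurable_indic.
Qed.

End measure_extra.

(** * Layer-cake integration and interpolation *)

Section layer_cake.
Context d (T : measurableType d) (R : realType).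
Variable v : {sigma_finite_measure set T -> \bar R}.
Local Notation mu := (@lebesgue_measure R).
Local Notation TR := (measurableTypeR R).

Lemma integral_powR_indic (t A : R) : -1 < t -> 0 <= A ->
  (\int[mu]_l (l `^ t * \1_[set l : TR | 0 < l < A] l)%:E =
   (A `^ (t + 1) / (t + 1))%:E)%E.
Proof.
move=> t1 A0; rewrite -integral_powR// integral_mul_indic.
by congr integral; apply/seteqP; split => l /=; rewrite in_itv.
Qed.

Lemma measurable_layer (F : T -> R) : measurable_fun [set: T] F ->
  measurable [set z : T * TR | 0 < z.2 < F z.1].
Proof.
move=> mF.
rewrite (_ : [set _ | _] = [set z | 0 < z.2] `&` [set z | z.2 < F z.1]); last first.
  by apply/seteqP; split => z /= => [/andP[]|[-> ->]].
apply: measurableI; apply: measurable_set_ltr => //.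
exact: (measurableT_comp mF measurable_fst).
Qed.

Lemma layer_cake (F w : T -> R) (t : R) : -1 < t ->
  measurable_fun [set: T] F -> measurable_fun [set: T] w ->
  (forall x, 0 <= F x) -> (forall x, 0 <= w x) ->
  (\int[v]_x ((t + 1)^-1 * F x `^ (t + 1) * w x)%:E =
   \int[mu]_l \int[v]_x
     (l `^ t * (w x * \1_[set z : T * TR | 0 < z.2 < F z.1] (x, l)))%:E)%E.
Proof.
move=> t1 mF mw F0 w0.
have mG : measurable_fun [set: T * TR] (fun z : T * TR =>
   (z.2 `^ t * (w z.1 * \1_[set z : T * TR | 0 < z.2 < F z.1] z))%:E).
  apply/measurable_EFinP; apply: measurable_funM.
    exact: (measurableT_comp (measurable_powR _) measurable_snd).
  apply: measurable_funM; first exact: (measurableT_comp mw measurable_fst).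
  by apply: measurable_indic; exact: measurable_layer.
rewrite -(fubini_tonelli (fun z : T * TR =>
   (z.2 `^ t * (w z.1 * \1_[set z : T * TR | 0 < z.2 < F z.1] z))%:E)) //; last first.
  by move=> z; rewrite lee_fin !mulr_ge0 ?powR_ge0.
apply: eq_integral => x _ /=.
under eq_integral do rewrite mulrCA EFinM.
rewrite ge0_integralZl_EFin//; last 2 first.
- by move=> l _; rewrite lee_fin mulr_ge0 ?powR_ge0.
- apply/measurable_EFinP; apply: measurable_funM; first exact: measurable_powR.
  exact: (measurableT_comp (measurable_indic (measurable_layer mF)) (pair1_measurable x)).
rewrite mulrC EFinM mulrC; congr (_ * _)%E.
by rewrite -integral_powR_indic.
Qed.

Lemma measurable_layer_integral (F w : T -> R) (t : R) :
  measurable_fun [set: T] F -> measurable_fun [set: T] w ->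
  (forall x, 0 <= w x) ->
  measurable_fun [set: TR] (fun l => \int[v]_x
     (l `^ t * (w x * \1_[set z : T * TR | 0 < z.2 < F z.1] (x, l)))%:E)%E.
Proof.
move=> mF mw w0.
apply: (measurable_fun_fubini_tonelli_G (fun z : T * TR =>
   (z.2 `^ t * (w z.1 * \1_[set z : T * TR | 0 < z.2 < F z.1] z))%:E)).
  apply/measurable_EFinP; apply: measurable_funM.
    exact: (measurableT_comp (measurable_powR _) measurable_snd).
  apply: measurable_funM; first exact: (measurableT_comp mw measurable_fst).
  by apply: measurable_indic; exact: measurable_layer.
by move=> z; rewrite lee_fin !mulr_ge0 ?powR_ge0.
Qed.

(** Marcinkiewicz interpolation, starting from a weak-type bound already localised to the set where
    f exceeds l/2. The layer-cake formula is used with exponent q - 1 on the left and q - 2 on the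
    right, there with weight [f * t2] and level function [2 * f]; this reduces the claim to the
    hypothesis at each level. The condition q - 2 > -1 is where q > 1 enters. *)
Lemma strong_type_of_weak (F f t1 t2 : T -> R) (q C : R) : 1 < q -> 0 <= C ->
  measurable_fun [set: T] F -> measurable_fun [set: T] f ->
  measurable_fun [set: T] t1 -> measurable_fun [set: T] t2 ->
  (forall x, 0 <= F x) -> (forall x, 0 <= f x) ->
  (forall x, 0 <= t1 x) -> (forall x, 0 <= t2 x) ->
  (forall l : R, (0 < l)%R -> \int[v]_x (t1 x * \1_[set x | (l < F x)%R] x)%:E <=
    (C / l)%:E * \int[v]_x (f x * t2 x * \1_[set x | (l < 2 * f x)%R] x)%:E)%E ->
  (\int[v]_x (F x `^ q * t1 x)%:E <=
    (C * q * 2 `^ (q - 1) / (q - 1))%:E * \int[v]_x (f x `^ q * t2 x)%:E)%E.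
Proof.
move=> q1 C0 mF mf mt1 mt2 F0 f0 t10 t20 weak.
have q0 : 0 < q by rewrite (lt_trans ltr01).
have q10 : 0 < q - 1 by rewrite subr_gt0.
have m2f : measurable_fun [set: T] (fun x => 2 * f x) by exact: measurable_funM.
have mft2 : measurable_fun [set: T] (fun x => f x * t2 x) by exact: measurable_funM.
have ft20 x : 0 <= f x * t2 x by rewrite mulr_ge0.
have -> : (\int[v]_x (F x `^ q * t1 x)%:E = q%:E *
    \int[v]_x (((q - 1) + 1)^-1 * F x `^ ((q - 1) + 1) * t1 x)%:E)%E.
  rewrite -ge0_integralZl_EFin//; first last.
  - exact: ltW.
  - apply/measurable_EFinP; apply: measurable_funM => //; apply: measurable_funM => //.
    exact: (measurableT_comp (measurable_powR _)).
  - by move=> x _; rewrite lee_fin !mulr_ge0 ?powR_ge0// invr_ge0 subrK ltW.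
  apply: eq_integral => x _; rewrite -EFinM subrK !mulrA divff ?mul1r//.
  by rewrite gt_eqF.
rewrite layer_cake//; last by rewrite (lt_trans _ q10)// ltrN10.
have -> : (\int[v]_x (f x `^ q * t2 x)%:E = ((q - 1) / 2 `^ (q - 1))%:E *
    \int[v]_x (((q - 2) + 1)^-1 * (2 * f x) `^ ((q - 2) + 1) * (f x * t2 x))%:E)%E.
  have e : q - 2 + 1 = q - 1 by ring.
  rewrite -ge0_integralZl_EFin//; first last.
  - by rewrite divr_ge0 ?powR_ge0// ltW.
  - apply/measurable_EFinP; apply: measurable_funM => //; apply: measurable_funM => //.
    exact: (measurableT_comp (measurable_powR _)).
  - by move=> x _; rewrite lee_fin !mulr_ge0 ?powR_ge0// invr_ge0 e ltW.
  apply: eq_integral => x _; rewrite -EFinM e powRM//; congr EFin.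
  rewrite -(mulr_powRB1 (f0 x) q0); field.
  by rewrite gt_eqF ?powR_gt0//= gt_eqF.
rewrite layer_cake//; last 2 first.
- lra.
- by move=> x; rewrite mulr_ge0.
rewrite muleA -EFinM.
have -> : C * q * 2 `^ (q - 1) / (q - 1) * ((q - 1) / 2 `^ (q - 1)) = q * C.
  by field; rewrite gt_eqF ?powR_gt0//= gt_eqF.
rewrite EFinM -muleA; apply: lee_wpmul2l; first by rewrite lee_fin ltW.
rewrite -ge0_integralZl_EFin//; first last.
- exact: (measurable_layer_integral _ m2f mft2).
- by move=> l _; apply: integral_ge0 => x _; rewrite lee_fin !mulr_ge0 ?powR_ge0.
apply: ge0_le_integral => //.
- by move=> l _; apply: integral_ge0 => x _; rewrite lee_fin !mulr_ge0 ?powR_ge0.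
- exact: (measurable_layer_integral _ mF mt1).
- by apply: emeasurable_funM => //; exact: (measurable_layer_integral _ m2f mft2).
move=> l _; have [l0|l0] := leP l 0.
  rewrite integral0_eq//; first by rewrite mule_ge0 ?lee_fin// integral_ge0// => x _;
    rewrite lee_fin !mulr_ge0 ?powR_ge0.
  by move=> x _; rewrite indicE memNset ?mulr0//= ltNge l0.
have indE (G : T -> R) x :
    \1_[set z : T * TR | 0 < z.2 < G z.1] (x, l) = \1_[set x | l < G x] x :> R.
  rewrite !indicE; congr (_%:R); congr (nat_of_bool _).
  by apply/idP/idP; rewrite !inE/= l0.
under eq_integral do rewrite indE EFinM.
under [X in (_ <= _ * X)%E]eq_integral do rewrite (indE (fun x => 2 * f x)) EFinM.
rewrite !ge0_integralZl_EFin ?powR_ge0//; first last.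
- apply/measurable_EFinP; apply: measurable_funM => //.
  by apply: measurable_indic; exact: measurable_set_ltr.
- by move=> x _; rewrite lee_fin mulr_ge0.
- apply/measurable_EFinP; apply: measurable_funM => //.
  by apply: measurable_indic; exact: measurable_set_ltr.
- by move=> x _; rewrite lee_fin mulr_ge0.
apply: (@le_trans _ _ ((l `^ (q - 1))%:E * ((C / l)%:E *
   \int[v]_x (f x * t2 x * \1_[set x | (l < 2 * f x)%R] x)%:E))%E).
  by apply: lee_wpmul2l; rewrite ?lee_fin ?powR_ge0// weak.
rewrite !muleA -!EFinM le_eqVlt; apply/orP; left; apply/eqP; congr (_%:E * _)%E.
have -> : q - 1 = q - 2 + 1 by ring.
rewrite (@powRD _ l (q - 2) 1); last by rewrite (gt_eqF l0) implybT.
by rewrite powRr1 ?ltW//; field; rewrite gt_eqF.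
Qed.

End layer_cake.

(** * Countable families of sets and Vitali selection *)

Section countable_families.
Context d (X : measurableType d) (R : realType).

(** The [A i] may overlap while the [B i] are disjoint: subadditivity on one side, additivity on the
    other. The injection [e] into nat makes each [J n] empty or a singleton, which turns the family
    into a sequence. *)
Lemma le_integral_countable_bigcup (mu : {measure set X -> \bar R}) (I : Type)
    (D : set I) (A B : I -> set X) (g h : X -> \bar R) :
  countable D -> trivIset D B ->
  (forall i, measurable (A i)) -> (forall i, measurable (B i)) ->
  measurable_fun [set: X] g -> measurable_fun [set: X] h ->
  (forall x, 0 <= g x)%E -> (forall x, 0 <= h x)%E ->
  (forall i, D i -> \int[mu]_(x in A i) g x <= \int[mu]_(x in B i) h x)%E ->
  (\int[mu]_(x in \bigcup_(i in D) A i) g x <= \int[mu]_x h x)%E.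
Proof.
move=> /countable_injP[e] e_inj tB mA mB mg mh g0 h0 AB.
pose J n := [set i | D i /\ e i = n].
have J1 n : J n = set0 \/ exists2 i, D i & J n = [set i].
  have [->|/set0P[i [Di ei]]] := eqVneq (J n) set0; first by left.
  right; exists i => //; apply/seteqP; split => [j [Dj ej]|_ ->]//.
  by apply: e_inj; rewrite ?inE// ej.
pose A' n := \bigcup_(i in J n) A i.
pose B' n := \bigcup_(i in J n) B i.
have mA' n : measurable (A' n).
  by rewrite /A'; case: (J1 n) => [->|[i _ ->]]; rewrite ?bigcup_set0// bigcup_set1.
have mB' n : measurable (B' n).
  by rewrite /B'; case: (J1 n) => [->|[i _ ->]]; rewrite ?bigcup_set0// bigcup_set1.
have -> : \bigcup_(i in D) A i = \bigcup_n A' n.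
  apply/seteqP; split => x [].
    by move=> i Di Ax; exists (e i) => //; exists i.
  by move=> n _ [i [Di _] Ax]; exists i.
have tB' : trivIset [set: nat] B'.
  move=> m n _ _ [x [[i [Di ei] Bi] [j [Dj ej] Bj]]].
  by rewrite -ei -ej (tB i j Di Dj)//; exists x.
rewrite seqDU_bigcup_eq ge0_integral_bigcup//; first last.
- exact: measurable_funTS.
- by move=> n; apply: measurableD => //; exact: bigsetU_measurable.
apply: (@le_trans _ _ (\sum_(0 <= n <oo) \int[mu]_(x in B' n) h x)%E).
  apply: lee_nneseries => [n _ _|n _]; first exact: integral_ge0.
  apply: (@le_trans _ _ (\int[mu]_(x in A' n) g x)%E).
    apply: ge0_subset_integral => //.
    - by apply: measurableD => //; exact: bigsetU_measurable.
    - exact: measurable_funTS.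
    - exact: subDsetl.
  rewrite /A' /B'; case: (J1 n) => [->|[i Di ->]]; rewrite ?bigcup_set1 ?AB//.
  by rewrite !bigcup_set0 !integral_set0.
rewrite -ge0_integral_bigcup//; first last.
- exact: measurable_funTS.
apply: ge0_subset_integral => //; exact: bigcupT_measurable.
Qed.

Lemma countable_bigcup_measurable (I : Type) (D : set I) (A : I -> set X) :
  countable D -> (forall i, measurable (A i)) -> measurable (\bigcup_(i in D) A i).
Proof.
move=> /countable_injP[e] e_inj mA.
rewrite (_ : \bigcup_(i in D) A i =
    \bigcup_n \bigcup_(i in [set i | D i /\ e i = n]) A i); last first.
  apply/seteqP; split => x [].
    by move=> i Di Ax; exists (e i) => //; exists i.
  by move=> n _ [i [Di _] Ax]; exists i.
apply: bigcupT_measurable => n.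
have [->|/set0P[i [Di ei]]] := eqVneq [set i | D i /\ e i = n] set0.
  by rewrite bigcup_set0.
rewrite (_ : [set i | _] = [set i]) ?bigcup_set1//.
apply/seteqP; split => [j [Dj ej]|_ ->]//.
by apply: e_inj; rewrite ?inE// ej.
Qed.

(** Only finitely many disjoint sets can have measure at least 1/(n+1). A selection made by Zorn's
    lemma has no enumeration; this supplies one. *)
Lemma trivIset_countable (mu : {finite_measure set X -> \bar R}) (I : choiceType)
    (D : set I) (F : I -> set X) :
  trivIset D F -> (forall i, measurable (F i)) ->
  (forall i, D i -> 0 < mu (F i))%E -> countable D.
Proof.
move=> tF mF F0.
pose Dn n := [set i | D i /\ (n.+1%:R^-1%:E <= mu (F i))%E].
have -> : D = \bigcup_n Dn n.
  apply/seteqP; split => [i Di|i [n _ []]]//.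
  have m0 : 0 < fine (mu (F i)).
    by rewrite fine_gt0// F0//= ltey_eq fin_num_measure.
  exists (Num.truncn (fine (mu (F i)))^-1) => //; split => //.
  rewrite -[leRHS]fineK ?fin_num_measure// lee_fin invf_ple ?posrE ?ltr0n//.
  exact/ltW/truncnS_gt.
apply: bigcup_countable => // n _; apply: finite_set_countable.
apply: contrapT => /infinite_set_fset.
pose M := fine (mu [set: X]).
move=> /(_ (Num.truncn (M * n.+1%:R)).+1)[B BD sB].
have : (mu (\big[setU/set0]_(i <- finmap.enum_fset B) F i) <= M%:E)%E.
  by rewrite /M fineK ?fin_num_measure//; apply: le_measure; rewrite ?inE//;
    exact: bigsetU_measurable.
rewrite measure_fbigsetU//; last first.
  by move=> i j iB jB; apply: tF; [have [] := BD _ iB|have [] := BD _ jB].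
apply/negP; rewrite -ltNge.
apply: (@lt_le_trans _ _ (\sum_(i <- finmap.enum_fset B) n.+1%:R^-1%:E)%E); last first.
  rewrite big_seq [leRHS]big_seq; apply: lee_sum => i iB.
  by have [] := BD _ iB.
rewrite sumEFin lte_fin big_const_seq count_predT iter_addr_0.
rewrite -[ltRHS]mulr_natl ltr_pdivlMr ?ltr0n//.
by rewrite (lt_le_trans (truncnS_gt _))// ler_nat.
Qed.

End countable_families.

Section vitali.
Variables (R : realType) (X : Type) (T : X -> set X) (rh : X -> R).
Hypothesis T_refl : forall x, T x x.
Hypothesis rh_gt0 : forall x, 0 < rh x.
Hypothesis rh_le1 : forall x, rh x <= 1.

(** Zorn's lemma is applied to disjoint subfamilies D with a property that passes to unions of
    chains: each member of Z that meets D at all meets a member of D of at least half its radius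
    [rh]. If some members of Z missed a maximal D, one of them with radius above half their supremum
    could be added. *)
Lemma vitali_selection (Z : set X) :
  exists D : set X, [/\ D `<=` Z, trivIset D T &
    forall x, Z x -> exists2 y, D y & T x `&` T y !=set0 /\ rh x <= 2 * rh y].
Proof.
pose P D := [/\ D `<=` Z, trivIset D T &
  forall x y, Z x -> D y -> T x `&` T y !=set0 ->
  exists2 y, D y & T x `&` T y !=set0 /\ rh x <= 2 * rh y].
have [|D [[DZ tD PD] maxD]] := @Zorn_bigcup _ P.
  move=> F FP Ftot; split.
  - by move=> x [D FD Dx]; have [DZ _ _] := FP _ FD; exact: DZ.
  - move=> x y [D FD Dx] [D' FD' Dy].
    have [_ tD _] := FP _ FD; have [_ tD' _] := FP _ FD'.
    by have [DD'|D'D] := Ftot _ _ FD FD'; [apply: tD' => //; exact: DD'|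
      apply: tD => //; exact: D'D].
  - move=> x y Zx [D FD Dy] xy.
    have [_ _ /(_ x y Zx Dy)] := FP _ FD.
    by move=> /(_ xy)[y' Dy' h]; exists y' => //; exists D.
exists D; split => // x Zx; apply: contrapT => nx.
pose W := [set x | Z x /\ forall y, D y -> ~ (T x `&` T y !=set0)].
have Wx : W x by split => // y Dy xy; apply: nx; exact: PD xy.
have supW : has_sup (rh @` W).
  split; first by exists (rh x), x.
  by exists 1 => _ [y _ <-].
have s0 : 0 < sup (rh @` W).
  by rewrite (lt_le_trans (rh_gt0 x))//; apply: ub_le_sup; [exact: supW.2|exists x].
have [_ [z Wz <-] hz] : exists2 r, (rh @` W) r & sup (rh @` W) / 2 < r.
  by apply: sup_gt; [exact: supW.1|rewrite ltr_pdivrMr// ltr_pMr// ltr1n].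
have Wle y : W y -> rh y <= 2 * rh z.
  move=> Wy; rewrite (@le_trans _ _ (sup (rh @` W)))//.
    by apply: ub_le_sup; [exact: supW.2|exists y].
  by rewrite mulrC -ler_pdivrMr// ltW.
apply: (maxD (D `|` [set z])).
  split; first exact: subsetUl.
  move=> /(_ z (or_intror erefl)) Dz.
  by apply: (Wz.2 z Dz); exists z; split.
split.
- by move=> y [/DZ//|->]; exact: Wz.1.
- move=> y y' [Dy|->] [Dy'|->]//.
  + exact: tD.
  + by rewrite setIC => /(Wz.2 _ Dy).
  + by move=> /(Wz.2 _ Dy').
- move=> y y' Zy Dy' yy'.
  have [Wy|nWy] := pselect (W y).
    case: Dy' yy' => [Dy' /(Wy.2 _ Dy')//|->] yz.
    by exists z; [right|split => //; exact: Wle].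
  have [y'' Dy'' yy''] : exists2 y'', D y'' & T y `&` T y'' !=set0.
    apply: contrapT => h; apply: nWy; split => // y'' Dy'' yy''.
    by apply: h; exists y''.
  by have [w Dw ?] := PD _ _ Zy Dy'' yy''; exists w => //; left.
Qed.

End vitali.

Section mass.
Context d (X : measurableType d) (R : realType).
Variable v : {finite_measure set X -> \bar R}.
Implicit Types (w a b : X -> R) (A : set X).

(** [fine] sends an infinite integral to 0, so masses are compared only under a finiteness
    hypothesis such as [wfin] below. *)
Definition mass w A : R := fine (\int[v]_(x in A) (w x)%:E).

Definition nonneg_mfun w := measurable_fun [set: X] w /\ forall x, 0 <= w x.

Lemma nonneg_mfunM a b : nonneg_mfun a -> nonneg_mfun b ->
  nonneg_mfun (fun x => a x * b x).
Proof.
by move=> [ma a0] [mb b0]; split => [|x]; [exact: measurable_funM|rewrite mulr_ge0].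
Qed.

Lemma nonneg_mfun_powR a t : nonneg_mfun a -> nonneg_mfun (fun x => a x `^ t).
Proof.
move=> [ma a0]; split => [|x]; last exact: powR_ge0.
exact: (measurableT_comp (measurable_powR _)).
Qed.

Lemma nonneg_mfun_indic A : measurable A -> nonneg_mfun (\1_A : X -> R).
Proof. by move=> mA; split => [|x]; [exact: measurable_indic|rewrite indicE]. Qed.

Lemma mass_ge0 w A : nonneg_mfun w -> 0 <= mass w A.
Proof. by move=> [_ w0]; rewrite fine_ge0// integral_ge0// => x _; rewrite lee_fin. Qed.

Section finite_mass.
Variable w : X -> R.
Hypothesis mw : nonneg_mfun w.
Hypothesis wfin : (\int[v]_x (w x)%:E < +oo)%E.

Lemma mass_fin_num A : measurable A -> (\int[v]_(x in A) (w x)%:E)%E \is a fin_num.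
Proof.
have [mw1 w0] := mw.
move=> mA; rewrite ge0_fin_numE; last by apply: integral_ge0 => x _; rewrite lee_fin.
apply: le_lt_trans wfin; apply: ge0_subset_integral => //.
- exact/measurable_EFinP.
- by move=> x _; rewrite lee_fin.
Qed.

Lemma massE A : measurable A -> (mass w A)%:E = (\int[v]_(x in A) (w x)%:E)%E.
Proof. by move=> mA; rewrite fineK// mass_fin_num. Qed.

Lemma le_mass A B : measurable A -> measurable B -> A `<=` B ->
  mass w A <= mass w B.
Proof.
have [mw1 w0] := mw.
move=> mA mB AB; rewrite -lee_fin !massE//; apply: ge0_subset_integral => //.
- exact/measurable_funTS/measurable_EFinP.
- by move=> x _; rewrite lee_fin.
Qed.

End finite_mass.

Lemma measurable_section (S : set (X * X)) (z : X) : measurable S ->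
  measurable [set x | S (x, z)].
Proof.
move=> mS; have := measurable_ysection z mS.
by congr measurable; apply/seteqP; split => x; rewrite /ysection/= inE.
Qed.

Lemma measurable_section2 (S : set (X * X)) (x : X) : measurable S ->
  measurable [set z | S (x, z)].
Proof.
move=> mS; have := measurable_xsection x mS.
by congr measurable; apply/seteqP; split => z; rewrite /xsection/= inE.
Qed.

Let indic_sectionE (S : set (X * X)) (x z : X) :
  \1_S (x, z) = \1_[set x | S (x, z)] x :> R.
Proof. by rewrite !indicE; congr (nat_of_bool _)%:R; apply/idP/idP; rewrite !inE. Qed.

Let indic_section2E (S : set (X * X)) (x z : X) :
  \1_S (x, z) = \1_[set z | S (x, z)] z :> R.
Proof. by rewrite !indicE; congr (nat_of_bool _)%:R; apply/idP/idP; rewrite !inE. Qed.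

Lemma measurable_integral_section (S : set (X * X)) w : measurable S ->
  nonneg_mfun w ->
  measurable_fun [set: X] (fun z => \int[v]_(x in [set x | S (x, z)]) (w x)%:E)%E.
Proof.
move=> mS [mw w0].
have := @measurable_fun_fubini_tonelli_G _ _ X X R v (fun z => (w z.1 * \1_S z)%:E).
rewrite [X in _ -> _ -> measurable_fun _ X](_ : _ =
  fun z => \int[v]_(x in [set x | S (x, z)]) (w x)%:E)%E; last first.
  apply/funext => z; rewrite /fubini_G -[RHS]integral_mul_indic.
  by apply: eq_integral => x _ /=; rewrite indic_sectionE.
apply => [|z]; last by rewrite lee_fin mulr_ge0.
apply/measurable_EFinP; apply: measurable_funM; last exact: measurable_indic.
exact: (measurableT_comp mw measurable_fst).
Qed.

Lemma nonneg_mfun_mass (S : set (X * X)) w : measurable S -> nonneg_mfun w ->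
  nonneg_mfun (fun z => mass w [set x | S (x, z)]).
Proof.
move=> mS mw; split => [|z]; last exact: mass_ge0.
exact: (measurableT_comp (fine_measurable measurableT) (measurable_integral_section mS mw)).
Qed.

Lemma tonelli_section (S : set (X * X)) a b : measurable S ->
  nonneg_mfun a -> nonneg_mfun b ->
  (\int[v]_z ((a z)%:E * \int[v]_(x in [set x | S (x, z)]) (b x)%:E) =
   \int[v]_x ((b x)%:E * \int[v]_(z in [set z | S (x, z)]) (a z)%:E))%E.
Proof.
move=> mS [ma a0] [mb b0].
have mG : measurable_fun [set: X * X] (fun z : X * X => (a z.2 * (b z.1 * \1_S z))%:E).
  apply/measurable_EFinP; apply: measurable_funM.
    exact: (measurableT_comp ma measurable_snd).
  apply: measurable_funM; last exact: measurable_indic.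
  exact: (measurableT_comp mb measurable_fst).
transitivity (\int[v]_z \int[v]_x (a z * (b x * \1_S (x, z)))%:E)%E.
  apply: eq_integral => z _; rewrite -[in LHS]integral_mul_indic.
  rewrite -ge0_integralZl_EFin//; first last.
  - apply/measurable_EFinP; apply: measurable_funM => //.
    by apply: measurable_indic; exact: measurable_section.
  - by move=> x _; rewrite lee_fin mulr_ge0.
have /= <- := @fubini_tonelli _ _ X X R v v _ mG; last first.
  by move=> z; rewrite lee_fin !mulr_ge0.
apply: eq_integral => x _; rewrite -[in RHS]integral_mul_indic.
rewrite -ge0_integralZl_EFin//; first last.
- apply/measurable_EFinP; apply: measurable_funM => //.
  by apply: measurable_indic; exact: measurable_section2.
- by move=> z _; rewrite lee_fin mulr_ge0.
by apply: eq_integral => z _; rewrite -EFinM indic_section2E mulrCA.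
Qed.
Lemma integral_pos_gt0 w A : measurable A -> measurable_fun [set: X] w ->
  (forall x, 0 < w x) -> (0 < v A)%E -> (0 < \int[v]_(x in A) (w x)%:E)%E.
Proof.
move=> mA mw w0 vA; rewrite lt0e; apply/andP; split; last first.
  by apply: integral_ge0 => x _; rewrite lee_fin ltW.
apply/eqP => int0; move: vA; rewrite lt0e => /andP[/eqP + _]; apply.
have : (\int[v]_(x in A) `|(w x)%:E|)%E = 0%E.
  by rewrite -int0; apply: eq_integral => x _; rewrite gee0_abs// lee_fin ltW.
have mw' : measurable_fun A (EFin \o w) by exact/measurable_funTS/measurable_EFinP.
move=> /(ae_eq_integral_abs v mA mw')[M [mM M0 AM]].
apply/eqP; rewrite eq_le measure_ge0 andbT -M0; apply: le_measure; rewrite ?inE//.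
move=> x Ax; apply: AM => /(_ Ax)/= [wx0].
by have := w0 x; rewrite wx0 ltxx.
Qed.
End mass.

(** * Tent spaces and the Carleson embedding *)

Section homogeneous_tents.
Context d (X : measurableType d) (R : realType).
Variable v : {finite_measure set X -> \bar R}.
Variables (dl : X -> X -> R) (rh : X -> R) (N s kp c0 C0 : R).

Definition tent t z := [set x | dl x z < t * rh z].
(* The part of the tent at a height comparable to its own. *)
Definition core z := [set x | dl x z < s * rh z /\ kp * rh z <= rh x].
Definition link x y :=
  [set z | [/\ dl x z < s * rh z, dl y z < s * rh z & rh z <= dl x y]].

(* [dl x y] plays the role of |1 - <x,y>| and [rh x] of 1 - |x|^2; [dl] is not a
   distance, since [dl x x = rh x]. *)
Record tent_space : Prop := TentSpace {
  measurable_dl : measurable_fun [set: X * X] (fun z : X * X => dl z.1 z.2) ;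
  measurable_rh : measurable_fun [set: X] rh ;
  dlC : forall x y, dl x y = dl y x ;
  dl_tri : forall x y z, dl x z <= 2 * (dl x y + dl y z) ;
  dl_refl : forall x, dl x x = rh x ;
  rh_le_dl : forall x y, rh x <= 2 * dl x y ;
  rh_gt0 : forall x, 0 < rh x ;
  rh_le1 : forall x, rh x <= 1 ;
  s_gt1 : 1 < s ;
  kp_gt0 : 0 < kp ;
  kp_le1 : kp <= 1 ;
  N_gt0 : 0 < N ;
  c0_gt0 : 0 < c0 ;
  C0_gt0 : 0 < C0 ;
  v_tent_le : forall x r, rh x <= r ->
    (v [set y | (dl y x < r)%R] <= (C0 * r `^ N)%:E)%E ;
  v_core_ge : forall z, ((c0 * rh z `^ N)%:E <= v (core z))%E ;
  v_link_ge : forall x y, ((c0 * dl x y `^ N)%:E <= v (link x y))%E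
}.

Hypothesis H : tent_space.

Let mdl := measurable_dl H.
Let mrh := measurable_rh H.
Let rh0 x : 0 < rh x := rh_gt0 H x.
Let s1 := s_gt1 H.
Let s0 : 0 < s := lt_trans ltr01 s1.
Let kp0 := kp_gt0 H.
Let N0 := N_gt0 H.

Let tentS t := [set z : X * X | dl z.1 z.2 < t * rh z.2].
Let coreS := [set z : X * X | dl z.1 z.2 < s * rh z.2 /\ kp * rh z.2 <= rh z.1].

Let mrh1 : measurable_fun [set: X * X] (fun z : X * X => rh z.1).
Proof. exact: (measurableT_comp mrh measurable_fst). Qed.

Let mrh2 : measurable_fun [set: X * X] (fun z : X * X => rh z.2).
Proof. exact: (measurableT_comp mrh measurable_snd). Qed.

Let mtentS t : measurable (tentS t).
Proof. by apply: measurable_set_ltr => //; exact: measurable_funM. Qed.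

Let mcoreS : measurable coreS.
Proof.
apply: measurableI; first exact: mtentS.
by apply: measurable_set_ler => //; exact: measurable_funM.
Qed.

Lemma measurable_tent t z : measurable (tent t z).
Proof. exact: (measurable_section z (mtentS t)). Qed.

Lemma measurable_core z : measurable (core z).
Proof. exact: (measurable_section z mcoreS). Qed.

Lemma core_tent z : core z `<=` tent s z.
Proof. by move=> x []. Qed.

Lemma tent_sub18 z : tent s z `<=` tent (18 * s) z.
Proof.
move=> x /lt_trans; apply; rewrite ltr_pM2r// ltr_pMl//; lra.
Qed.

(** Two uses of [dl_tri] through the common point give d(w,y) < 8 s rh x + 2 s rh y, and rh x <= 2
    rh y turns this into 16 + 2 = 18. *)
Lemma tent_engulf x y : tent s x `&` tent s y !=set0 -> rh x <= 2 * rh y ->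
  tent s x `<=` tent (18 * s) y.
Proof.
move=> [z [zx zy]] xy w wx; rewrite /tent/= in zx zy wx *.
have h1 := dl_tri H w z y; have h2 := dl_tri H w x z.
rewrite (dlC H x z) in h2.
have h3 : s * rh x <= s * (2 * rh y) by rewrite ler_pM2l.
have h4 := rh0 y; lra.
Qed.

Let nonneg_rh t : nonneg_mfun (fun z => rh z `^ t).
Proof. by apply: nonneg_mfun_powR; split => // x; exact: ltW. Qed.

Let C2 := (2 * s) `^ N * (C0 * (s / kp) `^ N).

Let C2_gt0 : 0 < C2.
Proof. by rewrite !mulr_gt0 ?powR_gt0 ?divr_gt0 ?mulr_gt0 ?(C0_gt0 H). Qed.

(** Bounded overlap of the cores, in integrated form. A centre z whose core contains x has height
    comparable to that of x: rh x <= 2 d(x,z) < 2 s rh z on one side, kp rh z <= rh x on the other.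
    Such z lie within s/kp rh x of x, a set whose volume cancels the factor rh^(-N). *)
Lemma core_multiplicity x :
  (\int[v]_(z in [set z | core z x]) (rh z `^ (- N))%:E <= C2%:E)%E.
Proof.
have mS : measurable [set z | core z x] by exact: (measurable_section2 x mcoreS).
apply: (@le_trans _ _ (\int[v]_(z in [set z | core z x]) ((2 * s) `^ N * rh x `^ (- N))%:E)%E).
  apply: ge0_le_integral => //.
  - by move=> z _; rewrite lee_fin powR_ge0.
  - by apply/measurable_funTS/measurable_EFinP; have [] := nonneg_rh (- N).
  - move=> z [xz _]; rewrite lee_fin !powRN.
    rewrite ler_pdivlMr ?powR_gt0// mulrC ler_pdivrMr ?powR_gt0//.
    rewrite -powRM ?(ltW (rh0 _)) ?mulr_ge0 ?(ltW s0)//.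
    rewrite ge0_ler_powR ?(ltW N0) ?nnegrE ?mulr_ge0 ?(ltW s0) ?(ltW (rh0 _))//.
    by have := rh_le_dl H x z; rewrite -mulrA => /le_trans; apply; rewrite ler_pM2l// ltW.
rewrite integral_cst//.
have sk : 1 <= s / kp by rewrite ler_pdivlMr// mul1r (le_trans (kp_le1 H))// ltW.
apply: (@le_trans _ _ (((2 * s) `^ N * rh x `^ (- N))%:E *
   (C0 * (s / kp * rh x) `^ N)%:E)%E).
  apply: lee_wpmul2l; first by rewrite lee_fin mulr_ge0 ?powR_ge0.
  have hr : rh x <= s / kp * rh x by rewrite ler_peMl// ltW.
  apply: (le_trans _ (v_tent_le H hr)).
  apply: le_measure; rewrite ?inE//.
    by apply: measurable_set_ltr => //; exact: (measurableT_comp mdl (pair2_measurable _)).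
  move=> z [/= xz kz]; rewrite (dlC H) (lt_le_trans xz)//.
  by rewrite -mulrA ler_pM2l// mulrC ler_pdivlMr// mulrC.
rewrite -EFinM lee_fin (@powRM _ (s / kp)) ?divr_ge0 ?(ltW s0) ?(ltW kp0) ?(ltW (rh0 _))//.
rewrite le_eqVlt; apply/orP; left; apply/eqP; rewrite /C2 powRN; field.
by rewrite gt_eqF ?powR_gt0.
Qed.

Section embedding.
Variables (w f : X -> R).
Hypothesis mw : nonneg_mfun w.
Hypothesis wfin : (\int[v]_x (w x)%:E < +oo)%E.
Hypothesis mf : nonneg_mfun f.
Hypothesis ffin : (\int[v]_x (f x * w x)%:E < +oo)%E.

Let core_weight z := rh z `^ (- N) * mass v w (core z).

(* Vitali selection: disjoint small tents carry the mass of [f w], and the cores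
   under the level set lie in their 18-fold dilates. *)
Lemma weak_embedding (l : R) : 0 < l ->
  (\int[v]_z (core_weight z *
     \1_[set z | (l * mass v w (tent (18 * s) z) <
        mass v (fun x => f x * w x) (tent s z))%R] z)%:E <=
   (C2 / l)%:E * \int[v]_x (f x * w x)%:E)%E.
Proof.
move=> l0; set Z := [set z | _].
have [_ w0] := mw.
have mfw := nonneg_mfunM mf mw.
have mZ : measurable Z.
  apply: measurable_set_ltr.
    apply: measurable_funM => //.
    by have [] := nonneg_mfun_mass v (mtentS (18 * s)) mw.
  by have [] := nonneg_mfun_mass v (mtentS s) mfw.
have [D [DZ tD coverD]] : exists D : set X, [/\ D `<=` Z, trivIset D (tent s) &
    forall x, Z x -> exists2 y, D y & tent s x `&` tent s y !=set0 /\ rh x <= 2 * rh y].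
  apply: vitali_selection => //; last exact: rh_le1 H.
  by move=> x; rewrite /tent/= (dl_refl H) ltr_pMl.
have cD : countable D.
  apply: (@trivIset_countable _ _ _ v _ D (tent s)) => // [z|z _].
    exact: measurable_tent.
  apply: (@lt_le_trans _ _ (v (core z))).
    apply: lt_le_trans (v_core_ge H z).
    by rewrite lte_fin mulr_gt0 ?powR_gt0 ?(c0_gt0 H).
  by apply: le_measure; rewrite ?inE; [exact: measurable_core|exact: measurable_tent|exact: core_tent].
pose V := \bigcup_(y in D) tent (18 * s) y.
have mV : measurable V.
  by apply: countable_bigcup_measurable => // y; exact: measurable_tent.
have coreV x z : Z z -> core z x -> V x.
  move=> Zz zx; have [y Dy [zy ry]] := coverD _ Zz.
  by exists y => //; apply: (tent_engulf zy ry); exact: core_tent.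
have mr1 : nonneg_mfun (fun z => rh z `^ (- N) * \1_Z z).
  by apply: nonneg_mfunM; [exact: nonneg_rh|exact: nonneg_mfun_indic].
(* Tonelli exchanges centre and point: the integral becomes that of [w] against the multiplicity of
   the cores with centre in Z, which is at most C2 and vanishes off V. *)
apply: (@le_trans _ _ (\int[v]_z ((rh z `^ (- N) * \1_Z z)%:E *
    \int[v]_(x in [set x | coreS (x, z)]) (w x)%:E))%E).
  rewrite le_eqVlt; apply/orP; left; apply/eqP; apply: eq_integral => z _.
  by rewrite -massE ?EFinM//; [rewrite -!EFinM mulrAC|exact: measurable_core].
rewrite (tonelli_section v mcoreS mr1 mw).
apply: (@le_trans _ _ (\int[v]_(x in V) (C2 * w x)%:E)%E).
  rewrite -[leRHS]integral_mul_indic; apply: ge0_le_integral => //.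
  - move=> x _; apply: mule_ge0; first by rewrite lee_fin.
    by apply: integral_ge0 => z _; rewrite lee_fin; have [_ ->] := mr1.
  - apply: emeasurable_funM; first by apply/measurable_EFinP; have [] := mw.
    pose S := [set z : X * X | coreS (z.2, z.1)].
    have mS : measurable S.
      by have := @measurable_swap _ _ X X measurableT _ mcoreS; rewrite setTI.
    exact: (measurable_integral_section v mS mr1).
  - apply/measurable_EFinP; apply: measurable_funM; last exact: measurable_indic.
    by apply: measurable_funM => //; have [] := mw.
  move=> x _; have [Vx|nVx] := pselect (V x).
    rewrite indicE mem_set// mulr1 [(C2 * _)%R]mulrC EFinM.
    apply: lee_wpmul2l; first by rewrite lee_fin.
    apply: le_trans (core_multiplicity x).
    apply: ge0_le_integral => //.
    - exact: measurable_section2.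
    - by move=> z _; rewrite lee_fin; have [_ ->] := mr1.
    - by apply/measurable_funTS/measurable_EFinP; have [] := mr1.
    - by apply/measurable_funTS/measurable_EFinP; have [] := nonneg_rh (- N).
    - move=> z _; rewrite lee_fin ler_piMr ?powR_ge0// indicE lern1 leq_b1.
  rewrite indicE memNset// mulr0 integral0_eq ?mule0// => z xz.
  rewrite indicE memNset ?mulr0// => Zz; apply: nVx; exact: coreV xz.
under eq_integral do rewrite EFinM.
rewrite ge0_integralZl_EFin ?(ltW C2_gt0)//; first last.
- by apply/measurable_funTS/measurable_EFinP; have [] := mw.
- by move=> x _; rewrite lee_fin.
rewrite (EFinM C2 l^-1) -muleA; apply: lee_wpmul2l; first by rewrite lee_fin ltW.
rewrite -ge0_integralZl_EFin ?invr_ge0 ?(ltW l0)//; first last.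
- by apply/measurable_EFinP; have [] := mfw.
- by move=> x _; rewrite lee_fin; have [_ ->] := mfw.
have mfw' : measurable_fun [set: X] (fun x => (f x * w x)%:E).
  by apply/measurable_EFinP; have [] := mfw.
(* Each y of D lies in Z, so the dilated tent has [w]-mass at most 1/l times the mass of [f w] on
   the tent itself, and the latter tents are disjoint. *)
apply: (@le_integral_countable_bigcup _ _ _ v X D (tent (18 * s)) (tent s)
  (fun x => (w x)%:E) (fun x => (l^-1)%:E * (f x * w x)%:E)%E) => //.
- by move=> z; exact: measurable_tent.
- by move=> z; exact: measurable_tent.
- by apply/measurable_EFinP; have [] := mw.
- exact: emeasurable_funM.
- move=> x; rewrite mule_ge0 ?lee_fin ?invr_ge0 ?(ltW l0)//.
  by have [_ ->] := mfw.
move=> y /DZ; rewrite /Z/= => hy.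
rewrite ge0_integralZl_EFin ?invr_ge0 ?(ltW l0)//; first last.
- exact: measurable_funTS.
- by move=> x _; rewrite lee_fin; have [_ ->] := mfw.
- exact: measurable_tent.
rewrite -(massE mw wfin); last exact: measurable_tent.
rewrite -(massE mfw ffin); last exact: measurable_tent.
by rewrite -EFinM lee_fin ler_pdivlMl// ltW.
Qed.

End embedding.
(** Density, on the space of centres, of a Carleson measure for [w]: by [core_multiplicity], the
    centres whose core lies in a set A carry at most C2 times the [w]-mass of A. *)
Definition core_weight w z := rh z `^ (- N) * mass v w (core z).

(** Numerator on the tent, denominator on its 18-fold dilate: the Vitali cover consists of dilates,
    and [w] is not assumed doubling. *)
Definition tent_ratio w f z :=
  mass v (fun x => f x * w x) (tent s z) / mass v w (tent (18 * s) z).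

Lemma nonneg_mfun_core_weight w : nonneg_mfun w -> nonneg_mfun (core_weight w).
Proof.
by move=> mw; apply: nonneg_mfunM; [exact: nonneg_rh|exact: (nonneg_mfun_mass v mcoreS)].
Qed.

Lemma nonneg_mfun_tent_ratio w f : nonneg_mfun w -> nonneg_mfun f ->
  nonneg_mfun (tent_ratio w f).
Proof.
move=> mw mf; apply: nonneg_mfunM.
  by apply: (nonneg_mfun_mass v (mtentS s)); exact: nonneg_mfunM.
rewrite (_ : (fun z => _^-1) = fun z => mass v w (tent (18 * s) z) `^ (-1)).
  exact: (nonneg_mfun_powR (-1) (nonneg_mfun_mass v (mtentS (18 * s)) mw)).
by apply/funext => z; rewrite powR_inv1// mass_ge0.
Qed.

(** The weak bound is applied at level l/2 to the part [f1] of f above l/2. The rest of f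
    contributes at most l/2 times the mass of the tent, hence of its dilate, so a ratio above l for
    f forces a ratio above l/2 for [f1]. This is the localised weak type that [strong_type_of_weak]
    asks for, with constant 2 C2. *)
Lemma embedding w f (q : R) : 1 < q -> nonneg_mfun w ->
  (\int[v]_x (w x)%:E < +oo)%E -> nonneg_mfun f ->
  (\int[v]_x (f x * w x)%:E < +oo)%E ->
  (\int[v]_z (tent_ratio w f z `^ q * core_weight w z)%:E <=
   (2 * C2 * q * 2 `^ (q - 1) / (q - 1))%:E * \int[v]_x (f x `^ q * w x)%:E)%E.
Proof.
move=> q1 mw wfin mf ffin.
have [mr r0] := nonneg_mfun_tent_ratio mw mf.
have [mc cw0] := nonneg_mfun_core_weight mw.
have mfw := nonneg_mfunM mf mw.
have [mw1 w0] := mw; have [mf1 f0] := mf.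
apply: strong_type_of_weak => //; first by rewrite mulr_ge0// ltW.
move=> l l0; pose A := [set x | (l < 2 * f x)%R].
have mA : measurable A by apply: measurable_set_ltr => //; exact: measurable_funM.
pose f1 x := f x * \1_A x.
have mf1' : nonneg_mfun f1 by apply: nonneg_mfunM => //; exact: nonneg_mfun_indic.
have f1E : (\int[v]_x (f1 x * w x)%:E =
    \int[v]_x (f x * w x * \1_A x)%:E)%E.
  by apply: eq_integral => x _; rewrite /f1 mulrAC.
have f1fin : (\int[v]_x (f1 x * w x)%:E < +oo)%E.
  apply: le_lt_trans ffin; apply: ge0_le_integral => //.
  - by move=> x _; rewrite lee_fin mulr_ge0//; have [_ ->] := mf1'.
  - by apply/measurable_EFinP; apply: measurable_funM => //; have [] := mf1'.
  - by apply/measurable_EFinP; have [] := mfw.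
  - by move=> x _; rewrite lee_fin ler_wpM2r// ler_piMr// indicE lern1 leq_b1.
have l20 : 0 < l / 2 by rewrite divr_gt0.
have := weak_embedding mw wfin mf1' f1fin l20.
rewrite -f1E (_ : C2 / (l / 2) = 2 * C2 / l); last by field; rewrite gt_eqF.
apply: le_trans; set Z1 := [set z | _]; set Z2 := [set z | _].
have mZ2 : measurable Z2.
  apply: measurable_set_ltr.
    apply: measurable_funM => //.
    by have [] := nonneg_mfun_mass v (mtentS (18 * s)) mw.
  by have [] := nonneg_mfun_mass v (mtentS s) (nonneg_mfunM mf1' mw).
have mZ1 : measurable Z1 by exact: measurable_set_ltr.
have Z12 z : Z1 z -> Z2 z.
  rewrite /Z1 /Z2/= /tent_ratio => hz.
  have mT := measurable_tent s z; have mT' := measurable_tent (18 * s) z.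
  (* With a zero denominator the ratio would be 0, as the inverse of 0 is 0, against l > 0. *)
  have S0 : 0 < mass v w (tent (18 * s) z).
    rewrite lt0r mass_ge0// andbT; apply/eqP => S0.
    by move: hz; rewrite S0 invr0 mulr0 ltNge (ltW l0).
  move: hz; rewrite ltr_pdivlMr// => hz.
  have h : mass v (fun x => f x * w x) (tent s z) <=
      mass v (fun x => f1 x * w x) (tent s z) + l / 2 * mass v w (tent s z).
    rewrite -lee_fin EFinD (EFinM (l / 2)) (massE mfw ffin)//.
    rewrite (massE (nonneg_mfunM mf1' mw) f1fin)// (massE mw wfin)//.
    rewrite -(ge0_integralZl_EFin _ _ _ _ (ltW l20))//; first last.
    - exact/measurable_funTS/measurable_EFinP.
    - by move=> x _; rewrite lee_fin.
    rewrite -ge0_integralD//; first last.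
    - by apply: emeasurable_funM => //; exact/measurable_funTS/measurable_EFinP.
    - by move=> x _; rewrite mule_ge0// lee_fin// ltW.
    - by apply/measurable_funTS/measurable_EFinP; have [] := nonneg_mfunM mf1' mw.
    - by move=> x _; rewrite lee_fin mulr_ge0//; have [_ ->] := mf1'.
    apply: ge0_le_integral => //.
    - by move=> x _; rewrite lee_fin; have [_ ->] := mfw.
    - by apply/measurable_funTS/measurable_EFinP; have [] := mfw.
    - apply/measurable_funTS; apply: emeasurable_funD.
        by apply/measurable_EFinP; have [] := nonneg_mfunM mf1' mw.
      by apply: emeasurable_funM => //; exact/measurable_EFinP.
    - move=> x _; rewrite -EFinM -EFinD lee_fin -mulrDl ler_wpM2r// /f1.
      rewrite indicE; have [xA|xA] := boolP (x \in A).
        by rewrite mulr1 lerDl ltW.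
      rewrite mulr0 add0r ler_pdivlMr// mulrC leNgt; apply/negP => xl.
      by move/negP : xA; apply; rewrite inE.
  have h2 : mass v w (tent s z) <= mass v w (tent (18 * s) z).
    by apply: le_mass => //; exact: tent_sub18.
  have h3 := ler_wpM2l (ltW l20) h2.
  rewrite -(ltrD2r (l / 2 * mass v w (tent (18 * s) z))).
  apply: (le_lt_trans _ (lt_le_trans hz _)).
    rewrite -mulrDl -splitr//.
  by rewrite (le_trans h)// lerD2l.
apply: ge0_le_integral => //.
- by move=> z _; rewrite lee_fin mulr_ge0.
- by apply/measurable_EFinP; apply: measurable_funM => //; exact: measurable_indic.
- by apply/measurable_EFinP; apply: measurable_funM => //; exact: measurable_indic.
- move=> z _; rewrite lee_fin ler_wpM2l// !indicE ler_nat.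
  by have [/set_mem/Z12/mem_set->|] := boolP (z \in Z1).
Qed.

End homogeneous_tents.

(** * The two-weight inequality in a tent space *)

Lemma hoelder_mass d (X : measurableType d) (R : realType)
    (v : {measure set X -> \bar R}) (A : set X) (h w1 w2 : X -> R) (a b : R) :
  measurable A -> nonneg_mfun w1 -> nonneg_mfun w2 ->
  0 < a -> 0 < b -> a^-1 + b^-1 = 1 ->
  (forall x, A x -> h x = w1 x `^ a^-1 * w2 x `^ b^-1) ->
  (\int[v]_(x in A) (h x)%:E <= (\int[v]_(x in A) (w1 x)%:E) `^ a^-1 *
     (\int[v]_(x in A) (w2 x)%:E) `^ b^-1)%E.
Proof.
move=> mA [mw1 w10] [mw2 w20] a0 b0 ab hE.
pose f x := (w1 x * \1_A x) `^ a^-1; pose g x := (w2 x * \1_A x) `^ b^-1.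
have m1 (w : X -> R) : measurable_fun [set: X] w ->
    measurable_fun [set: X] (fun x => w x * \1_A x).
  by move=> mw; apply: measurable_funM => //; exact: measurable_indic.
have i01 x : 0 <= \1_A x :> R by rewrite indicE.
have mf : measurable_fun [set: X] f.
  by apply: (measurableT_comp (measurable_powR _)); exact: m1.
have mg : measurable_fun [set: X] g.
  by apply: (measurableT_comp (measurable_powR _)); exact: m1.
have := ge0_hoelder v mf mg (fun x => powR_ge0 _ _) (fun x => powR_ge0 _ _) a0 b0 ab.
congr (_ <= _)%E.
  rewrite -[RHS]integral_mul_indic; apply: eq_integral => x _; congr EFin.
  rewrite /f /g indicE; have [/set_mem Ax|_] := boolP (x \in A).
    by rewrite !mulr1 hE.
  by rewrite !mulr0 powR0 ?mul0r// gt_eqF ?invr_gt0.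
congr (_ `^ _ * _ `^ _)%E; rewrite -[RHS]integral_mul_indic;
  apply: eq_integral => x _; congr EFin.
  by rewrite /f -powRrM mulVf ?gt_eqF// powRr1// mulr_ge0.
by rewrite /g -powRrM mulVf ?gt_eqF// powRr1// mulr_ge0.
Qed.

Section powR_algebra.
Context {R : realType}.

Lemma ler_powR_neg (a b t : R) : t <= 0 -> 0 < a -> a <= b -> b `^ t <= a `^ t.
Proof.
move=> t0 a0 ab; have b0 : 0 < b by exact: lt_le_trans ab.
have [m m0 ->] : exists2 m, 0 <= m & t = - m by exists (- t); rewrite ?opprK ?oppr_ge0.
rewrite !powRN lef_pV2 ?posrE ?powR_gt0//.
by rewrite ge0_ler_powR// nnegrE ltW.
Qed.

(* As [2 - q <= 0], passing from the tent mass [S] to the core mass [Sc] goes in the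
   right direction. *)
Lemma tent_core_ineq (q K C r S V Sc Vc : R) : 2 <= q -> 0 <= K -> 0 < C ->
  0 < r -> 0 < Sc -> Sc <= S -> 0 < Vc -> 0 <= V ->
  S `^ (q - 1) * V <= K * r `^ q ->
  r <= C * (Sc `^ ((q - 1) / q) * Vc `^ q^-1) ->
  S * V <= K * C `^ (q - 1) * r * (Sc `^ q^-1 * Vc `^ ((q - 1) / q)).
Proof.
move=> q2 K0 C0 r0 Sc0 ScS Vc0 V0 SV rSV.
have S0 : 0 < S by exact: lt_le_trans ScS.
have q0 : 0 < q by rewrite (lt_le_trans _ q2).
have q10 : 0 <= q - 1 by lra.
have -> : S * V = S `^ (2 - q) * (S `^ (q - 1) * V).
  rewrite mulrA -powRD; last by rewrite (gt_eqF S0) implybT.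
  by rewrite (_ : 2 - q + (q - 1) = 1) ?powRr1 ?ltW//; ring.
apply: (@le_trans _ _ (Sc `^ (2 - q) * (K * r `^ q))).
  by apply: ler_pM; rewrite ?mulr_ge0 ?powR_ge0// ler_powR_neg//; lra.
have -> : r `^ q = r * r `^ (q - 1) by rewrite mulr_powRB1// ltW.
apply: (@le_trans _ _ (Sc `^ (2 - q) * (K * (r *
   (C * (Sc `^ ((q - 1) / q) * Vc `^ q^-1)) `^ (q - 1))))).
  rewrite !ler_wpM2l ?powR_ge0 ?(ltW r0)//.
  by rewrite ge0_ler_powR// nnegrE ?(ltW r0)// !mulr_ge0 ?powR_ge0 ?(ltW C0).
rewrite !powRM ?mulr_ge0 ?powR_ge0 ?(ltW C0)// -!powRrM.
rewrite [q^-1 * _]mulrC.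
have -> : Sc `^ q^-1 = Sc `^ (2 - q) * Sc `^ ((q - 1) / q * (q - 1)).
  rewrite -powRD; last by rewrite (gt_eqF Sc0) implybT.
  by congr powR; field; rewrite gt_eqF.
by rewrite le_eqVlt; apply/orP; left; apply/eqP; ring.
Qed.

End powR_algebra.

Section two_weight.
Context d (X : measurableType d) (R : realType).
Variable v : {finite_measure set X -> \bar R}.
Variables (dl : X -> X -> R) (rh : X -> R) (N s kp c0 C0 : R).
Hypothesis H : tent_space v dl rh N s kp c0 C0.

Let T' := tent dl rh (18 * s).
Let E := core dl rh s kp.
Let rh0 x : 0 < rh x := rh_gt0 H x.
Let mT' z : measurable (T' z) := measurable_tent H (18 * s) z.
Let mE z : measurable (E z) := measurable_core H z.

Definition pos_mfun (w : X -> R) :=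
  [/\ measurable_fun [set: X] w, forall x, 0 < w x &
      (\int[v]_x (w x)%:E < +oo)%E].

Lemma pos_nonneg_mfun w : pos_mfun w -> nonneg_mfun w.
Proof. by move=> [mw w0 _]; split => // x; exact: ltW. Qed.

(** Two-weight form of the characteristic, meant for w1 = sigma and w2 = u rho^(pN). The power 2 N q
    is that of the volumes in the averages: N (q - 1) from dv_b and N + N q from the second measure.
    The bound is asked on the 18-fold tents, the denominators of [tent_ratio]. *)
Definition dual_pair (q K : R) (w1 w2 : X -> R) :=
  (forall x, w1 x `^ (q - 1) * w2 x = rh x `^ (N * q)) /\
  (forall z, mass v w1 (T' z) `^ (q - 1) * mass v w2 (T' z) <=
     K * rh z `^ (2 * N * q)).

Lemma core_mass_gt0 w z : pos_mfun w -> 0 < mass v w (E z).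
Proof.
move=> pw; have nw := pos_nonneg_mfun pw; have [mw w0 wfin] := pw.
rewrite -lte_fin massE//; apply: integral_pos_gt0 => //.
apply: lt_le_trans (v_core_ge H z).
by rewrite lte_fin mulr_gt0 ?powR_gt0 ?(c0_gt0 H).
Qed.

Lemma core_mass_le w z : pos_mfun w -> mass v w (E z) <= mass v w (T' z).
Proof.
move=> pw; have nw := pos_nonneg_mfun pw; have [mw w0 wfin] := pw.
by apply: le_mass => // x /(@core_tent _ _ _ _ _ _ _)/(tent_sub18 H).
Qed.

Let C4 := (kp `^ N * c0)^-1.

(** By the first clause of [dual_pair], rho^N is (w1^(q-1) w2)^(1/q), and Hoelder's inequality with
    exponents q/(q-1) and q bounds its integral over the core. That integral is at least (kp rh z)^N
    times the volume c0 rh z^N. *)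
Lemma core_hoelder q K w1 w2 z : 1 < q -> pos_mfun w1 -> pos_mfun w2 ->
  dual_pair q K w1 w2 ->
  rh z `^ (2 * N) <= C4 * (mass v w1 (E z) `^ ((q - 1) / q) * mass v w2 (E z) `^ q^-1).
Proof.
move=> q1 pw1 pw2 [wE _].
have nw1 := pos_nonneg_mfun pw1; have nw2 := pos_nonneg_mfun pw2.
have [_ w10 w1fin] := pw1; have [_ w20 w2fin] := pw2.
have q0 : 0 < q by rewrite (lt_trans ltr01).
have q10 : 0 < q - 1 by rewrite subr_gt0.
have a0 : 0 < q / (q - 1) by rewrite divr_gt0.
have := @hoelder_mass _ _ _ v (E z) (fun x => rh x `^ N) _ _ (q / (q - 1)) q
  (mE z) nw1 nw2 a0 q0.
rewrite invf_div => hoe.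
rewrite ler_pdivlMl ?mulr_gt0 ?powR_gt0 ?(kp_gt0 H) ?(c0_gt0 H)//.
have m1 := massE nw1 w1fin (mE z); have m2 := massE nw2 w2fin (mE z).
rewrite -lee_fin (EFinM (_ `^ _)) -(poweR_EFin (mass _ w1 _)) -(poweR_EFin (mass _ w2 _)).
rewrite m1 m2; apply: le_trans (hoe _ _); first last.
- move=> x _; rewrite (_ : N = (N * q) * q^-1); last by rewrite mulfK ?gt_eqF.
  rewrite powRrM -wE powRM ?powR_ge0 ?(ltW (w20 _))// -powRrM.
  by [].
- by field; rewrite gt_eqF.
apply: (@le_trans _ _ (\int[v]_(x in E z) (kp `^ N * rh z `^ N)%:E)%E).
  rewrite integral_cst//.
  apply: (@le_trans _ _ ((kp `^ N * rh z `^ N)%:E * (c0 * rh z `^ N)%:E)%E).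
    rewrite -EFinM lee_fin mulrACA [_ * c0]mulrC mulrC.
    by rewrite [2 * N]mulrDl !mul1r powRD ?(gt_eqF (rh0 z)) ?implybT.
  by apply: lee_wpmul2l; [rewrite lee_fin mulr_ge0 ?powR_ge0|exact: v_core_ge H z].
apply: ge0_le_integral => //.
- by move=> x _; rewrite lee_fin mulr_ge0 ?powR_ge0.
- apply/measurable_funTS/measurable_EFinP.
  exact: (measurableT_comp (measurable_powR _) (measurable_rh H)).
- move=> x [_ kx]; rewrite lee_fin -powRM ?(ltW (kp_gt0 H)) ?(ltW (rh0 _))//.
  by rewrite ge0_ler_powR ?(ltW (N_gt0 H)) ?nnegrE ?mulr_ge0 ?(ltW (kp_gt0 H)) ?(ltW (rh0 _)).
Qed.

End two_weight.

Section pairing.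
Context d (X : measurableType d) (R : realType).
Variable v : {finite_measure set X -> \bar R}.
Variables (dl : X -> X -> R) (rh : X -> R) (N s kp c0 C0 : R).
Hypothesis H : tent_space v dl rh N s kp c0 C0.

Let T := tent dl rh s.
Let T' := tent dl rh (18 * s).
Let E := core dl rh s kp.
Let rh0 x : 0 < rh x := rh_gt0 H x.

Let wcore := core_weight v dl rh N s kp.
Let ratio := tent_ratio v dl rh s.

Let mtS : measurable [set z : X * X | dl z.1 z.2 < s * rh z.2].
Proof.
apply: measurable_set_ltr; first exact: measurable_dl H.
apply: measurable_funM => //.
exact: (measurableT_comp (measurable_rh H) measurable_snd).
Qed.

Definition tent_form (w1 w2 f g : X -> R) : \bar R :=
  (\int[v]_z (rh z `^ (- (3 * N)) * (mass v (fun x => f x * w1 x) (T z) *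
     mass v (fun x => g x * w2 x) (T z)))%:E)%E.

Lemma tent_formC w1 w2 f g : tent_form w1 w2 f g = tent_form w2 w1 g f.
Proof. by apply: eq_integral => z _; rewrite [X in (_ * X)%:E]mulrC. Qed.

Definition integrable_mfun (w f : X -> R) :=
  nonneg_mfun f /\ (\int[v]_x (f x * w x)%:E < +oo)%E.

Lemma embedding_exists (q : R) : 1 < q -> exists2 C : R, 0 < C &
  forall w f, pos_mfun v w -> integrable_mfun w f ->
  (\int[v]_z (ratio w f z `^ q * wcore w z)%:E <=
   C%:E * \int[v]_x (f x `^ q * w x)%:E)%E.
Proof.
move=> q1; eexists; last first.
  move=> w f pw [mf ffin]; have [_ _ wfin] := pw.
  exact: (embedding H q1 (pos_nonneg_mfun pw) wfin mf ffin).
have s0 : 0 < s := lt_trans ltr01 (s_gt1 H).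
have q0 : 0 < q by rewrite (lt_trans ltr01).
have q10 : 0 < q - 1 by rewrite subr_gt0.
by rewrite !(divr_gt0, mulr_gt0, powR_gt0)// ?(C0_gt0 H) ?(kp_gt0 H).
Qed.

(** Each mass of [f w1] or [g w2] is a [tent_ratio] times the mass of a weight on the dilated tent.
    [tent_core_ineq] trades the product of these two for powers of core masses, at the price K
    C4^(q-1) rh^(2N). The remaining rh^(-N) is split with exponents 1/q and 1/q' and completes the
    core masses to powers of [core_weight]; Hoelder's inequality then leaves one embedding for each
    function. *)
Lemma tent_form_le2 (q : R) : 2 <= q -> exists2 C : R, 0 < C &
  forall w1 w2 f g K, 0 <= K -> pos_mfun v w1 -> pos_mfun v w2 ->
    dual_pair v dl rh N s q K w1 w2 ->
    integrable_mfun w1 f -> integrable_mfun w2 g ->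
  (tent_form w1 w2 f g <= (C * K)%:E *
    ((\int[v]_x (f x `^ q * w1 x)%:E) `^ q^-1 *
     (\int[v]_x (g x `^ (q / (q - 1)) * w2 x)%:E) `^ ((q - 1) / q)))%E.
Proof.
move=> q2; pose q' := q / (q - 1).
have q1 : 1 < q by lra.
have q0 : 0 < q by lra.
have q10 : 0 < q - 1 by rewrite subr_gt0.
have q'1 : 1 < q' by rewrite /q' ltr_pdivlMr// mul1r; lra.
have q'0 : 0 < q' by rewrite divr_gt0.
have q'V : (q - 1) / q = q'^-1 by rewrite invf_div.
have qq' : q^-1 + q'^-1 = 1 by rewrite -q'V; field; rewrite gt_eqF.
have [Ca Ca0 Ha] := embedding_exists q1.
have [Cb Cb0 Hb] := embedding_exists q'1.
pose C4 := (kp `^ N * c0)^-1.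
have C40 : 0 < C4 by rewrite invr_gt0 mulr_gt0 ?powR_gt0 ?(kp_gt0 H) ?(c0_gt0 H).
exists (C4 `^ (q - 1) * (Ca `^ q^-1 * Cb `^ q'^-1)).
  by rewrite !mulr_gt0 ?powR_gt0.
move=> w1 w2 f g K K0 pw1 pw2 wdp If Ig; rewrite q'V -/q'.
have nw1 := pos_nonneg_mfun pw1; have nw2 := pos_nonneg_mfun pw2.
have [mf ffin] := If; have [mg gfin] := Ig.
pose F z := ratio w1 f z * wcore w1 z `^ q^-1.
pose G z := ratio w2 g z * wcore w2 z `^ q'^-1.
have nF : nonneg_mfun F.
  apply: nonneg_mfunM; first exact: (nonneg_mfun_tent_ratio H).
  by apply: nonneg_mfun_powR; exact: (nonneg_mfun_core_weight H).
have nG : nonneg_mfun G.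
  apply: nonneg_mfunM; first exact: (nonneg_mfun_tent_ratio H).
  by apply: nonneg_mfun_powR; exact: (nonneg_mfun_core_weight H).
have pointwise z : rh z `^ (- (3 * N)) * (mass v (fun x => f x * w1 x) (T z) *
     mass v (fun x => g x * w2 x) (T z)) <= K * C4 `^ (q - 1) * (F z * G z).
  set Xf := mass _ _ _; set Yg := mass _ _ _.
  pose S := mass v w1 (T' z); pose V := mass v w2 (T' z).
  pose Sc := mass v w1 (E z); pose Vc := mass v w2 (E z).
  have Sc0 : 0 < Sc by exact: (core_mass_gt0 H z pw1).
  have Vc0 : 0 < Vc by exact: (core_mass_gt0 H z pw2).
  have ScS : Sc <= S by exact: (core_mass_le H z pw1).
  have VcV : Vc <= V by exact: (core_mass_le H z pw2).
  have S0 : 0 < S := lt_le_trans Sc0 ScS.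
  have V0 : 0 < V := lt_le_trans Vc0 VcV.
  have Xf0 : 0 <= Xf by apply: mass_ge0; exact: nonneg_mfunM.
  have Yg0 : 0 <= Yg by apply: mass_ge0; exact: nonneg_mfunM.
  have SV : S `^ (q - 1) * V <= K * (rh z `^ (2 * N)) `^ q.
    by rewrite -powRrM; have [_] := wdp; exact.
  have := tent_core_ineq q2 K0 C40 (powR_gt0 (2 * N) (rh0 z)) Sc0 ScS Vc0
    (ltW V0) SV (core_hoelder H z q1 pw1 pw2 wdp).
  rewrite q'V => key.
  rewrite /F /G /ratio /wcore /tent_ratio /core_weight -/Xf -/Yg -/S -/V -/Sc -/Vc.
  have -> : Xf * Yg = S * V * (Xf / S * (Yg / V)).
    by field; rewrite !gt_eqF.
  have XY0 : 0 <= Xf / S * (Yg / V) by rewrite mulr_ge0 ?divr_ge0 ?(ltW S0) ?(ltW V0).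
  apply: (@le_trans _ _ (rh z `^ (- (3 * N)) * (K * C4 `^ (q - 1) * rh z `^ (2 * N) *
     (Sc `^ q^-1 * Vc `^ q'^-1) * (Xf / S * (Yg / V))))).
    by rewrite ler_wpM2l ?powR_ge0// ler_wpM2r.
  rewrite !powRM ?powR_ge0 ?(ltW Sc0) ?(ltW Vc0)// -!powRrM.
  have rhE : rh z `^ (- (3 * N)) * rh z `^ (2 * N) =
      rh z `^ (- N * q^-1) * rh z `^ (- N * q'^-1).
    rewrite -!powRD; [|by rewrite (gt_eqF (rh0 z)) implybT..].
    by congr powR; rewrite -mulrDr qq'; ring.
  rewrite le_eqVlt; apply/orP; left; apply/eqP.
  have regroup (c k r t x : R) : c * (k * r * t * x) = c * r * (k * t * x) by ring.
  rewrite regroup.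
  rewrite rhE; move: (rh z `^ _) (rh z `^ (- N * q'^-1)) (Sc `^ _) (Vc `^ _) (C4 `^ _).
  by move: (Xf / S) (Yg / V) => ? ? ? ? ? ? ?; ring.
have hoe := ge0_hoelder v nF.1 nG.1 nF.2 nG.2 q0 q'0 qq'.
have KC0 : 0 <= K * C4 `^ (q - 1) by rewrite mulr_ge0 ?powR_ge0.
apply: (@le_trans _ _ (\int[v]_z ((K * C4 `^ (q - 1))%:E * (F z * G z)%:E)))%E.
  apply: ge0_le_integral => //.
  - by move=> z _; rewrite lee_fin !mulr_ge0 ?powR_ge0// mass_ge0//; exact: nonneg_mfunM.
  - apply/measurable_EFinP; apply: measurable_funM.
      exact: (measurableT_comp (measurable_powR _) (measurable_rh H)).
    apply: measurable_funM.
      by have [] := nonneg_mfun_mass v mtS (nonneg_mfunM mf nw1).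
    by have [] := nonneg_mfun_mass v mtS (nonneg_mfunM mg nw2).
  - apply: emeasurable_funM => //; apply/measurable_EFinP.
    by have [] := nonneg_mfunM nF nG.
  - by move=> z _; rewrite -EFinM lee_fin; exact: pointwise.
rewrite ge0_integralZl_EFin//; first last.
- by apply/measurable_EFinP; have [] := nonneg_mfunM nF nG.
- by move=> z _; rewrite lee_fin; have [_ ->] := nonneg_mfunM nF nG.
have -> : C4 `^ (q - 1) * (Ca `^ q^-1 * Cb `^ q'^-1) * K =
    K * C4 `^ (q - 1) * (Ca `^ q^-1 * Cb `^ q'^-1) by ring.
rewrite (EFinM (K * _)) -muleA; apply: lee_wpmul2l; first by rewrite lee_fin.
apply: (le_trans hoe).
have i0 (h : X -> R) (t : R) w : nonneg_mfun w -> (0 <= \int[v]_x (h x `^ t * w x)%:E)%E.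
  by move=> [_ w0]; apply: integral_ge0 => x _; rewrite lee_fin mulr_ge0 ?powR_ge0.
rewrite EFinM muleACA -!poweR_EFin -!poweRM ?lee_fin ?(ltW Ca0) ?(ltW Cb0) ?i0//.
have powE (t : R) w h z : 0 < t -> nonneg_mfun w -> nonneg_mfun h ->
    (ratio w h z * wcore w z `^ t^-1) `^ t = ratio w h z `^ t * wcore w z.
  move=> t0 nw nh; rewrite powRM ?powR_ge0//; last first.
    by have [_ ->] := nonneg_mfun_tent_ratio H nw nh.
  rewrite -powRrM mulVf ?gt_eqF// powRr1//.
  by have [_ ->] := nonneg_mfun_core_weight H nw.
apply: lee_pmul; rewrite ?poweR_ge0//.
- apply: gt0_ler_poweR; rewrite ?in_itv/= ?leey ?andbT ?invr_ge0 ?(ltW q0)//.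
  + by apply: integral_ge0 => x _; rewrite lee_fin powR_ge0.
  + by rewrite mule_ge0 ?lee_fin ?(ltW Ca0) ?i0.
  + by under eq_integral do rewrite /F powE//; exact: Ha.
- apply: gt0_ler_poweR; rewrite ?in_itv/= ?leey ?andbT ?invr_ge0 ?(ltW q'0)//.
  + by apply: integral_ge0 => x _; rewrite lee_fin powR_ge0.
  + by rewrite mule_ge0 ?lee_fin ?(ltW Cb0) ?i0.
  + by under eq_integral do rewrite /G powE//; exact: Hb.
Qed.

End pairing.

(** * From the bilinear form to the operator *)

Section operator.
Context d (X : measurableType d) (R : realType).
Variable v : {finite_measure set X -> \bar R}.
Variables (dl : X -> X -> R) (rh : X -> R) (N s kp c0 C0 : R).
Hypothesis H : tent_space v dl rh N s kp c0 C0.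

Let T := tent dl rh s.
Let rh0 x : 0 < rh x := rh_gt0 H x.
Let mT z : measurable (T z) := measurable_tent H s z.

Let S := [set z : X * X | dl z.1 z.2 < s * rh z.2].
Let mtS : measurable S.
Proof.
apply: measurable_set_ltr; first exact: measurable_dl H.
apply: measurable_funM => //.
exact: (measurableT_comp (measurable_rh H) measurable_snd).
Qed.

(** Both clauses are raised to the power 1/(q-1), which equals q/(q-1) - 1. *)
Lemma dual_pairC q K w1 w2 : 1 < q -> 0 <= K -> pos_mfun v w1 -> pos_mfun v w2 ->
  dual_pair v dl rh N s q K w1 w2 ->
  dual_pair v dl rh N s (q / (q - 1)) (K `^ (q - 1)^-1) w2 w1.
Proof.
move=> q1 K0 pw1 pw2 [wE wK].
have q10 : 0 < q - 1 by rewrite subr_gt0.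
have e : q / (q - 1) - 1 = (q - 1)^-1 by field; rewrite gt_eqF.
have aux (a c : R) : 0 <= a -> 0 <= c -> c `^ (q - 1)^-1 * a = (a `^ (q - 1) * c) `^ (q - 1)^-1.
  move=> a0 b0; rewrite powRM ?powR_ge0// -powRrM mulfV ?gt_eqF// powRr1//.
  by rewrite mulrC.
have [_ w10 _] := pw1; have [_ w20 _] := pw2.
have nw1 := pos_nonneg_mfun pw1; have nw2 := pos_nonneg_mfun pw2.
split => [x|z]; rewrite e.
  by rewrite aux ?(ltW (w10 _)) ?(ltW (w20 _))// wE -powRrM mulrA.
rewrite aux ?mass_ge0//.
have -> : K `^ (q - 1)^-1 * rh z `^ (2 * N * (q / (q - 1))) =
    (K * rh z `^ (2 * N * q)) `^ (q - 1)^-1.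
  by rewrite powRM ?powR_ge0// -powRrM mulrA.
apply: ge0_ler_powR; rewrite ?nnegrE ?mulr_ge0 ?powR_ge0 ?invr_ge0 ?(ltW q10)//.
by apply: mass_ge0.
Qed.

Lemma tent_form_le (p : R) : 1 < p -> exists2 C : R, 0 < C &
  forall w1 w2 f g K, 0 <= K -> pos_mfun v w1 -> pos_mfun v w2 ->
    dual_pair v dl rh N s p K w1 w2 ->
    integrable_mfun v w1 f -> integrable_mfun v w2 g ->
  (tent_form v dl rh N s w1 w2 f g <= (C * K `^ (Num.max 1 (p - 1)^-1))%:E *
    ((\int[v]_x (f x `^ p * w1 x)%:E) `^ p^-1 *
     (\int[v]_x (g x `^ (p / (p - 1)) * w2 x)%:E) `^ ((p - 1) / p)))%E.
Proof.
move=> p1; have p10 : 0 < p - 1 by rewrite subr_gt0.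
have p0 : 0 < p by rewrite (lt_trans ltr01).
have [p2|p2] := leP 2 p.
  have [C C0' HC] := tent_form_le2 H p2; exists C => //.
  move=> w1 w2 f g K K0 pw1 pw2 wdp If Ig.
  have -> : Num.max 1 (p - 1)^-1 = 1.
    by apply/max_idPl; rewrite invf_le1//; lra.
  by rewrite powRr1//; exact: HC.
have q2 : 2 <= p / (p - 1) by rewrite ler_pdivlMr//; lra.
have [C C0' HC] := tent_form_le2 H q2; exists C => //.
move=> w1 w2 f g K K0 pw1 pw2 wdp If Ig.
have -> : Num.max 1 (p - 1)^-1 = (p - 1)^-1.
  by apply/max_idPr; rewrite invf_ge1//; lra.
have := HC w2 w1 g f (K `^ (p - 1)^-1) (powR_ge0 _ _) pw2 pw1
  (dual_pairC p1 K0 pw1 pw2 wdp) Ig If.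
rewrite tent_formC.
have -> : p / (p - 1) / (p / (p - 1) - 1) = p.
  by field; rewrite !gt_eqF//; lra.
have -> : (p / (p - 1) - 1) / (p / (p - 1)) = p^-1.
  by field; rewrite !gt_eqF//; lra.
by rewrite invf_div [X in (_ * X)%E]muleC.
Qed.

Let dl_gt0 x y : 0 < dl x y.
Proof. by rewrite -(pmulr_rgt0 _ (ltr0Sn R 1)) (lt_le_trans (rh0 x))// (rh_le_dl H). Qed.

Lemma dl_powR_le x y : ((dl x y `^ (- (2 * N)))%:E <= (c0^-1)%:E *
  \int[v]_(z in [set z | S (x, z)]) (rh z `^ (- (3 * N)) * \1_[set z | S (y, z)] z)%:E)%E.
Proof.
have c00 := c0_gt0 H.
have m1 : measurable_fun [set: X] (fun z => rh z `^ (- (3 * N))).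
  exact: (measurableT_comp (measurable_powR _) (measurable_rh H)).
have mSy y' : measurable [set z | S (y', z)] := measurable_section2 y' mtS.
have mL : measurable (link dl rh s x y).
  rewrite (_ : link _ _ _ _ _ = [set z | S (x, z)] `&` [set z | S (y, z)] `&`
      [set z | rh z <= dl x y]).
    apply: measurableI; first exact: measurableI.
    by apply: measurable_set_ler => //; exact: measurable_rh H.
  by apply/seteqP; split => z [] //; case.
apply: (@le_trans _ _ ((c0^-1)%:E *
    \int[v]_(z in link dl rh s x y) (dl x y `^ (- (3 * N)))%:E)%E); last first.
  apply: lee_wpmul2l; first by rewrite lee_fin invr_ge0 ltW.
  rewrite -[leLHS]integral_mul_indic -[leRHS]integral_mul_indic.
  apply: ge0_le_integral => //.
  - by move=> z _; rewrite lee_fin mulr_ge0 ?powR_ge0.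
  - by apply/measurable_EFinP/measurable_funM => //; exact: measurable_indic.
  - apply/measurable_EFinP/measurable_funM; last exact: measurable_indic.
    by apply: measurable_funM => //; exact: measurable_indic.
  - move=> z _; rewrite lee_fin !indicE; have [/set_mem[xz yz rz]|_] := boolP (z \in link _ _ _ _ _).
      rewrite !mem_set//= !mulr1 ler_powR_neg//.
      by rewrite oppr_le0 mulr_ge0// ltW// (N_gt0 H).
    by rewrite mulr0 !mulr_ge0 ?powR_ge0.
rewrite integral_cst//.
apply: (@le_trans _ _ ((c0^-1)%:E * ((dl x y `^ (- (3 * N)))%:E * (c0 * dl x y `^ N)%:E))%E).
  rewrite -!EFinM lee_fin [leRHS](_ : _ = dl x y `^ (- (3 * N)) * dl x y `^ N); last first.
    by field; rewrite gt_eqF.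
  rewrite -powRD; last by rewrite (gt_eqF (dl_gt0 _ _)) implybT.
  by rewrite (_ : - (3 * N) + N = - (2 * N))//; ring.
apply: lee_wpmul2l; first by rewrite lee_fin invr_ge0 ltW.
apply: lee_wpmul2l; first by rewrite lee_fin powR_ge0.
exact: v_link_ge H x y.
Qed.

(** The positive operator that dominates the transform, without its factor rho(y)^N, which goes into
    the second weight u rho^(pN). *)
Definition potential (w f : X -> R) (y : X) : \bar R :=
  (\int[v]_x (f x * w x * dl x y `^ (- (2 * N)))%:E)%E.

Let mdlp t : measurable_fun [set: X * X] (fun z : X * X => dl z.1 z.2 `^ t).
Proof. exact: (measurableT_comp (measurable_powR _) (measurable_dl H)). Qed.

Let mdl1 t y : measurable_fun [set: X] (fun x => dl x y `^ t).
Proof. exact: (measurableT_comp (mdlp t) (pair2_measurable y)). Qed.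

Lemma measurable_potential w f : nonneg_mfun w -> nonneg_mfun f ->
  measurable_fun [set: X] (potential w f).
Proof.
move=> nw nf; have [mfw fw0] := nonneg_mfunM nf nw.
apply: (measurable_fun_fubini_tonelli_G
  (fun z : X * X => (f z.1 * w z.1 * dl z.1 z.2 `^ (- (2 * N)))%:E)).
  apply/measurable_EFinP/measurable_funM; last exact: mdlp.
  exact: (measurableT_comp mfw measurable_fst).
by move=> z; rewrite lee_fin mulr_ge0 ?powR_ge0.
Qed.

Lemma potential_ge0 w f y : nonneg_mfun w -> nonneg_mfun f -> (0 <= potential w f y)%E.
Proof.
move=> nw nf; have [mfw fw0] := nonneg_mfunM nf nw.
by apply: integral_ge0 => x _; rewrite lee_fin mulr_ge0 ?powR_ge0.
Qed.

(** For fixed y the kernel is bounded, since d(x,y) is at least rh y / 2. *)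
Lemma potential_lty w f y : nonneg_mfun w -> integrable_mfun v w f ->
  (potential w f y < +oo)%E.
Proof.
move=> nw [nf ffin]; have [mfw fw0] := nonneg_mfunM nf nw.
have r20 : 0 < rh y / 2 by rewrite divr_gt0.
apply: (@le_lt_trans _ _ (\int[v]_x (((rh y / 2) `^ (- (2 * N)))%:E * (f x * w x)%:E))%E).
  apply: ge0_le_integral => //.
  - by move=> x _; rewrite lee_fin mulr_ge0 ?powR_ge0.
  - by apply/measurable_EFinP/measurable_funM.
  - by apply: emeasurable_funM => //; exact/measurable_EFinP.
  - move=> x _; rewrite -EFinM lee_fin mulrC ler_wpM2r// ler_powR_neg//.
      by rewrite oppr_le0 mulr_ge0// ltW// (N_gt0 H).
    by rewrite ler_pdivrMr// mulrC (dlC H) (rh_le_dl H).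
rewrite ge0_integralZl_EFin ?powR_ge0//; first last.
- exact/measurable_EFinP.
- by move=> x _; rewrite lee_fin.
by rewrite lte_mul_pinfty ?lee_fin ?powR_ge0.
Qed.

(** Tonelli is used twice after [dl_powR_le]: first to gather the mass of [f w1] on the tents that
    contain y, then to integrate y against [g w2]. *)
Lemma potential_form_le w1 w2 f g : pos_mfun v w1 -> pos_mfun v w2 ->
  integrable_mfun v w1 f -> integrable_mfun v w2 g ->
  (\int[v]_y ((g y * w2 y)%:E * potential w1 f y) <=
   (c0^-1)%:E * tent_form v dl rh N s w1 w2 f g)%E.
Proof.
move=> pw1 pw2 [nf ffin] [ng gfin].
have nw1 := pos_nonneg_mfun pw1; have nw2 := pos_nonneg_mfun pw2.
have nfw := nonneg_mfunM nf nw1; have ngw := nonneg_mfunM ng nw2.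
have [mfw fw0] := nfw; have [mgw gw0] := ngw.
have nr : nonneg_mfun (fun z => rh z `^ (- (3 * N))).
  by apply: nonneg_mfun_powR; split; [exact: measurable_rh H|move=> z; rewrite ltW].
have nX : nonneg_mfun (fun z => mass v (fun x => f x * w1 x) (T z)).
  exact: nonneg_mfun_mass mtS nfw.
have nrX := nonneg_mfunM nr nX.
have c0V : 0 <= c0^-1 by rewrite invr_ge0 ltW// (c0_gt0 H).
have potE y : (potential w1 f y <= (c0^-1)%:E * \int[v]_(z in [set z | S (y, z)])
    (rh z `^ (- (3 * N)) * mass v (fun x => f x * w1 x) (T z))%:E)%E.
  pose a z := rh z `^ (- (3 * N)) * \1_[set z | S (y, z)] z.
  have na : nonneg_mfun a.
    by apply: nonneg_mfunM => //; apply: nonneg_mfun_indic; exact: measurable_section2.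
  have mI : measurable_fun [set: X]
      (fun x => \int[v]_(z in [set z | S (x, z)]) (a z)%:E)%E.
    have mS' : measurable [set z : X * X | S (z.2, z.1)].
      by have := @measurable_swap _ _ X X measurableT _ mtS; rewrite setTI.
    exact: (measurable_integral_section v mS' na).
  have I0 x : (0 <= \int[v]_(z in [set z | S (x, z)]) (a z)%:E)%E.
    by apply: integral_ge0 => z _; rewrite lee_fin; have [_ ->] := na.
  apply: (@le_trans _ _ (\int[v]_x ((c0^-1)%:E * ((f x * w1 x)%:E *
      \int[v]_(z in [set z | S (x, z)]) (a z)%:E)))%E).
    apply: ge0_le_integral => //.
    - by move=> x _; rewrite lee_fin mulr_ge0 ?powR_ge0.
    - by apply/measurable_EFinP/measurable_funM.
    - by do 2 apply: emeasurable_funM => //; exact/measurable_EFinP.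
    - by move=> x _; rewrite EFinM muleCA; apply: lee_wpmul2l; [rewrite lee_fin|exact: dl_powR_le].
  rewrite ge0_integralZl_EFin//; first last.
  - by apply: emeasurable_funM => //; exact/measurable_EFinP.
  - by move=> x _; rewrite mule_ge0 ?lee_fin.
  apply: lee_wpmul2l; first by rewrite lee_fin.
  rewrite -(tonelli_section v mtS na nfw) -[leRHS]integral_mul_indic.
  rewrite le_eqVlt; apply/orP; left; apply/eqP; apply: eq_integral => z _.
  by rewrite -(massE nfw ffin (mT z)) -EFinM /a mulrAC.
pose J y := (\int[v]_(z in [set z | S (y, z)])
    (rh z `^ (- (3 * N)) * mass v (fun x => f x * w1 x) (T z))%:E)%E.
have mJ : measurable_fun [set: X] J.
  have mS' : measurable [set z : X * X | S (z.2, z.1)].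
    by have := @measurable_swap _ _ X X measurableT _ mtS; rewrite setTI.
  exact: (measurable_integral_section v mS' nrX).
have J0 y : (0 <= J y)%E.
  by apply: integral_ge0 => z _; rewrite lee_fin; have [_ ->] := nrX.
apply: (@le_trans _ _ (\int[v]_y ((c0^-1)%:E * ((g y * w2 y)%:E * J y)))%E).
  apply: ge0_le_integral => //.
  - by move=> y _; rewrite mule_ge0 ?lee_fin// potential_ge0.
  - apply: emeasurable_funM; first exact/measurable_EFinP.
    exact: measurable_potential.
  - by do 2 apply: emeasurable_funM => //; exact/measurable_EFinP.
  - by move=> y _; rewrite muleCA; apply: lee_wpmul2l; rewrite ?lee_fin// potE.
rewrite ge0_integralZl_EFin//; first last.
- by apply: emeasurable_funM => //; exact/measurable_EFinP.
- by move=> x _; rewrite mule_ge0 ?lee_fin.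
apply: lee_wpmul2l; first by rewrite lee_fin.
rewrite -(tonelli_section v mtS nrX ngw).
rewrite le_eqVlt; apply/orP; left; apply/eqP; apply: eq_integral => z _.
by rewrite -(massE ngw gfin (mT z)) -EFinM mulrA.
Qed.

End operator.

Section potential_bound.
Context d (X : measurableType d) (R : realType).
Variable v : {finite_measure set X -> \bar R}.
Variables (dl : X -> X -> R) (rh : X -> R) (N s kp c0 C0 : R).
Hypothesis H : tent_space v dl rh N s kp c0 C0.

Let self_improve (p i B : R) : 1 < p -> 0 <= i -> 0 <= B ->
  i <= B * i `^ ((p - 1) / p) -> i <= B `^ p.
Proof.
move=> p1 i0 B0 iB; have p0 : 0 < p by rewrite (lt_trans ltr01).
have [->|in0] := eqVneq i 0; first exact: powR_ge0.
have {in0}i0 : 0 < i by rewrite lt0r in0.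
have iE : i = i `^ p^-1 * i `^ ((p - 1) / p).
  rewrite -powRD; last by rewrite (gt_eqF i0) implybT.
  rewrite (_ : p^-1 + (p - 1) / p = 1) ?powRr1 ?ltW//.
  by field; rewrite gt_eqF.
have : i `^ p^-1 <= B.
  by rewrite -(@ler_pM2r _ (i `^ ((p - 1) / p))) ?powR_gt0// -iE.
move=> /(ge0_ler_powR (ltW p0)) h.
have {h} := h _ _; rewrite !nnegrE powR_ge0 => /(_ isT B0).
by rewrite -powRrM mulVf ?gt_eqF// powRr1// ltW.
Qed.

(** Duality with an explicit extremal. With h the potential, the form is tested on g =
    min(h,k)^(p-1), whose norm is a power of the truncated integral [I k]. This gives I k <= B (I
    k)^((p-1)/p), and [self_improve] absorbs the right-hand power, which is legitimate because the
    truncation and the finite mass of w2 make [I k] finite. Monotone convergence removes k. *)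
Lemma potential_bound (p : R) : 1 < p -> exists2 C : R, 0 < C &
  forall w1 w2 f K, 0 <= K -> pos_mfun v w1 -> pos_mfun v w2 ->
    dual_pair v dl rh N s p K w1 w2 -> integrable_mfun v w1 f ->
    (\int[v]_x (f x `^ p * w1 x)%:E < +oo)%E ->
  (\int[v]_y (fine (potential v dl N w1 f y) `^ p * w2 y)%:E <=
    ((C * K `^ (Num.max 1 (p - 1)^-1)) `^ p)%:E *
    \int[v]_x (f x `^ p * w1 x)%:E)%E.
Proof.
move=> p1; have p0 : 0 < p by rewrite (lt_trans ltr01).
have p10 : 0 < p - 1 by rewrite subr_gt0.
have [C C1 HC] := tent_form_le H p1.
have c00 := c0_gt0 H.
exists (c0^-1 * C); first by rewrite mulr_gt0 ?invr_gt0.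
move=> w1 w2 f K K0 pw1 pw2 wdp If Afin.
have nw1 := pos_nonneg_mfun pw1; have nw2 := pos_nonneg_mfun pw2.
have [mw2 w20] := nw2; have [_ _ w2fin] := pw2.
set m := Num.max _ _ in HC *.
pose A := fine (\int[v]_x (f x `^ p * w1 x)%:E)%E.
have fp0 x : 0 <= f x `^ p * w1 x by rewrite mulr_ge0 ?powR_ge0// (nw1.2 x).
have A0 : 0 <= A by rewrite fine_ge0// integral_ge0// => x _; rewrite lee_fin.
have AE : (\int[v]_x (f x `^ p * w1 x)%:E = A%:E)%E.
  by rewrite fineK// ge0_fin_numE// integral_ge0// => x _; rewrite lee_fin.
pose h y := fine (potential v dl N w1 f y).
have pot0 y : (0 <= potential v dl N w1 f y)%E := potential_ge0 _ _ _ y nw1 If.1.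
have hE y : (h y)%:E = potential v dl N w1 f y.
  by rewrite fineK// ge0_fin_numE//; exact: (potential_lty H).
have h0 y : 0 <= h y by rewrite fine_ge0.
have mh : measurable_fun [set: X] h.
  exact: (measurableT_comp (fine_measurable measurableT) (measurable_potential H nw1 If.1)).
pose hk (k : nat) y := Num.min (h y) k%:R.
have hk0 k y : 0 <= hk k y by rewrite le_min h0/=.
have mhk k : measurable_fun [set: X] (hk k) by exact: measurable_minr.
pose M := c0^-1 * C * K `^ m.
have M0 : 0 <= M by rewrite !mulr_ge0 ?powR_ge0 ?invr_ge0 ?(ltW c00) ?(ltW C1).
have nhp k t : nonneg_mfun (fun y => hk k y `^ t).
  by apply: nonneg_mfun_powR; split.
have bnd k t : 0 <= t -> (\int[v]_y (hk k y `^ t * w2 y)%:E < +oo)%E.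
  move=> t0; apply: (@le_lt_trans _ _ (\int[v]_y ((k%:R `^ t)%:E * (w2 y)%:E)))%E.
    apply: ge0_le_integral => //.
    - by move=> y _; rewrite lee_fin mulr_ge0 ?powR_ge0.
    - by apply/measurable_EFinP/measurable_funM => //; have [] := nhp k t.
    - by apply: emeasurable_funM => //; exact/measurable_EFinP.
    - move=> y _; rewrite -EFinM lee_fin ler_wpM2r// ge0_ler_powR ?nnegrE//.
      by rewrite /hk ge_min lexx orbT.
  rewrite ge0_integralZl_EFin ?powR_ge0//; first last.
  - exact/measurable_EFinP.
  - by move=> y _; rewrite lee_fin.
  by rewrite lte_mul_pinfty ?lee_fin ?powR_ge0.
pose I k := (\int[v]_y (hk k y `^ p * w2 y)%:E)%E.
have I0 k : (0 <= I k)%E.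
  by apply: integral_ge0 => y _; rewrite lee_fin mulr_ge0 ?powR_ge0.
have IE k : I k = (fine (I k))%:E.
  by rewrite fineK// ge0_fin_numE// bnd// ltW.
have Ik k : (I k <= ((M `^ p) * A)%:E)%E.
  rewrite IE lee_fin.
  have -> : M `^ p * A = (M * A `^ p^-1) `^ p.
    by rewrite [RHS]powRM ?powR_ge0// -powRrM mulVf ?gt_eqF// powRr1.
  apply: self_improve => //; [exact: fine_ge0|apply: mulr_ge0 => //; exact: powR_ge0|].
  rewrite -lee_fin -IE.
  have -> : ((M * A `^ p^-1 * fine (I k) `^ ((p - 1) / p))%:E = M%:E *
     ((\int[v]_x (f x `^ p * w1 x)%:E) `^ p^-1 * I k `^ ((p - 1) / p)))%E.
    by rewrite AE [in RHS]IE !poweR_EFin -!EFinM mulrA.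
  have Ig : integrable_mfun v w2 (fun y => hk k y `^ (p - 1)).
    by split => //; apply: bnd; exact: ltW.
  have gE : (\int[v]_x ((hk k x `^ (p - 1)) `^ (p / (p - 1)) * w2 x)%:E = I k)%E.
    apply: eq_integral => y _; rewrite -powRrM mulrCA mulfV ?mulr1// gt_eqF//.
  have := HC w1 w2 f (fun y => hk k y `^ (p - 1)) K K0 pw1 pw2 wdp If Ig.
  rewrite gE => tf.
  apply: (@le_trans _ _ (\int[v]_y ((hk k y `^ (p - 1) * w2 y)%:E *
      potential v dl N w1 f y))%E).
    apply: ge0_le_integral => //.
    - by move=> y _; rewrite lee_fin mulr_ge0 ?powR_ge0.
    - by apply/measurable_EFinP/measurable_funM => //; have [] := nhp k p.
    - apply: emeasurable_funM; last exact: (measurable_potential H nw1 If.1).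
      by apply/measurable_EFinP/measurable_funM => //; have [] := nhp k (p - 1).
    - move=> y _; rewrite -hE -EFinM lee_fin mulrAC ler_wpM2r//.
      rewrite -mulr_powRB1// mulrC ler_wpM2l ?powR_ge0//.
      by rewrite /hk ge_min lexx.
  apply: (le_trans (potential_form_le H pw1 pw2 If Ig)).
  rewrite /M -mulrA (EFinM c0^-1) -muleA; apply: lee_wpmul2l.
    by rewrite lee_fin invr_ge0 ltW.
  exact: tf.
rewrite AE -EFinM.
have cvgI : I k @[k --> \oo] --> (\int[v]_y (h y `^ p * w2 y)%:E)%E.
  have := @cvg_monotone_convergence _ X R v [set: X] measurableT
    (fun k y => (hk k y `^ p * w2 y)%:E).
  have -> : (\int[v]_y (h y `^ p * w2 y)%:E =
     \int[v]_y limn (fun k => (hk k y `^ p * w2 y)%:E))%E.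
    apply: eq_integral => y _; apply/esym/cvg_lim => //.
    apply: (@cvg_near_cst _ _ _ _ \oo).
    near=> k; rewrite /hk min_l//.
    by near: k; exact: nbhs_infty_ger.
  apply.
  - by move=> k; apply/measurable_EFinP/measurable_funM => //; have [] := nhp k p.
  - by move=> k y _; rewrite lee_fin mulr_ge0 ?powR_ge0.
  - move=> y _ k l kl; rewrite lee_fin ler_wpM2r// ge0_ler_powR ?nnegrE ?(ltW p0)//.
    by rewrite /hk le_min ge_min lexx/= ge_min ler_nat kl orbT.
rewrite -(cvg_lim _ cvgI)//; apply: lime_le; first by apply/cvg_ex; eexists; exact: cvgI.
by apply: nearW => k; exact: Ik.
Unshelve. all: by end_near. Qed.

End potential_bound.

(** * Geometry of the ball *)

Import ComplexField.Normc.
Local Open Scope complex_scope.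

Section complex_extra.
Context {R : realType}.
Implicit Types (x y : R[i]) (r : R).

Lemma normc_ge0 x : 0 <= normc x.
Proof. by case: x => a b /=; exact: sqrtr_ge0. Qed.

Lemma normc_conj x : normc (x^*) = normc x.
Proof. by case: x => a b /=; rewrite sqrrN. Qed.

Lemma normc_real r : normc (r%:C) = `|r|.
Proof. by rewrite /= expr0n/= addr0 sqrtr_sqr. Qed.

Lemma sub1_real_complex r : 1 - r%:C = (1 - r)%:C.
Proof. by rewrite rmorphB rmorph1. Qed.

Lemma normc_distC x y : normc (x - y) = normc (y - x).
Proof. by rewrite -normcN opprB. Qed.

Lemma sqr_normcE x : normc x ^+ 2 = complex.Re x ^+ 2 + complex.Im x ^+ 2.
Proof. by case: x => a b /=; rewrite sqr_sqrtr// addr_ge0// sqr_ge0. Qed.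

Lemma mulr_conjc x : x * conjc x = (normc x ^+ 2)%:C.
Proof.
rewrite sqr_normcE; case: x => a b /=; apply/eqP; rewrite eq_complex/=.
by apply/andP; split; apply/eqP; ring.
Qed.

Lemma normc_sum (I : Type) (s : seq I) (F : I -> R[i]) :
  normc (\sum_(i <- s) F i) <= \sum_(i <- s) normc (F i).
Proof.
elim/big_ind2 : _ => [|x a y b xa yb|i _]; rewrite ?normc0//.
by rewrite (le_trans (le_normcD _ _))// lerD.
Qed.

Lemma normc_geB x y : normc x - normc y <= normc (x - y).
Proof. by rewrite lerBlDr -{1}(subrK y x) le_normcD. Qed.

Lemma Re_le_normc x : `|complex.Re x| <= normc x.
Proof.
by rewrite -sqrtr_sqr; case: x => a b /=; rewrite ler_wsqrtr// lerDl sqr_ge0.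
Qed.

Lemma Im_le_normc x : `|complex.Im x| <= normc x.
Proof.
by rewrite -sqrtr_sqr; case: x => a b /=; rewrite ler_wsqrtr// lerDr sqr_ge0.
Qed.

Lemma normc_le_ReIm x : normc x <= `|complex.Re x| + `|complex.Im x|.
Proof.
case: x => a b /=; rewrite -[leRHS]ger0_norm ?addr_ge0// -sqrtr_sqr.
rewrite ler_wsqrtr// sqrrD !real_normK ?num_real// lerD2r lerDl.
by rewrite mulrn_wge0// mulr_ge0.
Qed.

End complex_extra.

Section hermitian.
Context {R : realType} {n : nat}.
Implicit Types (x y z a b c : 'rV[R[i]]_n).

Definition hdist x y : R := normc (1 - hdot x y).
Definition defect x : R := 1 - hnorm x ^+ 2.

Lemma hnorm_ge0 x : 0 <= hnorm x.
Proof. exact: sqrtr_ge0. Qed.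

Lemma sqr_hnorm x : hnorm x ^+ 2 = \sum_(i < n) normc (x ord0 i) ^+ 2.
Proof. by rewrite sqr_sqrtr// sumr_ge0// => i _; exact: sqr_ge0. Qed.

Lemma normc_coord_le x i : normc (x ord0 i) <= hnorm x.
Proof.
rewrite -(@ler_pXn2r _ 2) ?nnegrE ?normc_ge0 ?hnorm_ge0// sqr_hnorm.
by rewrite (bigD1 i)//= lerDl sumr_ge0// => j _; exact: sqr_ge0.
Qed.

Lemma hdotC x y : hdot y x = (hdot x y)^*.
Proof.
rewrite /hdot raddf_sum/=; apply: eq_bigr => i _.
by rewrite rmorphM/= conjcK mulrC.
Qed.

Lemma hdotBl x y z : hdot (x - y) z = hdot x z - hdot y z.
Proof. by rewrite /hdot -sumrB; apply: eq_bigr => i _; rewrite !mxE mulrBl. Qed.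

Lemma hdotDl x y z : hdot (x + y) z = hdot x z + hdot y z.
Proof. by rewrite /hdot -big_split; apply: eq_bigr => i _; rewrite !mxE mulrDl. Qed.

Lemma hdotZl (k : R[i]) x z : hdot (k *: x) z = k * hdot x z.
Proof. by rewrite /hdot big_distrr/=; apply: eq_bigr => i _; rewrite mxE -mulrA. Qed.

Lemma hdotBr x y z : hdot z (x - y) = hdot z x - hdot z y.
Proof. by rewrite hdotC hdotBl rmorphB/= -!hdotC. Qed.

Lemma hdotZr (k : R[i]) x z : hdot z (k *: x) = conjc k * hdot z x.
Proof. by rewrite hdotC hdotZl rmorphM/= -hdotC. Qed.

Lemma hdotxx x : hdot x x = (hnorm x ^+ 2)%:C.
Proof.
rewrite sqr_hnorm /hdot raddf_sum/=; apply: eq_bigr => i _.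
exact: mulr_conjc.
Qed.

(** The arithmetic-geometric mean in each coordinate. It replaces the Cauchy-Schwarz inequality, as
    only vectors of norm at most 1 or sums of squares occur. *)
Lemma normc_hdot_le x y : normc (hdot x y) <= (hnorm x ^+ 2 + hnorm y ^+ 2) / 2.
Proof.
rewrite (le_trans (normc_sum _ _))// !sqr_hnorm -big_split/= mulr_suml.
apply: ler_sum => i _; rewrite normcM normc_conj.
have := sqr_ge0 (normc (x ord0 i) - normc (y ord0 i)); lra.
Qed.

Lemma normc_hdot_le1 x y : hnorm x <= 1 -> hnorm y <= 1 -> normc (hdot x y) <= 1.
Proof.
move=> x1 y1; rewrite (le_trans (normc_hdot_le x y))// ler_pdivrMr// mul1r.
by rewrite -[2]/(1 + 1) lerD// exprn_ile1// hnorm_ge0.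
Qed.

Lemma hdistC x y : hdist x y = hdist y x.
Proof. by rewrite /hdist (hdotC y x) -[in RHS]normc_conj rmorphB rmorph1. Qed.

Lemma hdistxx x : hnorm x <= 1 -> hdist x x = defect x.
Proof.
move=> x1; rewrite /hdist hdotxx sub1_real_complex normc_real ger0_norm//.
by rewrite subr_ge0 exprn_ile1// hnorm_ge0.
Qed.

Lemma defect_le_hdist x y : hnorm y <= 1 -> defect x <= 2 * hdist x y.
Proof.
move=> y1; rewrite /defect /hdist.
have := normc_geB 1 (hdot x y); rewrite normc1 => h1.
have h2 := normc_hdot_le x y.
have : hnorm y ^+ 2 <= 1 by rewrite exprn_ile1// hnorm_ge0.
lra.
Qed.

(* The form <x,y> - <x,b><b,y> is positive semidefinite for |b| <= 1. *)
Let hdot_reduced b x y : hdot x y - hdot x b * hdot b y =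
  hdot (x - hdot x b *: b) (y - hdot y b *: b) +
  (1 - hnorm b ^+ 2)%:C * (hdot x b * hdot b y).
Proof.
rewrite hdotBr !hdotBl !hdotZl hdotZr hdotZr hdotxx -(hdotC y b).
rewrite -sub1_real_complex; ring.
Qed.

(** 1 - <x,y> = (1 - al) + al (1 - ga) - (<x,y> - al ga). The last term is a value of the reduced
    form, hence in modulus at most the mean of its values at (x,x) and (y,y); each of these, |z|^2 -
    |<z,b>|^2, is at most 2 |1 - <z,b>|. So the error is again bounded by the sum of the two
    distances, whence the factor 2. *)
Lemma hdist_triangle b x y : hnorm x <= 1 -> hnorm y <= 1 -> hnorm b <= 1 ->
  hdist x y <= 2 * (hdist x b + hdist b y).
Proof.
move=> x1 y1 b1.
pose al := hdot x b; pose ga := hdot b y.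
have al1 : normc al <= 1 by exact: normc_hdot_le1.
have ga1 : normc ga <= 1 by exact: normc_hdot_le1.
have b10 : 0 <= 1 - hnorm b ^+ 2 by rewrite subr_ge0 exprn_ile1// hnorm_ge0.
have dgE z : hnorm (z - hdot z b *: b) ^+ 2 +
    (1 - hnorm b ^+ 2) * normc (hdot z b) ^+ 2 = hnorm z ^+ 2 - normc (hdot z b) ^+ 2.
  have := hdot_reduced b z z; rewrite !hdotxx (hdotC z b) mulr_conjc.
  by rewrite -rmorphB -rmorphM -rmorphD/= => /complexI ->.
have dgl z : hnorm z <= 1 -> hnorm z ^+ 2 - normc (hdot z b) ^+ 2 <= 2 * hdist z b.
  move=> z1; have zb1 := normc_hdot_le1 z1 b1.
  have z2 : hnorm z ^+ 2 <= 1 by rewrite exprn_ile1// hnorm_ge0.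
  have h := normc_geB 1 (hdot z b); rewrite normc1 in h.
  have h0 := normc_ge0 (hdot z b); rewrite /hdist; nra.
have Hxy : normc (hdot x y - al * ga) <= hdist x b + hdist b y.
  have gaE : normc ga = normc (hdot y b) by rewrite /ga hdotC normc_conj.
  rewrite hdot_reduced (le_trans (le_normcD _ _))// 2!normcM normc_real ger0_norm//.
  have h1 := normc_hdot_le (x - hdot x b *: b) (y - hdot y b *: b).
  have h2 : normc al * normc ga <= (normc al ^+ 2 + normc ga ^+ 2) / 2.
    by have := sqr_ge0 (normc al - normc ga); lra.
  have h3 := ler_wpM2l b10 h2.
  have := dgE x; have := dgE y; have := dgl _ x1; have := dgl _ y1.
  rewrite [hdist b y]hdistC -gaE -/al; lra.
have -> : hdist x y = normc ((1 - al) + al * (1 - ga) - (hdot x y - al * ga)).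
  by rewrite /hdist; congr normc; ring.
rewrite (le_trans (le_normcD _ _))// normcN.
have := le_normcD (1 - al) (al * (1 - ga)); rewrite normcM.
have := ler_wpM2r (normc_ge0 (1 - ga)) al1; rewrite mul1r.
rewrite /hdist -/al -/ga in Hxy *; lra.
Qed.

Lemma hnormZ (r : R) x : hnorm (r%:C *: x) = `|r| * hnorm x.
Proof.
rewrite -sqrtr_sqr -sqrtrM ?sqr_ge0// /hnorm; congr Num.sqrt.
rewrite big_distrr; apply: eq_bigr => i _; rewrite mxE normcM normc_real/=.
by rewrite exprMn real_normK ?num_real.
Qed.

Lemma hnorm0 : hnorm (0 : 'rV[R[i]]_n) = 0.
Proof.
by rewrite /hnorm big1 ?sqrtr0// => i _; rewrite mxE normc0 expr0n.
Qed.

Lemma hnorm_eq0 x : (hnorm x == 0) = (x == 0).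
Proof.
apply/eqP/eqP => [x0|->]; last exact: hnorm0.
apply/rowP => i; rewrite mxE; apply: eq0_normc; apply/eqP.
by rewrite eq_le normc_ge0 andbT -x0 normc_coord_le.
Qed.

End hermitian.

Section direction.
Context {R : realType} {n : nat}.
Hypothesis n1 : (1 <= n)%N.
Implicit Types (z : 'rV[R[i]]_n).

(** The boundary point above z; at z = 0 a basis vector serves, available because n is positive. *)
Lemma direction_exists z : exists a : 'rV[R[i]]_n, hnorm a = 1 /\
  z = (hnorm z)%:C *: a.
Proof.
have [->|z0] := eqVneq z 0.
  exists (\row_j (if j == Ordinal n1 then 1 else 0)); split; last first.
    by rewrite hnorm0 scale0r.
  rewrite /hnorm (bigD1 (Ordinal n1))//= mxE eqxx normc1 expr1n big1 ?addr0 ?sqrtr1//.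
  by move=> i i0; rewrite mxE (negbTE i0) normc0 expr0n.
have zn0 : hnorm z != 0 by rewrite hnorm_eq0.
exists ((hnorm z)^-1%:C *: z); split.
  by rewrite hnormZ ger0_norm ?invr_ge0 ?hnorm_ge0// mulVf.
by rewrite scalerA -rmorphM/= divff// scale1r.
Qed.

Lemma hdist_direction z (a : 'rV[R[i]]_n) : hnorm z <= 1 -> hnorm a = 1 ->
  z = (hnorm z)%:C *: a -> hdist z a = 1 - hnorm z.
Proof.
move=> z1 a1 za; rewrite /hdist {1}za hdotZl hdotxx a1 expr1n mulr1.
rewrite sub1_real_complex normc_real ger0_norm// subr_ge0//.
Qed.

Lemma one_sub_hnorm_le z : hnorm z <= 1 -> 1 - hnorm z <= defect z <= 2 * (1 - hnorm z).
Proof.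
by move=> z1; have z0 := hnorm_ge0 z; rewrite /defect; apply/andP; split; nra.
Qed.

End direction.

(** * Volumes of caps *)

Section reflection.
Context {R : realType}.
Local Notation mu := (@lebesgue_measure R).
Local Notation TR := (measurableTypeR R).

Let mrefl (q : R) : measurable_fun [set: TR] (fun x : TR => q - x : TR).
Proof. exact: measurable_funB. Qed.

Lemma lebesgue_measure_refl (q : R) (A : set TR) : measurable A ->
  pushforward mu (fun x : TR => q - x : TR) A = mu A.
Proof.
move=> mA; apply/esym.
have := @lebesgue_measure_unique R
  (pushforward mu (fun x : TR => q - x : TR)) _ A mA; apply.
move=> _ [[a b]] _ <-.
have e : (fun x : TR => q - x : TR) @^-1` `]a, b] = `[q - b, q - a[%classic.
  by apply/seteqP; split => x /=; rewrite !in_itv/= => /andP[h1 h2]; lra.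
transitivity (mu `[q - b, q - a[); last by rewrite -e.
rewrite !lebesgue_measure_itv/= !lte_fin ltrD2l ltrN2.
by case: ifPn => // _; congr EFin; ring.
Qed.

Lemma integral_refl (q : R) (g : R -> \bar R) : measurable_fun [set: TR] g ->
  (forall x, 0 <= g x)%E -> (\int[mu]_x g (q - x)%R = \int[mu]_x g x)%E.
Proof.
move=> mg g0.
rewrite (_ : (fun x => g (q - x)) = g \o (fun x : TR => q - x : TR))//.
rewrite -[LHS](@ge0_integral_pushforward _ _ _ _ R _ (mrefl q) mu setT g)//.
by apply: eq_measure_integral => //= A mA _; exact: lebesgue_measure_refl.
Qed.

(** A translation is the composition of two reflections. *)
Lemma integral_transl (q : R) (g : R -> \bar R) : measurable_fun [set: TR] g ->
  (forall x, 0 <= g x)%E -> (\int[mu]_x g (q + x)%R = \int[mu]_x g x)%E.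
Proof.
move=> mg g0; rewrite -(integral_refl q mg g0).
have := @integral_refl 0 (fun x => g (q - x)) (measurableT_comp mg (mrefl q)) (fun=> g0 _).
move=> <-; apply: eq_integral => x _; congr g; ring.
Qed.

(** The integral over 0 < y < A / th of the majorant (2 th y)^t + A^t of the next proof, divided by
    A^(t+1) and doubled for the two signs of x. *)
Definition strip_const (t th : R) : R :=
  2 * ((2 * th) `^ t / th `^ (t + 1) / (t + 1) + th^-1).

(** With q = sqrt Q, Q - x^2 is the product of y = q - |x| and q + |x|, the latter at least 2 th on
    the support. So y < A / th, and Q - x^2 lies between 2 th y and A: its power is at most (2 th
    y)^t if t < 0 and at most A^t otherwise. The bound is uniform in Q, which varies with the
    slice. *)
Lemma integral_strip_le (t th A Q : R) (G : R -> R) : -1 < t -> 0 < th -> 0 < A ->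
  measurable_fun [set: TR] G -> (forall x, 0 <= G x) ->
  (forall x, G x != 0 -> [/\ th <= `|x|, 0 < Q - x ^+ 2, Q - x ^+ 2 <= A &
     G x <= (Q - x ^+ 2) `^ t]) ->
  (\int[mu]_x (G x)%:E <= (strip_const t th * A `^ (t + 1))%:E)%E.
Proof.
move=> t1 th0 A0 mG G0 GQ.
pose B := A / th; have B0 : 0 < B by rewrite divr_gt0.
pose g (y : R) := ((2 * th) `^ t * y `^ t + A `^ t) * \1_[set l : TR | 0 < l < B] y.
have BE : [set l : TR | 0 < l < B] = `]0, B[%classic.
  by apply/seteqP; split => x /=; rewrite in_itv.
have mB : measurable [set l : TR | 0 < l < B] by rewrite BE.
have g0 y : (0 <= (g y)%:E)%E.
  by rewrite lee_fin mulr_ge0 ?addr_ge0 ?mulr_ge0 ?powR_ge0// indicE.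
have mpt : measurable_fun [set: TR] (fun y : TR => y `^ t) by exact: measurable_powR.
have mg : measurable_fun [set: TR] (fun y => (g y)%:E).
  apply/measurable_EFinP/measurable_funM; last exact: measurable_indic.
  by apply: measurable_funD => //; exact: measurable_funM.
have intg : (\int[mu]_y (g y)%:E = (((2 * th) `^ t / th `^ (t + 1) / (t + 1) + th^-1) *
    A `^ (t + 1))%:E)%E.
  rewrite /g; under eq_integral do rewrite mulrDl EFinD -mulrA EFinM [(A `^ t * _)%:E]EFinM.
  rewrite ge0_integralD//; first last.
  - by apply: emeasurable_funM => //; apply/measurable_EFinP/measurable_indic.
  - by move=> x _; rewrite mule_ge0 ?lee_fin ?powR_ge0.
  - apply: emeasurable_funM => //; apply/measurable_EFinP/measurable_funM.
      exact: mpt.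
    exact: measurable_indic.
  - by move=> x _; rewrite mule_ge0 ?lee_fin ?mulr_ge0 ?powR_ge0.
  rewrite !ge0_integralZl_EFin ?powR_ge0//; first last.
  - apply/measurable_EFinP/measurable_funM; first exact: mpt.
    exact: measurable_indic.
  - by move=> x _; rewrite lee_fin mulr_ge0 ?powR_ge0.
  - exact/measurable_EFinP/measurable_indic.
  rewrite integral_powR_indic ?(ltW B0)// integral_indic//= setIT.
  rewrite BE lebesgue_measure_itv/= lte_fin B0 oppr0 adde0 -!EFinM -EFinD; congr EFin.
  have -> : A `^ t * B = th^-1 * A `^ (t + 1).
    rewrite /B [RHS]mulrC mulrA; congr (_ / _).
    by rewrite powRD ?(gt_eqF A0) ?implybT// powRr1// ltW.
  have AB : A `^ (t + 1) = B `^ (t + 1) * th `^ (t + 1).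
    by rewrite -powRM ?(ltW B0) ?(ltW th0)// divfK// gt_eqF.
  rewrite AB; field.
  by rewrite !gt_eqF ?powR_gt0//=; lra.
pose q := Num.sqrt Q.
apply: (@le_trans _ _ (\int[mu]_x ((g (q - x))%:E + (g (q + x))%:E))%E).
  apply: ge0_le_integral => //.
  - by move=> x _; rewrite lee_fin.
  - exact/measurable_EFinP.
  - apply: emeasurable_funD; first exact: (measurableT_comp mg (mrefl q)).
    by apply: (measurableT_comp mg); exact: measurable_funD.
  move=> x _; have [->|Gx0] := eqVneq (G x) 0; first by rewrite adde_ge0.
  have [thx Qx QA GQx] := GQ x Gx0.
  have Q0 : 0 <= Q by have := sqr_ge0 x; lra.
  have qE : q ^+ 2 = Q by rewrite sqr_sqrtr.
  have q0 : 0 <= q by exact: sqrtr_ge0.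
  have fac : Q - x ^+ 2 = (q - x) * (q + x) by rewrite -qE; ring.
  have key y y' : 2 * th <= y' -> Q - x ^+ 2 = y * y' ->
      (Q - x ^+ 2) `^ t <= g y.
    move=> hy' Qy.
    have y'0 : 0 < y' by lra.
    have y0 : 0 < y by rewrite -(pmulr_lgt0 _ y'0) -Qy.
    have yB : y < B.
      rewrite /B ltr_pdivlMr//.
      have : y * (2 * th) <= y * y' by rewrite ler_pM2l.
      have : 0 < y * th by rewrite mulr_gt0.
      by rewrite -Qy; lra.
    rewrite /g indicE mem_set/= ?y0 ?yB// mulr1.
    have [t0|t0] := leP 0 t.
      apply: (@le_trans _ _ (A `^ t)).
        by rewrite ge0_ler_powR// nnegrE ltW.
      by rewrite lerDr mulr_ge0 ?powR_ge0.
    apply: (@le_trans _ _ ((2 * th * y) `^ t)).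
      rewrite ler_powR_neg ?(ltW t0) ?mulr_gt0// Qy mulrC ler_pM2l//.
    by rewrite powRM ?(ltW y0)// ?mulr_ge0 ?(ltW th0)// lerDl powR_ge0.
  have xq : `|x| <= q by rewrite -sqrtr_sqr ler_wsqrtr//; lra.
  have [x0|x0] := leP 0 x.
    rewrite ger0_norm// in xq thx.
    apply: (@le_trans _ _ (g (q - x))%:E); last by rewrite leeDl.
    by rewrite lee_fin (le_trans GQx)// (key _ (q + x))//; lra.
  rewrite ltr0_norm// in xq thx.
  apply: (@le_trans _ _ (g (q + x))%:E); last by rewrite leeDr.
  by rewrite lee_fin (le_trans GQx)// (key _ (q - x))//; [lra|rewrite fac mulrC].
rewrite ge0_integralD//; first last.
- by apply: (measurableT_comp mg); exact: measurable_funD.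
- exact: (measurableT_comp mg (mrefl q)).
rewrite (integral_refl q mg g0) (integral_transl q mg g0) intg -EFinD lee_fin.
by rewrite /strip_const le_eqVlt; apply/orP; left; apply/eqP; ring.
Qed.

End reflection.

Lemma ge0_integral_le_bound d (T : measurableType d) (R : realType)
    (mu : {measure set T -> \bar R}) (S : set T) (g : T -> \bar R) (M : R) :
  measurable S -> 0 <= M -> measurable_fun [set: T] g -> (forall x, 0 <= g x)%E ->
  (forall x, ~ S x -> g x = 0)%E -> (forall x, S x -> g x <= M%:E)%E ->
  (\int[mu]_x g x <= M%:E * mu S)%E.
Proof.
move=> mS M0 mg g0 gS gM; rewrite -integral_cst// -integral_mul_indic.
apply: ge0_le_integral => //.
- apply/measurable_EFinP/measurable_funM => //; exact: measurable_indic.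
- move=> x _; rewrite indicE; have [/set_mem xS|xS] := boolP (x \in S).
    by rewrite mulr1 gM.
  by rewrite mulr0 gS// => /mem_set; exact/negP.
Qed.

(** * Integration over planar strips and along one complex coordinate *)

Section lebesgue_C_integral.
Context {R : realType}.
Local Notation mu := (@lebesgue_measure R).
Local Notation TR := (measurableTypeR R).
Implicit Types G : R[i] -> \bar R.

Lemma measurable_Complex G : measurable_fun [set: R[i]] G ->
  measurable_fun [set: TR * TR] (fun z : TR * TR => G (z.1 +i* z.2)).
Proof. by move=> mG; exact: (measurableT_comp mG (@measurable_pair_complex R)). Qed.

Lemma integral_C_im G : measurable_fun [set: R[i]] G -> (forall x, 0 <= G x)%E ->
  (\int[@lebesgue_C R]_x G x = \int[mu]_y \int[mu]_x G (x +i* y)%C)%E.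
Proof.
move=> mG G0; rewrite (ge0_integral_pushforward (@measurable_pair_complex R))//.
by have /= <- := fubini_tonelli2 (m1 := mu) (m2 := mu) _ (measurable_Complex mG) (fun z => G0 _).
Qed.

Lemma integral_C_re G : measurable_fun [set: R[i]] G -> (forall x, 0 <= G x)%E ->
  (\int[@lebesgue_C R]_x G x = \int[mu]_x \int[mu]_y G (x +i* y)%C)%E.
Proof.
move=> mG G0; rewrite (ge0_integral_pushforward (@measurable_pair_complex R))//.
by have /= <- := fubini_tonelli1 (m1 := mu) (m2 := mu) _ (measurable_Complex mG) (fun z => G0 _).
Qed.

Let lebesgue_itvcc (c k : R) : 0 <= k ->
  mu [set x : TR | `|x - c| <= k] = (2 * k)%:E.
Proof.
move=> k0; rewrite (_ : [set x : TR | _] = `[c - k, c + k]%classic); last first.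
  apply/seteqP; split => x /=; rewrite in_itv/= ler_norml => /andP[h1 h2]; lra.
rewrite lebesgue_measure_itv/= lte_fin; case: ifPn => [_|]; first by congr EFin; ring.
by move=> h; congr EFin; lra.
Qed.

Let measurable_itvcc (c k : R) : measurable [set x : TR | `|x - c| <= k].
Proof.
apply: measurable_set_ler => //; apply: measurableT_comp => //.
exact: measurable_funB.
Qed.

(** [ax] tells whether the real or the imaginary part plays the role of x in [integral_strip_le];
    the other part ranges over an interval of length 2k. *)
Lemma integral_C_strip (ax : bool) (t th A Q c k : R) (G : R[i] -> R) :
  -1 < t -> 0 < th -> 0 < A -> 0 <= k ->
  measurable_fun [set: R[i]] G -> (forall x, 0 <= G x) ->
  (forall x, G x != 0 ->
    let r := if ax then complex.Re x else complex.Im x in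
    let s := if ax then complex.Im x else complex.Re x in
    [/\ th <= `|r|, `|s - c| <= k, 0 < Q - normc x ^+ 2, Q - normc x ^+ 2 <= A &
     G x <= (Q - normc x ^+ 2) `^ t]) ->
  (\int[@lebesgue_C R]_x (G x)%:E <=
     (strip_const t th * A `^ (t + 1) * (2 * k))%:E)%E.
Proof.
move=> t1 th0 A0 k0 mG G0 GQ.
have mG' : measurable_fun [set: R[i]] (fun x => (G x)%:E) by exact/measurable_EFinP.
have mGp := measurable_Complex mG'.
have sc0 : 0 <= strip_const t th.
  have t10 : 0 < t + 1 by lra.
  by rewrite mulr_ge0// addr_ge0// ?invr_ge0 ?(ltW th0)// !(mulr_ge0, powR_ge0, invr_ge0)// ltW.
have G0' x : (0 <= (G x)%:E)%E by rewrite lee_fin.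
case: ax GQ => /= GQ.
  rewrite integral_C_im// EFinM -(lebesgue_itvcc c k0).
  apply: ge0_integral_le_bound => //; first by rewrite mulr_ge0 ?powR_ge0.
  - exact: (measurable_fun_fubini_tonelli_G
      (fun z : TR * TR => (G (z.1 +i* z.2))%:E)).
  - by move=> y; apply: integral_ge0 => x _.
  - move=> y /= ny; apply: integral0_eq => x _.
    by have [->//|/GQ[]] := eqVneq (G (x +i* y)) 0.
  - move=> y _; apply: (@integral_strip_le R t th A (Q - y ^+ 2)) => //.
    + exact: (measurableT_comp mG (measurableT_comp (@measurable_pair_complex R) (pair2_measurable y))).
    + move=> x /GQ; rewrite sqr_normcE/= => -[h1 h2 h3 h4 h5].
      by have <- : Q - (x ^+ 2 + y ^+ 2) = Q - y ^+ 2 - x ^+ 2 by ring.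
rewrite integral_C_re// EFinM -(lebesgue_itvcc c k0).
apply: ge0_integral_le_bound => //; first by rewrite mulr_ge0 ?powR_ge0.
- exact: (measurable_fun_fubini_tonelli_F
    (fun z : TR * TR => (G (z.1 +i* z.2))%:E)).
- by move=> y; apply: integral_ge0 => x _.
- move=> y /= ny; apply: integral0_eq => x _.
  by have [->//|/GQ[]] := eqVneq (G (y +i* x)) 0.
- move=> y _; apply: (@integral_strip_le R t th A (Q - y ^+ 2)) => //.
  + exact: (measurableT_comp mG (measurableT_comp (@measurable_pair_complex R) (pair1_measurable y))).
  + move=> x /GQ; rewrite sqr_normcE/= => -[h1 h2 h3 h4 h5].
    by have <- : Q - (y ^+ 2 + x ^+ 2) = Q - y ^+ 2 - x ^+ 2 by ring.
Qed.

Definition csquare (c : R[i]) (h : R) : set R[i] :=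
  [set x | `|complex.Re x - complex.Re c| <= h /\
           `|complex.Im x - complex.Im c| <= h].

Lemma measurable_csquare c h : measurable (csquare c h).
Proof.
apply: measurableI; apply: measurable_set_ler => //; apply: measurableT_comp => //.
  by apply: measurable_funB => //; exact: measurable_Re.
by apply: measurable_funB => //; exact: measurable_Im.
Qed.

Lemma lebesgue_csquare c h : 0 <= h ->
  @lebesgue_C R (csquare c h) = ((2 * h) ^+ 2)%:E.
Proof.
move=> h0; rewrite /lebesgue_C /pushforward.
rewrite (_ : _ @^-1` _ = [set x : TR | `|x - complex.Re c| <= h] `*`
  [set x : TR | `|x - complex.Im c| <= h]); last by apply/seteqP; split.
rewrite product_measure1E; [|exact: measurable_itvcc|exact: measurable_itvcc].
by rewrite expr2 EFinM; congr (_ * _)%E; exact: lebesgue_itvcc.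
Qed.

Lemma csquare_normc c h x : csquare c h x -> normc (x - c) <= 2 * h.
Proof.
move=> [h1 h2]; rewrite (le_trans (normc_le_ReIm _))// mulrDl mul1r.
by case: x c h1 h2 => [a b] [a' b'] /= h1 h2; rewrite lerD.
Qed.

Lemma normc_csquare c h x : normc (x - c) <= h -> csquare c h x.
Proof.
move=> xch; have := Re_le_normc (x - c); have := Im_le_normc (x - c).
case: x c xch => [a b] [a' b'] /= xch h1 h2.
by split; rewrite /= (le_trans _ xch).
Qed.

End lebesgue_C_integral.

Section insert.
Context {R : realType}.

Definition rV_ins (T : Type) n (j : 'I_n.+1) (x : T) (v : 'rV[T]_n) : 'rV[T]_n.+1 :=
  \row_i if unlift j i is Some k then v ord0 k else x.

Lemma rV_ins_same (T : Type) n (j : 'I_n.+1) (x : T) (v : 'rV[T]_n) :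
  rV_ins j x v ord0 j = x.
Proof. by rewrite mxE unlift_none. Qed.

Lemma rV_ins_lift (T : Type) n (j : 'I_n.+1) (x : T) (v : 'rV[T]_n) k :
  rV_ins j x v ord0 (lift j k) = v ord0 k.
Proof. by rewrite mxE liftK. Qed.

Lemma rV_ins_cons (T : Type) n (k : 'I_n.+1) (x y : T) (v : 'rV[T]_n) :
  rV_ins (lift ord0 k) x (rV_ins ord0 y v) = rV_ins ord0 y (rV_ins k x v).
Proof.
apply/rowP => i; case: (unliftP ord0 i) => [i' ->|->].
  rewrite rV_ins_lift; case: (unliftP k i') => [i'' ->|->].
    have -> : lift ord0 (lift k i'') = lift (lift ord0 k) (lift ord0 i'').
      by apply/val_inj; rewrite /= /bump !add1n ltnS; case: leqP.
    by rewrite !rV_ins_lift.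
  by rewrite !rV_ins_same.
rewrite rV_ins_same.
have -> : @ord0 n.+1 = lift (lift ord0 k) ord0 by apply/val_inj.
by rewrite rV_ins_lift rV_ins_same.
Qed.

Lemma measurable_rV_ins d (T : measurableType d) n (j : 'I_n.+1) :
  measurable_fun [set: T * 'rV[T]_n] (fun z : T * 'rV[T]_n => rV_ins j z.1 z.2).
Proof.
apply: measurable_fun_rV => i; under eq_fun do rewrite mxE.
case: unliftP => [k _|_]; last exact: measurable_fst.
exact: (measurableT_comp (measurable_rV_coord k) measurable_snd).
Qed.

Lemma measurable_rV_ins1 d (T : measurableType d) n (j : 'I_n.+1) (v : 'rV[T]_n) :
  measurable_fun [set: T] (fun x : T => rV_ins j x v).
Proof. exact: (measurableT_comp (measurable_rV_ins j) (pair2_measurable v)). Qed.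

Lemma integral_rV_ins0 n (F : 'rV[R[i]]_n.+1 -> \bar R) :
  measurable_fun [set: 'rV[R[i]]_n.+1] F -> (forall w, 0 <= F w)%E ->
  (\int[lebesgue_Cn R n.+1]_w F w =
   \int[@lebesgue_C R]_x \int[lebesgue_Cn R n]_v F (rV_ins ord0 x v))%E /\
  (\int[lebesgue_Cn R n.+1]_w F w =
   \int[lebesgue_Cn R n]_v \int[@lebesgue_C R]_x F (rV_ins ord0 x v))%E.
Proof.
move=> mF F0.
have E : (\int[lebesgue_Cn R n.+1]_w F w =
    \int[@lebesgue_C R \x lebesgue_Cn R n]_z F (rV_ins ord0 z.1 z.2))%E.
  by rewrite (ge0_integral_pushforward (@measurable_rV_cons _ _ n)).
have mF' := measurableT_comp mF (@measurable_rV_ins _ R[i] n ord0).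
by rewrite E; split; [rewrite fubini_tonelli1|rewrite fubini_tonelli2].
Qed.

(** [lebesgue_Cn] splits off only its first coordinate, whereas the coordinate bounded away from 0
    depends on the cap. The induction exposes coordinate 0, slices the others along k, and puts
    coordinate 0 back by a second splitting; [rV_ins_cons] matches the two orders of insertion. *)
Lemma integral_rV_ins n (j : 'I_n.+1) (F : 'rV[R[i]]_n.+1 -> \bar R) :
  measurable_fun [set: 'rV[R[i]]_n.+1] F -> (forall w, 0 <= F w)%E ->
  (\int[lebesgue_Cn R n.+1]_w F w =
   \int[lebesgue_Cn R n]_v \int[@lebesgue_C R]_x F (rV_ins j x v))%E.
Proof.
elim: n j F => [|n IHn] j F mF F0.
  by rewrite (ord1 j); have [_] := integral_rV_ins0 mF F0.
case: (unliftP ord0 j) => [k ->|->]; last by have [_] := integral_rV_ins0 mF F0.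
have [-> _] := integral_rV_ins0 mF F0.
transitivity (\int[@lebesgue_C R]_y \int[lebesgue_Cn R n]_v
    \int[@lebesgue_C R]_x F (rV_ins ord0 y (rV_ins k x v)))%E.
  apply: eq_integral => y _; rewrite (IHn k)//.
  exact: (measurableT_comp mF (measurableT_comp (@measurable_rV_ins _ R[i] n.+1 ord0) (pair1_measurable y))).
pose G (w : 'rV[R[i]]_n.+1) := (\int[@lebesgue_C R]_x F (rV_ins (lift ord0 k) x w))%E.
have mG : measurable_fun [set: 'rV[R[i]]_n.+1] G.
  apply: (measurable_fun_fubini_tonelli_G
    (fun z : R[i] * 'rV[R[i]]_n.+1 => F (rV_ins (lift ord0 k) z.1 z.2))) => //.
  exact: (measurableT_comp mF (measurable_rV_ins _)).
have G0 w : (0 <= G w)%E by apply: integral_ge0.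
have [-> _] := integral_rV_ins0 mG G0.
apply: eq_integral => y _; apply: eq_integral => v _; apply: eq_integral => x _.
by rewrite rV_ins_cons.
Qed.

End insert.

Section boxes.
Context {R : realType}.

Definition cbox n (c : 'rV[R[i]]_n) (h : R) : set 'rV[R[i]]_n :=
  [set v | forall k, csquare (c ord0 k) h (v ord0 k)].

Lemma measurable_cbox n (c : 'rV[R[i]]_n) h : measurable (cbox c h).
Proof.
rewrite (_ : cbox c h = \bigcap_(k in [set: 'I_n])
    [set v | csquare (c ord0 k) h (v ord0 k)]); last first.
  by apply/seteqP; split => v H k => [_|]; exact: H.
apply: fin_bigcap_measurable => // k _.
have := measurable_rV_coord k (measurableT : measurable [set: 'rV[R[i]]_n])
  (measurable_csquare (c ord0 k) h).
by rewrite setTI.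
Qed.

Lemma lebesgue_cbox n (c : 'rV[R[i]]_n) h : 0 <= h ->
  lebesgue_Cn R n (cbox c h) = (((2 * h) ^+ 2) ^+ n)%:E.
Proof.
move=> h0; elim: n c => [|n IHn] c.
  by rewrite /= diracE mem_set//= => -[].
rewrite [LHS](_ : _ = (@lebesgue_C R \x lebesgue_Cn R n)%E
  (csquare (c ord0 ord0) h `*` cbox (\row_k c ord0 (lift ord0 k)) h)).
  rewrite product_measure1E; [|exact: measurable_csquare|exact: measurable_cbox].
  rewrite [X in (_ * X)%E]IHn (exprS ((2 * h) ^+ 2) n) (EFinM ((2 * h) ^+ 2)); congr (_ * _)%E.
  exact: lebesgue_csquare.
rewrite /= /lebesgue_cons /pushforward; congr product_measure1.
apply/seteqP; split => [[x v] H|[x v] [/= xc vc] k]; last first.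
  case: (unliftP ord0 k) => [i ->|->]; rewrite mxE ?unlift_none// liftK.
  by have := vc i; rewrite mxE.
split => /= [|k]; first by have := H ord0; rewrite mxE unlift_none.
by have := H (lift ord0 k); rewrite !mxE liftK.
Qed.

Section slices.
Variables (n : nat) (j : 'I_n.+1) (F : 'rV[R[i]]_n.+1 -> \bar R).
Variables (c : 'rV[R[i]]_n) (h M : R).
Hypothesis mF : measurable_fun [set: 'rV[R[i]]_n.+1] F.
Hypothesis F0 : forall w, (0 <= F w)%E.
Hypothesis h0 : 0 <= h.
Hypothesis M0 : 0 <= M.

Let G v := (\int[@lebesgue_C R]_x F (rV_ins j x v))%E.

Let mG : measurable_fun [set: 'rV[R[i]]_n] G.
Proof.
apply: (measurable_fun_fubini_tonelli_G
  (fun z : R[i] * 'rV[R[i]]_n => F (rV_ins j z.1 z.2))) => //.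
exact: (measurableT_comp mF (measurable_rV_ins _)).
Qed.

Let G0 v : (0 <= G v)%E. Proof. exact: integral_ge0. Qed.

Lemma integral_slice_le :
  (forall v x, ~ cbox c h v -> F (rV_ins j x v) = 0%E) ->
  (forall v, cbox c h v -> G v <= M%:E)%E ->
  (\int[lebesgue_Cn R n.+1]_w F w <= (M * ((2 * h) ^+ 2) ^+ n)%:E)%E.
Proof.
move=> H1 H2; rewrite (integral_rV_ins j)// EFinM -(lebesgue_cbox c h0).
apply: ge0_integral_le_bound => //; first exact: measurable_cbox.
by move=> v vc; apply: integral0_eq => x _; exact: H1.
Qed.

Lemma le_integral_slice : (forall v, cbox c h v -> M%:E <= G v)%E ->
  ((M * ((2 * h) ^+ 2) ^+ n)%:E <= \int[lebesgue_Cn R n.+1]_w F w)%E.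
Proof.
move=> H1; rewrite (integral_rV_ins j)// EFinM -(lebesgue_cbox c h0).
rewrite -integral_cst//; last exact: measurable_cbox.
rewrite -integral_mul_indic; apply: ge0_le_integral => //.
- by move=> v _; rewrite lee_fin mulr_ge0// indicE.
- apply/measurable_EFinP/measurable_funM => //; apply: measurable_indic.
  exact: measurable_cbox.
- move=> v _; rewrite indicE; have [/set_mem vc|vc] := boolP (v \in cbox c h).
    by rewrite mulr1 H1.
  by rewrite mulr0; exact: G0.
Qed.

End slices.

Definition axis (ax : bool) (z : R[i]) : R :=
  if ax then complex.Re z else complex.Im z.

Definition rV_rest n (j : 'I_n.+1) (w : 'rV[R[i]]_n.+1) : 'rV[R[i]]_n :=
  \row_k w ord0 (lift j k).

Lemma rV_rest_ins n (j : 'I_n.+1) x (v : 'rV[R[i]]_n) : rV_rest j (rV_ins j x v) = v.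
Proof. by apply/rowP => k; rewrite mxE rV_ins_lift. Qed.

Lemma sqr_hnorm_split n (j : 'I_n.+1) (w : 'rV[R[i]]_n.+1) :
  hnorm w ^+ 2 = normc (w ord0 j) ^+ 2 + hnorm (rV_rest j w) ^+ 2.
Proof.
rewrite !sqr_hnorm (bigD1_ord j)//=; congr (_ + _).
by apply: eq_bigr => k _; rewrite mxE.
Qed.

Lemma hdot_split n (j : 'I_n.+1) (w a : 'rV[R[i]]_n.+1) :
  hdot w a = w ord0 j * conjc (a ord0 j) + hdot (rV_rest j w) (rV_rest j a).
Proof.
rewrite /hdot (bigD1_ord j)//=; congr (_ + _).
by apply: eq_bigr => k _; rewrite !mxE.
Qed.

(** In each slice one real axis of coordinate j carries the singularity of defect^t, and the other
    lies in an interval whose centre [kap] may vary with the slice. This variation accommodates the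
    thin direction of a cap, which is in general not a coordinate direction. *)
Lemma integral_slab_le n (j : 'I_n.+1) (ax : bool) (t th A k h : R)
    (c : 'rV[R[i]]_n) (kap : 'rV[R[i]]_n -> R) (F : 'rV[R[i]]_n.+1 -> R) :
  -1 < t -> 0 < th -> 0 < A -> 0 <= k -> 0 <= h ->
  measurable_fun [set: 'rV[R[i]]_n.+1] F -> (forall w, 0 <= F w) ->
  (forall w, F w != 0 ->
    [/\ cbox c h (rV_rest j w), th <= `|axis ax (w ord0 j)|,
        `|axis (~~ ax) (w ord0 j) - kap (rV_rest j w)| <= k,
        0 < defect w <= A & F w <= defect w `^ t]) ->
  (\int[lebesgue_Cn R n.+1]_w (F w)%:E <=
    (strip_const t th * A `^ (t + 1) * (2 * k) * ((2 * h) ^+ 2) ^+ n)%:E)%E.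
Proof.
move=> t1 th0 A0 k0 h0 mF F0 FH.
have sc0 : 0 <= strip_const t th.
  have t10 : 0 < t + 1 by lra.
  by rewrite mulr_ge0// addr_ge0// ?invr_ge0 ?(ltW th0)// !(mulr_ge0, powR_ge0, invr_ge0)// ltW.
have mF' : measurable_fun [set: 'rV[R[i]]_n.+1] (fun w => (F w)%:E) by exact/measurable_EFinP.
apply: (@integral_slice_le n j _ c h) => //.
- by apply: mulr_ge0; [apply: mulr_ge0; rewrite ?powR_ge0|rewrite mulr_ge0].
- move=> v x nv; have [->//|/FH[]] := eqVneq (F (rV_ins j x v)) 0.
  by rewrite rV_rest_ins.
- move=> v _; apply: (@integral_C_strip R ax t th A (1 - hnorm v ^+ 2) (kap v)) => //.
    exact: (measurableT_comp mF (measurable_rV_ins1 _ _)).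
  move=> x /FH[_]; rewrite rV_rest_ins rV_ins_same /defect (sqr_hnorm_split j).
  rewrite rV_rest_ins rV_ins_same => h1 h2 /andP[h3 h4] h5.
  have <- : 1 - (normc x ^+ 2 + hnorm v ^+ 2) = 1 - hnorm v ^+ 2 - normc x ^+ 2 by ring.
  by split => //; move: h2; rewrite /axis; case: (ax).
Qed.

End boxes.

Section complex_measurability.
Context d (T : measurableType d) (R : realType).
Implicit Types f g : T -> R[i].

Lemma measurable_fun_complex f :
  measurable_fun [set: T] (fun x => complex.Re (f x)) ->
  measurable_fun [set: T] (fun x => complex.Im (f x)) ->
  measurable_fun [set: T] f.
Proof.
move=> mr mi.
rewrite (_ : f = @pair_complex R \o (fun x => (complex.Re (f x), complex.Im (f x)))).
  apply: (measurableT_comp (@measurable_pair_complex R)).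
  exact: measurable_fun_pair.
by apply/funext => x /=; case: (f x).
Qed.

Lemma measurable_complexD f g : measurable_fun [set: T] f ->
  measurable_fun [set: T] g -> measurable_fun [set: T] (fun x => f x + g x).
Proof.
move=> mf mg.
have [mfr mfi] := (measurableT_comp (@measurable_Re R) mf, measurableT_comp (@measurable_Im R) mf).
have [mgr mgi] := (measurableT_comp (@measurable_Re R) mg, measurableT_comp (@measurable_Im R) mg).
apply: measurable_fun_complex.
  rewrite (_ : (fun _ => _) = fun x => complex.Re (f x) + complex.Re (g x)).
    exact: measurable_funD.
  by apply/funext => x; case: (f x) (g x) => [? ?] [? ?].
rewrite (_ : (fun _ => _) = fun x => complex.Im (f x) + complex.Im (g x)).
  exact: measurable_funD.
by apply/funext => x; case: (f x) (g x) => [? ?] [? ?].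
Qed.

Lemma measurable_complexM f g : measurable_fun [set: T] f ->
  measurable_fun [set: T] g -> measurable_fun [set: T] (fun x => f x * g x).
Proof.
move=> mf mg.
have [mfr mfi] := (measurableT_comp (@measurable_Re R) mf, measurableT_comp (@measurable_Im R) mf).
have [mgr mgi] := (measurableT_comp (@measurable_Re R) mg, measurableT_comp (@measurable_Im R) mg).
apply: measurable_fun_complex.
  rewrite (_ : (fun _ => _) = fun x => complex.Re (f x) * complex.Re (g x) -
      complex.Im (f x) * complex.Im (g x)).
    by apply: measurable_funB; exact: measurable_funM.
  by apply/funext => x; case: (f x) (g x) => [? ?] [? ?].
rewrite (_ : (fun _ => _) = fun x => complex.Re (f x) * complex.Im (g x) +
    complex.Im (f x) * complex.Re (g x)).
  by apply: measurable_funD; exact: measurable_funM.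
by apply/funext => x; case: (f x) (g x) => [? ?] [? ?].
Qed.

Lemma measurable_conjc f : measurable_fun [set: T] f ->
  measurable_fun [set: T] (fun x => conjc (f x)).
Proof.
move=> mf.
have [mfr mfi] := (measurableT_comp (@measurable_Re R) mf, measurableT_comp (@measurable_Im R) mf).
apply: measurable_fun_complex.
  rewrite (_ : (fun _ => _) = fun x => complex.Re (f x))//.
  by apply/funext => x; case: (f x).
rewrite (_ : (fun _ => _) = fun x => - complex.Im (f x)).
  exact: measurableT_comp mfi.
by apply/funext => x; case: (f x).
Qed.

Lemma measurable_complex_sum (I : Type) (s : seq I) (F : I -> T -> R[i]) :
  (forall i, measurable_fun [set: T] (F i)) ->
  measurable_fun [set: T] (fun x => \sum_(i <- s) F i x).
Proof.
move=> mF; elim: s => [|i s IHs].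
  by rewrite (_ : (fun _ => _) = cst 0)//; apply/funext => x; rewrite big_nil.
rewrite (_ : (fun _ => _) = fun x => F i x + \sum_(i <- s) F i x).
  exact: measurable_complexD.
by apply/funext => x; rewrite big_cons.
Qed.

End complex_measurability.

Section hermitian_measurability.
Context {R : realType} {n : nat}.
Local Notation V := 'rV[R[i]]_n.

Lemma measurable_hdot : measurable_fun [set: V * V] (fun z : V * V => hdot z.1 z.2).
Proof.
apply: measurable_complex_sum => i; apply: measurable_complexM.
  exact: (measurableT_comp (measurable_rV_coord i) measurable_fst).
apply: measurable_conjc.
exact: (measurableT_comp (measurable_rV_coord i) measurable_snd).
Qed.

Lemma measurable_hdist : measurable_fun [set: V * V] (fun z : V * V => hdist z.1 z.2).
Proof.
apply: (measurableT_comp (@measurable_normc R)).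
rewrite (_ : (fun _ => _) = fun z : V * V => 1 + (-1) * hdot z.1 z.2).
  apply: measurable_complexD => //; apply: measurable_complexM => //.
  exact: measurable_hdot.
by apply/funext => z; rewrite mulN1r.
Qed.

Lemma measurable_hdist1 (a : V) : measurable_fun [set: V] (fun z => hdist z a).
Proof. exact: (measurableT_comp measurable_hdist (pair2_measurable a)). Qed.

Lemma measurable_defect : measurable_fun [set: V] (@defect R n).
Proof.
by apply: measurable_funB => //; apply: measurable_funX; exact: measurable_hnorm.
Qed.

Lemma measurable_defect_powR t : measurable_fun [set: V] (fun z => defect z `^ t).
Proof. exact: (measurableT_comp (measurable_powR _) measurable_defect). Qed.

Lemma unit_ball_defect (z : V) : unit_ball z -> 0 < defect z <= 1.
Proof.
rewrite /unit_ball/= => z1; have z0 := hnorm_ge0 z.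
rewrite subr_gt0 lerBlDr lerDl sqr_ge0 andbT.
by rewrite exprn_ilt1.
Qed.

Lemma defect_gt0_ball (z : V) : 0 < defect z -> unit_ball z.
Proof.
rewrite /unit_ball/= subr_gt0 => z1; have z0 := hnorm_ge0 z.
by rewrite ltNge; apply/negP => h; move: z1; rewrite ltNge exprn_ege1.
Qed.

Lemma sqr_hnormD (x y : V) :
  hnorm (x + y) ^+ 2 = hnorm x ^+ 2 + hnorm y ^+ 2 + 2 * complex.Re (hdot x y).
Proof.
have E : hdot (x + y) (x + y) = hdot x x + hdot y y + (hdot x y + conjc (hdot x y)).
  rewrite hdotC hdotDl [hdot x (x + y)]hdotC [hdot y (x + y)]hdotC !hdotDl.
  rewrite !rmorphD/= !conjcK (hdotC x y) !hdotxx; ring.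
have := congr1 (@complex.Re R) E; rewrite !hdotxx /= => ->.
by case: (hdot x y) => a b /=; ring.
Qed.

Lemma hnormN (x : V) : hnorm (- x) = hnorm x.
Proof.
by rewrite /hnorm; congr Num.sqrt; apply: eq_bigr => i _; rewrite mxE normcN.
Qed.

End hermitian_measurability.

(** * Integrability of powers of the defect over the ball *)

Section ball_volume.
Context {R : realType} {n : nat}.
Local Notation V := 'rV[R[i]]_n.+1.
Local Notation L := (lebesgue_Cn R n.+1).

(** If |w|^2 >= 1/2, the largest of the 2(n+1) real coordinates of w is at least 1 / (2 sqrt(n+1));
    this smaller value avoids the root. *)
Definition axis_min : R := (4 * n.+1%:R)^-1.

Lemma axis_min_gt0 : 0 < axis_min.
Proof. by rewrite invr_gt0 mulr_gt0// ltr0n. Qed.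

Lemma axis_min_lt1 : axis_min < 1.
Proof.
rewrite invf_lt1 ?mulr_gt0 ?ltr0n//.
have : 1 <= n.+1%:R :> R by rewrite ler1n.
lra.
Qed.

Lemma axis_min_le (w : V) : 1 / 2 <= hnorm w ^+ 2 ->
  exists j ax, axis_min <= `|axis ax (w ord0 j)|.
Proof.
move=> w2; apply: contrapT => H.
have Hj j ax : `|axis ax (w ord0 j)| <= axis_min.
  by rewrite leNgt; apply/negP => h; apply: H; exists j, ax; exact: ltW.
have : hnorm w ^+ 2 <= \sum_(i < n.+1) (2 * axis_min ^+ 2).
  rewrite sqr_hnorm; apply: ler_sum => i _; rewrite sqr_normcE.
  have := Hj i true; have := Hj i false; rewrite /axis.
  have p0 := axis_min_gt0.
  rewrite -(real_normK (num_real (complex.Re _))) -(real_normK (num_real (complex.Im _))).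
  have := normr_ge0 (complex.Re (w ord0 i)); have := normr_ge0 (complex.Im (w ord0 i)).
  nra.
rewrite sumr_const card_ord -[_ *+ n.+1]mulr_natr; apply/negP; rewrite -ltNge (lt_le_trans _ w2)//.
have e : axis_min * n.+1%:R = 1 / 4.
  have : n.+1%:R != 0 :> R by rewrite pnatr_eq0.
  by rewrite /axis_min; move: n.+1%:R => m m0; field.
have -> : 2 * axis_min ^+ 2 * n.+1%:R = 2 * axis_min * (1 / 4) by rewrite -e; ring.
have := axis_min_lt1; lra.
Qed.

Let mball : measurable (@unit_ball R n.+1) := @measurable_unit_ball R n.+1.

Let measurable_axis (ax : bool) (j : 'I_n.+1) :
  measurable_fun [set: V] (fun w : V => axis ax (w ord0 j)).
Proof.
by case: ax; [apply: (measurableT_comp (@measurable_Re R))|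
  apply: (measurableT_comp (@measurable_Im R))]; exact: measurable_rV_coord.
Qed.

Lemma integral_axis_lty (t : R) (j : 'I_n.+1) (ax : bool) : -1 < t ->
  (\int[L]_w (defect w `^ t * \1_[set w : V | unit_ball w /\
     axis_min <= `|axis ax (w ord0 j)|] w)%:E < +oo)%E.
Proof.
move=> t1; set S := [set w : V | _].
have mS : measurable S.
  apply: measurableI => //; apply: measurable_set_ler => //.
  exact: (measurableT_comp _ (measurable_axis ax j)).
apply: le_lt_trans (ltry _).
apply: (@integral_slab_le R n j ax t axis_min 1 1 1 0 (fun=> 0)) => //.
- exact: axis_min_gt0.
- apply: measurable_funM; first exact: measurable_defect_powR.
  exact: measurable_indic.
- by move=> w; rewrite mulr_ge0 ?powR_ge0// indicE.
- move=> w; rewrite indicE; have [/set_mem[wB wax] _|] := boolP (w \in S); last first.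
    by rewrite mulr0 eqxx.
  have cle i : normc (w ord0 i) <= 1 by rewrite (le_trans (normc_coord_le _ _))// ltW.
  split => //.
  + move=> k; rewrite !mxE; apply: normc_csquare; rewrite subr0; exact: cle.
  + rewrite subr0; apply: le_trans (cle j).
    by case: (ax); [exact: Im_le_normc|exact: Re_le_normc].
  + exact: unit_ball_defect.
  + by rewrite mulr1.
Qed.

(** Where the defect is at least 1/2 its power is at most [K0], the sum of the bounds for the two
    signs of t. Elsewhere |w|^2 > 1/2, and [axis_min_le] places w in one of finitely many slabs. *)
Lemma ball_integral_lty (t : R) : -1 < t ->
  (\int[L]_(w in unit_ball) (defect w `^ t)%:E < +oo)%E.
Proof.
move=> t1; rewrite -integral_mul_indic.
pose K0 : R := 1 + (1 / 2) `^ t.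
have K00 : 0 <= K0 by rewrite addr_ge0 ?powR_ge0.
pose F (i : 'I_n.+1 * bool) (w : V) := defect w `^ t * \1_[set w : V | unit_ball w /\
     axis_min <= `|axis i.2 (w ord0 i.1)|] w.
have mS i : measurable [set w : V | unit_ball w /\ axis_min <= `|axis i.2 (w ord0 i.1)|].
  apply: measurableI => //; apply: measurable_set_ler => //.
  exact: (measurableT_comp _ (measurable_axis i.2 i.1)).
have mF i : measurable_fun [set: V] (fun w => (F i w)%:E).
  apply/measurable_EFinP/measurable_funM; first exact: measurable_defect_powR.
  exact: measurable_indic.
have F0 i w : (0 <= (F i w)%:E)%E by rewrite lee_fin mulr_ge0 ?powR_ge0// indicE.
have mb : measurable (cbox (0 : V) 1) by exact: measurable_cbox.
apply: (@le_lt_trans _ _ (\int[L]_w ((K0 * \1_(cbox (0 : V) 1) w)%:E +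
    \sum_(i : 'I_n.+1 * bool) (F i w)%:E))%E).
  apply: ge0_le_integral => //.
  - by move=> w _; rewrite lee_fin mulr_ge0 ?powR_ge0// indicE.
  - apply/measurable_EFinP/measurable_funM; first exact: measurable_defect_powR.
    exact: measurable_indic.
  - apply: emeasurable_funD; last exact: emeasurable_sum.
    by apply/measurable_EFinP/measurable_funM => //; exact: measurable_indic.
  move=> w _; rewrite [X in X%:E](_ : _ = defect w `^ t * \1_unit_ball w)//.
  rewrite [in leLHS]indicE; have [/set_mem wB|_] := boolP (w \in unit_ball); last first.
    by rewrite mulr0 adde_ge0 ?lee_fin ?mulr_ge0// ?sume_ge0.
  have /andP[d0 d1] := unit_ball_defect wB.
  rewrite mulr1 sumEFin -EFinD lee_fin.
  have cle i : normc (w ord0 i) <= 1 by rewrite (le_trans (normc_coord_le _ _))// ltW.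
  have wbox : cbox 0 1 w.
    by move=> k; rewrite mxE; apply: normc_csquare; rewrite subr0.
  rewrite [in leRHS]indicE mem_set// mulr1.
  have [dh|dh] := leP (1 / 2) (defect w).
    apply: (@le_trans _ _ K0); last by rewrite lerDl sumr_ge0// => i _; rewrite -lee_fin.
    have [t0|t0] := leP 0 t.
      apply: (@le_trans _ _ 1); last by rewrite lerDl powR_ge0.
      have -> : 1 = (1 : R) `^ t by rewrite powR1.
      by rewrite ge0_ler_powR// nnegrE ltW.
    by rewrite ler_wpDl// ler_powR_neg// ?ltW//; lra.
  have [j [ax jax]] : exists j ax, axis_min <= `|axis ax (w ord0 j)|.
    by apply: axis_min_le; move: dh; rewrite /defect; lra.
  apply: (@le_trans _ _ (F (j, ax) w)).
    by rewrite /F indicE mem_set ?mulr1.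
  rewrite (bigD1 (j, ax))//= addrCA lerDl addr_ge0// sumr_ge0// => i _.
  by rewrite -lee_fin.
rewrite ge0_integralD//; first last.
- exact: emeasurable_sum.
- by move=> w _; rewrite sume_ge0.
- by apply/measurable_EFinP/measurable_funM => //; exact: measurable_indic.
- by move=> w _; rewrite lee_fin mulr_ge0// indicE.
rewrite lte_add_pinfty//.
  rewrite integral_mul_indic integral_cst//.
  by rewrite [X in (_ * X)%E](_ : _ = (((2 * 1) ^+ 2) ^+ n.+1)%:E) ?ltry//; exact: lebesgue_cbox.
rewrite ge0_integral_sum//; apply: lte_sum_pinfty => i _.
exact: integral_axis_lty.
Qed.

End ball_volume.

Section tent_volume.
Context {R : realType} {n : nat}.
Local Notation V := 'rV[R[i]]_n.+1.
Local Notation L := (lebesgue_Cn R n.+1).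
Local Notation th := (@axis_min R n).

Let mball : measurable (@unit_ball R n.+1) := @measurable_unit_ball R n.+1.
Let th0 : 0 < th := axis_min_gt0.

Definition cap (a : V) (r : R) : set V := [set w | unit_ball w /\ hdist w a < r].

Lemma measurable_cap a r : measurable (cap a r).
Proof.
by apply: measurableI => //; apply: measurable_set_ltr => //; exact: measurable_hdist1.
Qed.

Lemma axis_le_normc ax (z : R[i]) : `|axis ax z| <= normc z.
Proof. by case: ax; [exact: Re_le_normc|exact: Im_le_normc]. Qed.

Lemma axisB ax (z z' : R[i]) : axis ax (z - z') = axis ax z - axis ax z'.
Proof. by case: ax z z' => -[? ?] [? ?]. Qed.

(** |w - a|^2 = |w|^2 + 1 - 2 Re <w,a>, and Re <w,a> is at least 1 - r. Hence the size sqrt r of a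
    cap. *)
Lemma cap_near (a w : V) r : hnorm a = 1 -> cap a r w -> hnorm (w - a) ^+ 2 <= 2 * r.
Proof.
rewrite /cap/= /unit_ball/= => a1 [w1 wa]; rewrite sqr_hnormD hnormN a1.
have -> : complex.Re (hdot w (- a)) = - complex.Re (hdot w a).
  rewrite -scaleN1r hdotZr rmorphN rmorph1 mulN1r.
  by case: (hdot w a).
have : complex.Re (1 - hdot w a) <= r.
  rewrite (le_trans (ler_norm _))// (le_trans (Re_le_normc _))//; exact: ltW.
rewrite (_ : complex.Re (1 - hdot w a) = 1 - complex.Re (hdot w a)); last first.
  by case: (hdot w a).
have : hnorm w ^+ 2 <= 1 by rewrite exprn_ile1// ?hnorm_ge0// ltW.
lra.
Qed.

(** Take a real axis of a coordinate j on which a is at least th. All coordinates of w are within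
    sqrt(2r) of those of a, so this axis stays above th/2. Given the others, w_j is within r/th of
    the solution [c] of <w,a> = 1, and the defect is at most 2r. The slab estimate yields the
    product of r^(t+1), r and r^n. *)
Lemma small_cap_integral_le (t : R) : -1 < t -> exists2 C : R, 0 < C &
  forall (a : V) r, hnorm a = 1 -> 0 < r -> r <= th ^+ 2 / 8 ->
  (\int[L]_w (defect w `^ t * \1_(cap a r) w)%:E <=
    (C * r `^ (n.+1%:R + 1 + t))%:E)%E.
Proof.
move=> t1; have t10 : 0 < t + 1 by lra.
have sc0 : 0 < strip_const t (th / 2).
  by rewrite mulr_gt0// addr_gt0// ?invr_gt0 ?(divr_gt0, mulr_gt0, invr_gt0, powR_gt0).
exists (strip_const t (th / 2) * 2 `^ (t + 1) * (2 / th) * 8 ^+ n).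
  by rewrite mulr_gt0 ?exprn_gt0// mulr_gt0 ?divr_gt0// mulr_gt0// powR_gt0.
move=> a r a1 r0 rth.
have [j [ax jax]] : exists j ax, th <= `|axis ax (a ord0 j)|.
  by apply: axis_min_le; rewrite a1 expr1n; lra.
have aj : th <= normc (a ord0 j) by rewrite (le_trans jax)// axis_le_normc.
have aj0 : 0 < normc (a ord0 j) by exact: lt_le_trans aj.
have ajc0 : conjc (a ord0 j) != 0.
  by apply/eqP => h; move: aj0; rewrite -normc_conj h normc0 ltxx.
pose c v := (1 - hdot v (rV_rest j a)) / conjc (a ord0 j).
pose h := Num.sqrt (2 * r).
have r20 : 0 <= 2 * r by rewrite mulr_ge0// ltW.
have hE : h ^+ 2 = 2 * r by rewrite sqr_sqrtr.
have h0 : 0 <= h by exact: sqrtr_ge0.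
have mc : measurable (cap a r) := measurable_cap a r.
have Ar : 0 < 2 * r by rewrite mulr_gt0.
have kr : 0 <= r / th by rewrite divr_ge0// ltW.
apply: le_trans (@integral_slab_le R n j ax t (th / 2) (2 * r) (r / th) h
  (rV_rest j a) (fun v => axis (~~ ax) (c v)) _ t1 _ Ar kr h0 _ _ _) _.
- by rewrite divr_gt0.
- apply: measurable_funM; first exact: measurable_defect_powR.
  exact: measurable_indic.
- by move=> w; rewrite mulr_ge0 ?powR_ge0// indicE.
- move=> w; rewrite indicE; have [/set_mem wS _|] := boolP (w \in cap a r); last first.
    by rewrite mulr0 eqxx.
  have near := cap_near a1 wS; have [wB wa] := wS.
  have nc i : normc (w ord0 i - a ord0 i) <= h.
    rewrite -(@ler_pXn2r _ 2) ?nnegrE ?normc_ge0// hE (le_trans _ near)//.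
    rewrite ler_pXn2r ?nnegrE ?normc_ge0 ?hnorm_ge0//.
    by have := normc_coord_le (w - a) i; rewrite !mxE.
  have hth : h <= th / 2.
    rewrite -(@ler_pXn2r _ 2) ?nnegrE ?divr_ge0 ?(ltW th0)// hE; nra.
  split.
  + by move=> k; rewrite !mxE; exact: normc_csquare.
  + have := lerB_dist (axis ax (a ord0 j)) (axis ax (w ord0 j)).
    have := axis_le_normc ax (w ord0 j - a ord0 j); rewrite axisB distrC.
    have := nc j; lra.
  + rewrite -axisB (le_trans (axis_le_normc _ _))//.
    have -> : w ord0 j - c (rV_rest j w) = (hdot w a - 1) / conjc (a ord0 j).
      by rewrite /c (hdot_split j) [in RHS]addrC; field.
    rewrite normcM normcV normc_conj normc_distC.
    apply: ler_pM; rewrite ?invr_ge0 ?normc_ge0//; first exact: ltW.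
    by rewrite lef_pV2.
  + have /andP[-> _] := unit_ball_defect wB.
    rewrite /=; have := @defect_le_hdist _ _ w a; rewrite a1 => /(_ (lexx _)).
    by move: wa; rewrite /hdist; lra.
  + by rewrite mulr1.
- rewrite lee_fin; have -> : (2 * h) ^+ 2 = 8 * r by rewrite exprMn hE; ring.
  have -> : n.+1%:R + 1 + t = (t + 1) + 1 + n%:R.
    by rewrite -natr1; ring.
  rewrite (@powRD _ r (t + 1 + 1)) ?(gt_eqF r0) ?implybT//.
  rewrite (@powRD _ r (t + 1) 1) ?(gt_eqF r0) ?implybT//.
  rewrite powR_mulrn ?(ltW r0)// powRr1 ?(ltW r0)//.
  rewrite powRM ?(ltW r0)//.
  rewrite [(8 * r) ^+ n]exprMn.
  by rewrite le_eqVlt; apply/orP; left; apply/eqP; ring.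
Qed.

Lemma cap_integral_le (t : R) : -1 < t -> exists2 C : R, 0 < C &
  forall (a : V) r, hnorm a = 1 -> 0 < r ->
  (\int[L]_(w in cap a r) (defect w `^ t)%:E <= (C * r `^ (n.+1%:R + 1 + t))%:E)%E.
Proof.
move=> t1; have [C C0 HC] := small_cap_integral_le t1.
pose r0 := th ^+ 2 / 8; have r00 : 0 < r0 by rewrite divr_gt0// exprn_gt0.
have Ifin := @ball_integral_lty R n t t1.
pose I := fine (\int[L]_(w in unit_ball) (defect w `^ t)%:E)%E.
have I0 : 0 <= I by rewrite fine_ge0// integral_ge0// => w _; rewrite lee_fin powR_ge0.
have IE : (\int[L]_(w in unit_ball) (defect w `^ t)%:E = I%:E)%E.
  by rewrite fineK// ge0_fin_numE// integral_ge0// => w _; rewrite lee_fin powR_ge0.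
pose M := n.+1%:R + 1 + t; have M0 : 0 < M.
  have : 0 <= n.+1%:R :> R by []. rewrite /M; lra.
exists (C + I / r0 `^ M); first by rewrite ltr_wpDr// divr_ge0 ?powR_ge0.
move=> a r a1 rp; rewrite -/M.
have [rr0|rr0] := leP r r0.
  rewrite -integral_mul_indic (le_trans (HC a r a1 rp rr0))// lee_fin.
  by rewrite ler_wpM2r ?powR_ge0// lerDl divr_ge0 ?powR_ge0.
apply: (@le_trans _ _ I%:E).
  rewrite -IE; apply: ge0_subset_integral => //.
  - exact: measurable_cap.
  - by apply/measurable_funTS/measurable_EFinP; exact: measurable_defect_powR.
  - by move=> w _; rewrite lee_fin powR_ge0.
  - by move=> w [].
rewrite lee_fin mulrDl ler_wpDl ?mulr_ge0 ?powR_ge0 ?(ltW C0)//.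
rewrite mulrAC -mulrA ler_peMr// ler_pdivlMr ?powR_gt0// mul1r.
by rewrite ge0_ler_powR ?nnegrE ?(ltW M0) ?(ltW r00) ?(ltW rp) ?(ltW rr0).
Qed.

Definition deep_cap (a : V) (r : R) : set V := [set w | hdist w a < r /\ r / 4 <= defect w].

Lemma measurable_deep_cap a r : measurable (deep_cap a r).
Proof.
apply: measurableI; first by apply: measurable_set_ltr => //; exact: measurable_hdist1.
by apply: measurable_set_ler => //; exact: measurable_defect.
Qed.

(** Around (1 - r/2) a the deep cap contains a box of size sqrt r in the coordinates other than j
    and r in coordinate j. The box is sheared: its centre [c v] in coordinate j is the value for
    which <w,a> = 1 - r/2. Thus <w,a> varies by O(r) only, although the other coordinates vary by
    O(sqrt r). *)
Lemma deep_cap_volume_ge : exists2 C : R, 0 < C &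
  forall (a : V) r, hnorm a = 1 -> 0 < r -> r <= 1 ->
  ((C * r `^ (n.+1%:R + 1))%:E <= L (deep_cap a r))%E.
Proof.
(* [dl] must satisfy 1/2 + 2 dl < 1 for the distance and 3/4 - 4 dl - 20 dl^2 >= 1/4 for the defect.
   [ep] keeps the shear of coordinate j below 2 dl sqrt r after division by |a_j| >= th. *)
pose dl : R := 1 / 16; pose ep : R := dl * th / n.+1%:R.
have dl0 : 0 < dl by rewrite divr_gt0.
have n0 : 0 < n.+1%:R :> R by rewrite ltr0n.
have ep0 : 0 < ep by rewrite !mulr_gt0 ?invr_gt0.
have epn : ep * n.+1%:R = dl * th by rewrite /ep divfK// gt_eqF.
have dlE : dl = 1 / 16 by [].
clearbody ep; clearbody dl.
have nn : n%:R <= n.+1%:R :> R by rewrite ler_nat.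
have n1 : 1 <= n.+1%:R :> R by rewrite ler1n.
have nge0 : 0 <= n%:R :> R by [].
have th1 := @axis_min_lt1 R n.
exists ((2 * dl) ^+ 2 * ((2 * ep) ^+ 2) ^+ n); first by rewrite !(mulr_gt0, exprn_gt0).
move=> a r a1 r0 r1.
have [j [ax jax]] : exists j ax, th <= `|axis ax (a ord0 j)|.
  by apply: axis_min_le; rewrite a1 expr1n; lra.
have aj : th <= normc (a ord0 j) by rewrite (le_trans jax)// axis_le_normc.
have aj0 : 0 < normc (a ord0 j) by exact: lt_le_trans aj.
have ac1 i : normc (a ord0 i) <= 1 by rewrite -a1 normc_coord_le.
have ajc0 : conjc (a ord0 j) != 0.
  by apply/eqP => h; move: aj0; rewrite -normc_conj h normc0 ltxx.
pose q := Num.sqrt r.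
have q0 : 0 < q by rewrite sqrtr_gt0.
have qE : q ^+ 2 = r by rewrite sqr_sqrtr// ltW.
have q1 : q <= 1 by rewrite -sqrtr1 ler_wsqrtr.
pose tt := 1 - r / 2.
have tt0 : 0 <= tt by rewrite /tt; lra.
have tt1 : tt <= 1 by rewrite /tt; lra.
pose a' := rV_rest j a.
pose c v : R[i] := tt%:C * a ord0 j - hdot (v - tt%:C *: a') a' / conjc (a ord0 j).
have h0 : 0 <= ep * q by rewrite mulr_ge0// ltW.
have M0 : 0 <= (2 * (dl * r)) ^+ 2 by exact: sqr_ge0.
have mD := measurable_deep_cap a r.
have inS v x : cbox (tt%:C *: a') (ep * q) v -> csquare (c v) (dl * r) x ->
    deep_cap a r (rV_ins j x v).
  move=> vb xc.
  have vk k : normc ((v - tt%:C *: a') ord0 k) <= 2 * (ep * q).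
    by have := csquare_normc (vb k); rewrite !mxE.
  have xk : normc (x - c v) <= 2 * (dl * r) := csquare_normc xc.
  pose eta := rV_ins j x v - tt%:C *: a.
  have etaj : eta ord0 j = x - tt%:C * a ord0 j by rewrite !mxE unlift_none.
  have etar : rV_rest j eta = v - tt%:C *: a'.
    by apply/rowP => k; rewrite !mxE liftK.
  pose tau := hdot eta a.
  have tauE : tau = (x - c v) * conjc (a ord0 j).
    by rewrite /tau (hdot_split j) etaj etar -/a' /c; field.
  have tau1 : normc tau <= 2 * (dl * r).
    rewrite tauE normcM normc_conj (le_trans _ xk)// ler_piMr ?normc_ge0//.
  have hd : normc (hdot (v - tt%:C *: a') a') <= dl * th * 2 * q.
    rewrite (le_trans (normc_sum _ _))//.
    apply: (@le_trans _ _ (\sum_(k < n) (2 * (ep * q)))).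
      apply: ler_sum => k _; rewrite normcM normc_conj.
      rewrite (le_trans _ (vk k))// ler_piMr ?normc_ge0// /a' mxE; exact: ac1.
    rewrite sumr_const card_ord -[_ *+ n]mulr_natr.
    have -> : dl * th * 2 * q = 2 * (ep * q) * n.+1%:R by rewrite -epn; ring.
    by rewrite ler_wpM2l// mulr_ge0.
  have etajn : normc (eta ord0 j) <= 4 * dl * q.
    have -> : eta ord0 j = (x - c v) - hdot (v - tt%:C *: a') a' / conjc (a ord0 j).
      by rewrite etaj /c; ring.
    rewrite (le_trans (le_normcD _ _))// normcN normcM normcV normc_conj.
    have : normc (hdot (v - tt%:C *: a') a') / normc (a ord0 j) <= dl * 2 * q.
      rewrite ler_pdivrMr// (le_trans hd)//.
      have : 0 <= dl * 2 * q by rewrite !mulr_ge0// ltW.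
      by move: aj; nra.
    have : dl * r <= dl * q by rewrite ler_pM2l// -qE; nra.
    move: xk; lra.
  have etarn : hnorm (rV_rest j eta) ^+ 2 <= 4 * dl ^+ 2 * r.
    rewrite etar sqr_hnorm.
    apply: (@le_trans _ _ (\sum_(k < n) (2 * (ep * q)) ^+ 2)).
      apply: ler_sum => k _; rewrite ler_pXn2r ?nnegrE ?normc_ge0//.
      by rewrite mulr_ge0.
    rewrite sumr_const card_ord -[_ *+ n]mulr_natr.
    have -> : (2 * (ep * q)) ^+ 2 * n%:R = 4 * r * (ep ^+ 2 * n%:R) by rewrite -qE; ring.
    have : ep ^+ 2 * n%:R <= dl ^+ 2.
      apply: (@le_trans _ _ ((ep * n.+1%:R) ^+ 2)).
        rewrite exprMn ler_wpM2l ?sqr_ge0//; nra.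
      by rewrite epn exprMn ler_piMr ?sqr_ge0// exprn_ile1// ltW.
    have r40 : 0 <= 4 * r by rewrite mulr_ge0// ltW.
    by move=> /(ler_wpM2l r40); lra.
  have etan : hnorm eta ^+ 2 <= 20 * dl ^+ 2 * r.
    rewrite (sqr_hnorm_split j).
    have : normc (eta ord0 j) ^+ 2 <= (4 * dl * q) ^+ 2.
      by rewrite ler_pXn2r ?nnegrE ?normc_ge0 ?mulr_ge0 ?(ltW dl0) ?(ltW q0).
    have -> : (4 * dl * q) ^+ 2 = 16 * dl ^+ 2 * r by rewrite -qE; ring.
    lra.
  have zE : rV_ins j x v = tt%:C *: a + eta by rewrite addrC subrK.
  have dotE : hdot (rV_ins j x v) a = tt%:C + tau.
    by rewrite zE hdotDl hdotZl hdotxx a1 expr1n mulr1.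
  split.
    rewrite /hdist dotE opprD addrA sub1_real_complex.
    rewrite (le_lt_trans (le_normcD _ _))// normcN normc_real.
    have -> : `|1 - tt| = r / 2 by rewrite /tt ger0_norm; [ring|lra].
    by move: tau1; rewrite dlE; lra.
  rewrite /defect zE sqr_hnormD hnormZ a1 mulr1 ger0_norm//.
  have -> : hdot (tt%:C *: a) eta = tt%:C * conjc tau by rewrite hdotZl /tau -hdotC.
  have : complex.Re (tt%:C * conjc tau) <= 2 * (dl * r).
    rewrite (le_trans (ler_norm _))// (le_trans (Re_le_normc _))//.
    rewrite normcM normc_conj normc_real ger0_norm// (le_trans _ tau1)//.
    by rewrite ler_piMl ?normc_ge0.
  have : tt ^+ 2 <= 1 - r + r / 4 by rewrite /tt; nra.
  move: etan; rewrite dlE; lra.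
apply: le_trans (_ : (((2 * (dl * r)) ^+ 2 * ((2 * (ep * q)) ^+ 2) ^+ n)%:E <= _)%E); last first.
  rewrite -[deep_cap a r]setIT -integral_indic//.
  apply: (@le_integral_slice R n j (fun w => (\1_(deep_cap a r) w)%:E)
    (tt%:C *: a') (ep * q) ((2 * (dl * r)) ^+ 2)) => //.
    exact/measurable_EFinP/measurable_indic.
  move=> v vb.
  rewrite -(lebesgue_csquare (c v)) ?mulr_ge0 ?(ltW dl0) ?(ltW r0)//.
  rewrite -[csquare _ _]setIT -integral_indic//; last exact: measurable_csquare.
  apply: ge0_le_integral => //.
  - by apply/measurable_EFinP/measurable_indic; exact: measurable_csquare.
  - apply/measurable_EFinP; apply: (measurableT_comp (measurable_indic mD)).
    exact: measurable_rV_ins1.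
  - move=> x _; rewrite lee_fin !indicE ler_nat.
    by have [/set_mem/(inS v x vb)/mem_set ->|] := boolP (x \in csquare _ _).
rewrite lee_fin powRD ?(gt_eqF r0) ?implybT// powRr1 ?(ltW r0)// powR_mulrn ?(ltW r0)//.
rewrite le_eqVlt; apply/orP; left; apply/eqP.
have -> : (2 * (ep * q)) ^+ 2 = (2 * ep) ^+ 2 * r by rewrite -qE; ring.
by rewrite [(_ * r) ^+ n]exprMn (exprS r n); ring.
Qed.

End tent_volume.

(** * The measures dv_t: density, finiteness and volumes of caps *)

Section vol_density.
Variables (R : realType) (n : nat) (t : R).
Local Notation V := 'rV[R[i]]_n.
Local Notation L := (lebesgue_Cn R n).
Local Open Scope ereal_scope.

Let mball : measurable (@unit_ball R n) := @measurable_unit_ball R n.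

Lemma vol_mul_indic (A : set V) :
  vol t A = \int[L]_(z in A) (vol_density t z * \1_unit_ball z)%:E.
Proof.
rewrite -integral_mul_indic /vol -integral_mul_indic; apply: eq_integral => z _.
rewrite -mulrA; congr (_ * _)%:E; rewrite !indicE in_setI mulrC.
by case: (z \in A); case: (z \in unit_ball); rewrite ?mulr1 ?mulr0.
Qed.

Lemma measurable_density_ball :
  measurable_fun [set: V] (fun z => (vol_density t z * \1_unit_ball z)%R : R).
Proof.
apply: measurable_funM; first exact: measurable_vol_density.
exact: measurable_indic.
Qed.

Lemma integral_volE (f : V -> \bar R) : measurable_fun [set: V] f ->
  (forall z, 0 <= f z) ->
  \int[vol t]_z f z = \int[L]_z (f z * (vol_density t z * \1_unit_ball z)%:E).
Proof.
apply: ge0_integral_density; first exact: measurable_density_ball.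
- by move=> z; rewrite mulr_ge0// ?vol_density_ge0// indicE.
- by move=> A _; exact: vol_mul_indic.
Qed.

Lemma vol_setI_ball (A : set V) : vol t (A `&` unit_ball) = vol t A.
Proof. by rewrite /vol -setIA setIid. Qed.

Let ball_integral : \bar R := \int[L]_(z in unit_ball) ((1 - hnorm z ^+ 2) `^ t)%:E.

Let ball_integral_ge0 : 0 <= ball_integral.
Proof. by apply: integral_ge0 => z _; rewrite lee_fin powR_ge0. Qed.

Lemma vol_setT : vol t [set: V] = (vol_const n t)%:E * ball_integral.
Proof.
rewrite /vol setTI /vol_density; under eq_integral do rewrite EFinM.
rewrite ge0_integralZl_EFin//.
- by move=> z _; rewrite lee_fin powR_ge0.
- by apply/measurable_funTS/measurable_EFinP; exact: measurable_defect_powR.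
- by rewrite invr_ge0 fine_ge0.
Qed.

Let vol_fin : fin_num_fun (@vol R n t).
Proof.
apply: lty_fin_num_fun; apply: (@le_lt_trans _ _ (vol t [set: V])) => //.
rewrite vol_setT /vol_const -/ball_integral.
(* If the integral over the ball is infinite, its [fine] and the inverse of that are 0, so the total
   mass is 0: the measure is finite for every t. *)
have [->|fin] := eqVneq ball_integral +oo; first by rewrite /= invr0 mul0e ltry.
rewrite lte_mul_pinfty// ?lee_fin ?invr_ge0 ?fine_ge0//.
by rewrite ltey.
Qed.

HB.instance Definition _ := Measure_isFinite.Build _ _ _ (@vol R n t) vol_fin.

End vol_density.

Section vol_caps.
Context {R : realType} {m : nat}.
Local Notation n := m.+1.
Local Notation V := 'rV[R[i]]_n.
Local Notation L := (lebesgue_Cn R n).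

Let mball : measurable (@unit_ball R n) := @measurable_unit_ball R n.

Lemma deep_cap_ball (a : V) r : 0 < r -> deep_cap a r `<=` unit_ball.
Proof. by move=> r0 w [_ h]; apply: defect_gt0_ball; rewrite (lt_le_trans _ h)// divr_gt0. Qed.

Lemma ball_integral_gt0 (t : R) :
  (0 < \int[L]_(z in unit_ball) (defect z `^ t)%:E)%E.
Proof.
have [a [a1 _]] := @direction_exists R n (ltn0Sn m) 0.
have [C C0 HC] := @deep_cap_volume_ge R m.
have mD := measurable_deep_cap a 1.
have Dpos : (0 < L (deep_cap a 1))%E.
  by apply: lt_le_trans (HC a 1 a1 ltr01 (lexx _)); rewrite lte_fin mulr_gt0 ?powR_gt0.
apply: (@lt_le_trans _ _ (\int[L]_(z in deep_cap a 1) (Num.min ((1 / 4) `^ t) 1)%:E)%E).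
  by rewrite integral_cst// mule_gt0// lte_fin lt_min ltr01 andbT powR_gt0.
apply: (@le_trans _ _ (\int[L]_(z in deep_cap a 1) (defect z `^ t)%:E)%E).
  apply: ge0_le_integral => //.
  - by apply/measurable_funTS/measurable_EFinP; exact: measurable_defect_powR.
  - move=> z zD; have /andP[d0 d1] := unit_ball_defect (deep_cap_ball ltr01 zD).
    have [_ d4] := zD; rewrite lee_fin; have [t0|t0] := leP 0 t.
      by rewrite ge_min ge0_ler_powR ?nnegrE// ltW.
    rewrite ge_min; apply/orP; right.
    have -> : 1 = (1 : R) `^ t by rewrite powR1.
    by rewrite ler_powR_neg// ltW.
apply: ge0_subset_integral => //.
- by apply/measurable_funTS/measurable_EFinP; exact: measurable_defect_powR.
- by move=> z _; rewrite lee_fin powR_ge0.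
- exact: deep_cap_ball.
Qed.

Variable t : R.
Hypothesis t1 : -1 < t.

Lemma vol_const_gt0 : 0 < vol_const n t.
Proof.
rewrite /vol_const invr_gt0 fine_gt0//; apply/andP; split.
  exact: ball_integral_gt0.
exact: ball_integral_lty.
Qed.

Lemma vol_cap_le : exists2 C : R, 0 < C &
  forall (a : V) r, hnorm a = 1 -> 0 < r ->
  (vol t (cap a r) <= (C * r `^ (n%:R + 1 + t))%:E)%E.
Proof.
have [C C0 HC] := @cap_integral_le R m t t1.
exists (vol_const n t * C); first by rewrite mulr_gt0// vol_const_gt0.
move=> a r a1 r0; rewrite /vol /vol_density.
have -> : cap a r `&` unit_ball = cap a r by apply/setIidl => w [].
under eq_integral do rewrite EFinM.
rewrite ge0_integralZl_EFin//; first last.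
- by rewrite ltW// vol_const_gt0.
- by apply/measurable_funTS/measurable_EFinP; exact: measurable_defect_powR.
- by move=> z _; rewrite lee_fin powR_ge0.
- exact: measurable_cap.
by rewrite -mulrA EFinM; apply: lee_wpmul2l; [rewrite lee_fin ltW// vol_const_gt0|exact: HC].
Qed.

Lemma vol_deep_cap_ge : exists2 C : R, 0 < C &
  forall (a : V) r, hnorm a = 1 -> 0 < r -> r <= 1 ->
  ((C * r `^ (n%:R + 1 + t))%:E <= vol t (deep_cap a r))%E.
Proof.
have [C C0 HC] := @deep_cap_volume_ge R m.
(* On the deep cap the defect lies between r/4 and 2r; the sign of t decides which end bounds its
   power from below. *)
pose K : R := Num.min ((1 / 4) `^ t) (2 `^ t).
have K0 : 0 < K by rewrite lt_min !powR_gt0.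
have vc0 := vol_const_gt0.
exists (vol_const n t * (K * C)); first by rewrite !mulr_gt0.
move=> a r a1 r0 r1; rewrite /vol /vol_density.
have -> : deep_cap a r `&` unit_ball = deep_cap a r by apply/setIidl; exact: deep_cap_ball.
have mD := measurable_deep_cap a r.
under eq_integral do rewrite EFinM.
rewrite ge0_integralZl_EFin ?(ltW vc0)//; first last.
- by apply/measurable_funTS/measurable_EFinP; exact: measurable_defect_powR.
- by move=> z _; rewrite lee_fin powR_ge0.
rewrite -mulrA EFinM; apply: lee_wpmul2l; first by rewrite lee_fin ltW.
apply: (@le_trans _ _ (\int[L]_(z in deep_cap a r) (K * r `^ t)%:E)%E).
  rewrite integral_cst//.
  apply: (@le_trans _ _ ((K * r `^ t)%:E * (C * r `^ (n%:R + 1))%:E)%E).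
    rewrite -EFinM lee_fin (@powRD _ r (n%:R + 1) t) ?(gt_eqF r0) ?implybT//.
    by rewrite le_eqVlt; apply/orP; left; apply/eqP; ring.
  by apply: lee_wpmul2l; [rewrite lee_fin mulr_ge0 ?powR_ge0 ?(ltW K0)|exact: HC].
apply: ge0_le_integral => //.
- by move=> z _; rewrite lee_fin mulr_ge0 ?powR_ge0 ?(ltW K0).
- by apply/measurable_funTS/measurable_EFinP; exact: measurable_defect_powR.
- move=> z [zr dz]; rewrite lee_fin.
  have r40 : 0 < r / 4 by rewrite divr_gt0.
  have d0 : 0 < defect z by exact: lt_le_trans dz.
  have d2 : defect z <= 2 * r.
    have := @defect_le_hdist R n z a; rewrite a1 => /(_ (lexx _)) /le_trans; apply.
    by rewrite ler_pM2l// ltW.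
  have [t0|t0] := leP 0 t.
    apply: (@le_trans _ _ ((r / 4) `^ t)); last first.
      by rewrite ge0_ler_powR ?nnegrE// ltW.
    have -> : r / 4 = 1 / 4 * r by ring.
    by rewrite powRM ?(ltW r0)// ler_wpM2r ?powR_ge0// ge_min lexx.
  apply: (@le_trans _ _ ((2 * r) `^ t)).
    by rewrite powRM ?(ltW r0)// ler_wpM2r ?powR_ge0// ge_min lexx orbT.
  by rewrite ler_powR_neg// ltW.
Qed.

End vol_caps.

(** * The ball as a tent space *)

Section ball_tent_space.
Context {R : realType} {m : nat}.
Local Notation n := m.+1.
Local Notation V := 'rV[R[i]]_n.
Variable b : R.
Hypothesis b1 : -1 < b.

(* Retraction onto the ball, so that the tent axioms hold on the whole space. *)
Definition ball_proj (z : V) : V := if hnorm z < 1 then z else 0.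

Lemma ball_proj_id z : unit_ball z -> ball_proj z = z.
Proof. by rewrite /unit_ball/= /ball_proj => ->. Qed.

Lemma ball_proj_ball z : unit_ball (ball_proj z).
Proof. by rewrite /unit_ball/= /ball_proj; case: ifPn => //; rewrite hnorm0. Qed.

Lemma measurable_ball_proj : measurable_fun [set: V] ball_proj.
Proof.
apply: measurable_fun_ifT => //.
apply: measurable_fun_ltr => //; exact: measurable_hnorm.
Qed.

Definition pdist (x y : V) : R := hdist (ball_proj x) (ball_proj y).
Definition pdefect (x : V) : R := defect (ball_proj x).

Let le1 z : hnorm (ball_proj z) <= 1.
Proof. exact: ltW (ball_proj_ball z). Qed.

Lemma measurable_pdist : measurable_fun [set: V * V] (fun z : V * V => pdist z.1 z.2).
Proof.
apply: (@measurableT_comp _ _ _ _ _ _ (fun z : V * V => hdist z.1 z.2) _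
  (fun z : V * V => (ball_proj z.1, ball_proj z.2)) (@measurable_hdist R n)).
apply: measurable_fun_pair.
  exact: (measurableT_comp measurable_ball_proj measurable_fst).
exact: (measurableT_comp measurable_ball_proj measurable_snd).
Qed.

Lemma measurable_pdefect : measurable_fun [set: V] pdefect.
Proof. exact: (measurableT_comp measurable_defect measurable_ball_proj). Qed.

Local Notation N := (n%:R + 1 + b).

Lemma ball_dim_gt0 : 0 < N.
Proof. by have := ler0n R n; move: (n%:R : R) => k; move: b1; lra. Qed.

Lemma hdist_le2 (x y : V) : hnorm x <= 1 -> hnorm y <= 1 -> hdist x y <= 2.
Proof.
move=> x1 y1; rewrite /hdist (le_trans (le_normcD _ _))// normcN normc1.
by rewrite -[2]/(1 + 1) lerD2l normc_hdot_le1.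
Qed.

(** Caps at the boundary point a above x replace balls around x, as d(x,a) <= rho(x). The core of z
    contains the deep cap of radius rho(z), whence kp = 1/4. The link of x and y contains a deep cap
    of radius r = d(x,y)/2, the half making its heights at most 2r = d(x,y). There rho(x) <= 4r, so
    d(x,z) < 10r and d(y,z) < 24r, while r <= 4 rho(z); hence 96 rho(z) suffices and s = 100. *)
Lemma ball_tent_space : exists c0 C0 : R,
  tent_space (@vol R n b) pdist pdefect N 100 (1 / 4) c0 C0.
Proof.
have [C C_gt0 HC] := @vol_cap_le R m b b1.
have [c c_gt0 Hc] := @vol_deep_cap_ge R m b b1.
have N0 := ball_dim_gt0.
have dir z := @direction_exists R n (ltn0Sn m) (ball_proj z).
have dir_dist z (a : V) : hnorm a = 1 -> ball_proj z = (hnorm (ball_proj z))%:C *: a ->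
    hdist (ball_proj z) a <= pdefect z.
  move=> a1 za; rewrite (hdist_direction (le1 z) a1 za).
  by have /andP[] := one_sub_hnorm_le (le1 z).
have pd0 z : 0 < pdefect z by have /andP[] := unit_ball_defect (ball_proj_ball z).
have pd1 z : pdefect z <= 1 by have /andP[] := unit_ball_defect (ball_proj_ball z).
have pdd x y : pdefect x <= 2 * pdist x y by exact: defect_le_hdist.
have mdist1 y : measurable_fun [set: V] (fun x => pdist x y).
  exact: (measurableT_comp measurable_pdist (pair2_measurable y)).
have deep_ball (a : V) r x : 0 < r -> deep_cap a r x -> ball_proj x = x.
  by move=> r0 xD; apply: ball_proj_id; exact: deep_cap_ball xD.
exists (c * (1 / 2) `^ N), (C * 4 `^ N); split.
- exact: measurable_pdist.
- exact: measurable_pdefect.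
- by move=> x y; rewrite /pdist hdistC.
- by move=> x y z; exact: hdist_triangle.
- by move=> x; rewrite /pdist hdistxx.
- exact: pdd.
- exact: pd0.
- exact: pd1.
- lra.
- lra.
- lra.
- exact: N0.
- by rewrite mulr_gt0 ?powR_gt0.
- by rewrite mulr_gt0 ?powR_gt0.
- move=> x r xr; have [a [a1 xa]] := dir x.
  have r0 : 0 < r := lt_le_trans (pd0 x) xr.
  apply: (@le_trans _ _ (vol b ([set y | pdist y x < r] `&` unit_ball))).
    by rewrite vol_setI_ball.
  (* d(y,a) <= 2 (d(y,x) + d(x,a)) < 4r, since d(x,a) <= rho(x) <= r. *)
  apply: (@le_trans _ _ (vol b (cap a (4 * r)))); last first.
    rewrite (le_trans (HC a (4 * r) a1 _))// ?mulr_gt0//.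
    by rewrite lee_fin powRM ?(ltW r0)// mulrA.
  apply: le_measure; rewrite ?inE.
  + apply: measurableI; last exact: measurable_unit_ball.
    by apply: measurable_set_ltr => //.
  + exact: measurable_cap.
  move=> y [/= yx yB]; split => //.
  have := @hdist_triangle R n (ball_proj x) y a (ltW yB).
  rewrite a1 => /(_ (lexx _) (le1 x)).
  move: yx; rewrite /pdist (ball_proj_id yB).
  have := dir_dist x a a1 xa; lra.
- move=> z; have [a [a1 za]] := dir z.
  have dz := dir_dist z a a1 za.
  apply: (@le_trans _ _ (vol b (deep_cap a (pdefect z)))).
    apply: le_trans (Hc a _ a1 (pd0 z) (pd1 z)).
    rewrite lee_fin ler_wpM2r ?powR_ge0// ler_piMr ?(ltW c_gt0)//.
    have : (1 / 2) `^ N <= (1 : R) `^ N.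
      by apply: ge0_ler_powR; rewrite ?nnegrE ?(ltW N0)//; lra.
    by rewrite powR1.
  apply: le_measure; rewrite ?inE.
  + exact: measurable_deep_cap.
  + apply: measurableI.
      by apply: measurable_set_ltr => //; exact: measurable_funM.
    by apply: measurable_set_ler => //; exact: measurable_pdefect.
  move=> x xD; have [xa xd] := xD; have xE := deep_ball _ _ _ (pd0 z) xD.
  split; last by rewrite /= /pdefect xE -/(pdefect z); lra.
  rewrite /= /pdist xE.
  have x1 : hnorm x <= 1 by rewrite -xE le1.
  have h := @hdist_triangle R n a x (ball_proj z) x1 (le1 z).
  rewrite a1 (hdistC a) in h; have {}h := h (lexx _).
  by have := pd0 z; lra.
- move=> x y; have [a [a1 xa]] := dir x.
  have dx := dir_dist x a a1 xa.
  pose r := pdist x y / 2.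
  have pxy : 0 < pdist x y by rewrite -(pmulr_rgt0 _ (ltr0Sn R 1)) (lt_le_trans (pd0 x)).
  have r0 : 0 < r by rewrite divr_gt0.
  have r1 : r <= 1 by rewrite ler_pdivrMr// mul1r; exact: hdist_le2.
  have rE : pdist x y = 2 * r by rewrite /r; field.
  apply: (@le_trans _ _ (vol b (deep_cap a r))).
    apply: le_trans (Hc a _ a1 r0 r1).
    rewrite lee_fin -mulrA -powRM ?(ltW pxy)//.
    by rewrite (_ : 1 / 2 * pdist x y = r)// /r; ring.
  apply: le_measure; rewrite ?inE.
  + exact: measurable_deep_cap.
  + rewrite (_ : link _ _ _ _ _ = [set z | pdist x z < 100 * pdefect z] `&`
      [set z | pdist y z < 100 * pdefect z] `&` [set z | pdefect z <= pdist x y]).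
      have mp w : measurable_fun [set: V] (fun z => pdist w z).
        exact: (measurableT_comp measurable_pdist (pair1_measurable w)).
      have mpd := measurable_pdefect.
      apply: measurableI; last exact: measurable_set_ler.
      by apply: measurableI; apply: measurable_set_ltr => //; exact: measurable_funM.
    by apply/seteqP; split => z [] //; case.
  move=> z zD; have [za zd] := zD; have zE := deep_ball _ _ _ r0 zD.
  have zd' : r / 4 <= pdefect z by rewrite /pdefect zE.
  have z1 : hnorm z <= 1 by have := le1 z; rewrite zE.
  have h1 := @hdist_triangle R n a (ball_proj x) z (le1 x) z1.
  have h2 := @hdist_triangle R n (ball_proj x) (ball_proj y) z (le1 y) z1 (le1 x).
  rewrite a1 (hdistC a) in h1; have {}h1 := h1 (lexx _).
  have pdx := pdd x y.
  have e1 : hdist (ball_proj y) (ball_proj x) = 2 * r by rewrite hdistC -rE.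
  rewrite e1 in h2; rewrite rE in pdx.
  split.
  + by rewrite /pdist zE; lra.
  + by rewrite /pdist zE; lra.
  + have := @defect_le_hdist R n z a; rewrite a1 => /(_ (lexx _)).
    by rewrite rE /pdefect zE; lra.
Qed.

End ball_tent_space.

Section ball_integrals.
Context {R : realType} {m : nat}.
Local Notation n := m.+1.
Local Notation V := 'rV[R[i]]_n.

Let mball : measurable (@unit_ball R n) := @measurable_unit_ball R n.

Lemma measurable_comp_ball_proj d (T : measurableType d) (f : V -> T) :
  measurable_fun unit_ball f -> measurable_fun [set: V] (fun x => f (ball_proj x)).
Proof.
move=> mf; apply: (@measurable_comp _ _ _ _ _ _ unit_ball f setT ball_proj) => //.
  by move=> _ [x _ <-]; exact: ball_proj_ball.
exact: measurable_ball_proj.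
Qed.

Lemma vol_setC_ball t : vol t (~` @unit_ball R n) = 0%E.
Proof. by rewrite -vol_setI_ball setICl measure0. Qed.

Lemma integral_ball_proj t (A : set V) (f : V -> \bar R) : measurable A ->
  measurable_fun unit_ball f -> (forall x, unit_ball x -> 0 <= f x)%E ->
  (\int[vol t]_(x in A) f (ball_proj x) = \int[vol t]_(x in A `&` unit_ball) f x)%E.
Proof.
move=> mA mf f0.
rewrite (@ge0_negligible_integral _ _ _ (vol t) A (~` unit_ball))//.
- rewrite setDE setCK; apply: eq_integral => x; rewrite inE => -[_ xB].
  by rewrite ball_proj_id.
- exact: measurableC.
- by apply: measurable_funTS; exact: measurable_comp_ball_proj.
- by move=> x _; apply: f0; exact: ball_proj_ball.
- exact: vol_setC_ball.
Qed.

Lemma integral_vol_change t t' (A : set V) (f : V -> R) : -1 < t -> -1 < t' ->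
  measurable A -> measurable_fun unit_ball f -> (forall x, unit_ball x -> 0 <= f x) ->
  (\int[vol t']_(x in A `&` unit_ball) (f x)%:E =
   (vol_const n t' / vol_const n t)%:E *
   \int[vol t]_(x in A) (f (ball_proj x) * pdefect x `^ (t' - t))%:E)%E.
Proof.
move=> t1 t'1 mA mf f0.
have vt := @vol_const_gt0 R m t t1; have vt' := @vol_const_gt0 R m t' t'1.
have mfp : measurable_fun [set: V] (fun x => f (ball_proj x)).
  exact: measurable_comp_ball_proj.
have fp0 x : 0 <= f (ball_proj x) by apply: f0; exact: ball_proj_ball.
have mpd : measurable_fun [set: V] (fun x : V => pdefect x `^ (t' - t)).
  exact: (measurableT_comp (measurable_powR _) measurable_pdefect).
have mA1 : measurable_fun [set: V] (\1_A : V -> R) by exact: measurable_indic.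
set c := vol_const n t' / vol_const n t.
have cE : vol_const n t' = c * vol_const n t by rewrite /c divfK// gt_eqF.
have c0 : 0 <= c by rewrite divr_ge0// ltW.
clearbody c.
rewrite -integral_ball_proj//; first last.
- exact/measurable_EFinP.
rewrite -integral_mul_indic -[in RHS]integral_mul_indic.
transitivity (\int[vol t]_x (c%:E *
    (f (ball_proj x) * pdefect x `^ (t' - t) * \1_A x)%:E))%E; last first.
  apply: ge0_integralZl_EFin => //.
  - by move=> x _; rewrite lee_fin !mulr_ge0 ?powR_ge0// indicE.
  - by apply/measurable_EFinP/measurable_funM => //; exact: measurable_funM.
rewrite integral_volE; last 2 first.
- apply: emeasurable_funM => //.
  by apply/measurable_EFinP/measurable_funM => //; exact: measurable_funM.
- by move=> x; rewrite -EFinM lee_fin !mulr_ge0 ?powR_ge0// indicE.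
rewrite integral_volE; last 2 first.
- by apply/measurable_EFinP/measurable_funM.
- by move=> x; rewrite lee_fin mulr_ge0// indicE.
apply: eq_integral => x _; rewrite -!EFinM; congr EFin.
rewrite [\1_unit_ball x]indicE; have [/set_mem xB|_] := boolP (x \in unit_ball).
  rewrite /pdefect ball_proj_id// !mulr1 /vol_density -/(defect x).
  have /andP[d0 _] := unit_ball_defect xB.
  have -> : defect x `^ t' = defect x `^ (t' - t) * defect x `^ t.
    by rewrite -powRD ?subrK// (gt_eqF d0) implybT.
  by rewrite cE; ring.
by rewrite !mulr0.
Qed.

(** For z different from 0 the tent is the cap of radius 1 - |z| at z/|z|. The factor 3 serves z =
    0, whose tent is the whole ball: there a is arbitrary and distances are at most 2. *)
Lemma carleson_tentP (z : V) : unit_ball z -> exists a : V,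
  [/\ hnorm a = 1, deep_cap a (1 - hnorm z) `<=` carleson_tent z,
      carleson_tent z `<=` cap a (3 * (1 - hnorm z)) &
      forall x y, carleson_tent z x -> carleson_tent z y ->
        hdist x y <= 4 * (1 - hnorm z)].
Proof.
rewrite /unit_ball/= => z1; have [a [a1 za]] := @direction_exists R n (ltn0Sn m) z.
have r0 : 0 < 1 - hnorm z by rewrite subr_gt0.
exists a; rewrite /carleson_tent; have [z0|z0] := eqVneq z 0.
  rewrite z0 hnorm0 subr0 !mulr1; split => //.
  - by apply: deep_cap_ball.
  - move=> w wB; split => //; rewrite (le_lt_trans (hdist_le2 (ltW wB) _)) ?a1//.
    by rewrite ltr_nat.
  - by move=> x y xB yB; rewrite (le_trans (hdist_le2 (ltW xB) (ltW yB)))// ler_nat.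
have zn0 : hnorm z != 0 by rewrite hnorm_eq0.
have -> : (hnorm z)^-1%:C *: z = a.
  by rewrite {2}za scalerA -rmorphM/= mulVf// scale1r.
split => //.
- move=> w wD; split; first exact: deep_cap_ball wD.
  by have [wa _] := wD; rewrite -/(hdist a w) hdistC.
- move=> w [wB wa]; split => //; rewrite hdistC (lt_le_trans wa)// ler_peMl ?(ltW r0)//.
  by rewrite ler1n.
- move=> x y [xB xa] [yB ya].
  have := @hdist_triangle R n a x y (ltW xB) (ltW yB); rewrite a1 => /(_ (lexx _)).
  rewrite (hdistC x a) /hdist; lra.
Qed.

Lemma measurable_carleson_tent (z : V) : measurable (carleson_tent z).
Proof.
rewrite /carleson_tent; case: ifPn => // _; apply: measurableI => //.
apply: measurable_set_ltr => //.
exact: (measurableT_comp measurable_hdist (pair1_measurable _)).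
Qed.

Lemma carleson_tent_ball (z : V) : carleson_tent z `<=` unit_ball.
Proof. by rewrite /carleson_tent; case: ifPn => // _ w []. Qed.

Lemma vol_carleson_tent t : -1 < t -> exists c C : R, [/\ 0 < c, 0 < C &
  forall z : V, unit_ball z ->
  ((c * (1 - hnorm z) `^ (n%:R + 1 + t))%:E <= vol t (carleson_tent z))%E /\
  (vol t (carleson_tent z) <= (C * (1 - hnorm z) `^ (n%:R + 1 + t))%:E)%E].
Proof.
move=> t1; have [C C0 HC] := @vol_cap_le R m t t1.
have [c c0 Hc] := @vol_deep_cap_ge R m t t1.
exists c, (C * 3 `^ (n%:R + 1 + t)); split => //; first by rewrite mulr_gt0 ?powR_gt0.
move=> z zB; have [a [a1 Ha Hb _]] := carleson_tentP zB.
have r0 : 0 < 1 - hnorm z by rewrite subr_gt0.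
have mT := measurable_carleson_tent z.
split.
  apply: le_trans (Hc a _ a1 r0 _) _; first by rewrite gerBl hnorm_ge0.
  by apply: le_measure; rewrite ?inE//; exact: measurable_deep_cap.
apply: (@le_trans _ _ (vol t (cap a (3 * (1 - hnorm z))))).
  by apply: le_measure; rewrite ?inE//; exact: measurable_cap.
rewrite (le_trans (HC a _ a1 _)) ?mulr_gt0// lee_fin powRM ?(ltW r0)//.
by rewrite mulrA.
Qed.

(** For x in the tent, d(x,a) < 2 (K rho + 1 - |w|), and rho <= 2 (1 - |w|) gives the radius (4K +
    2)(1 - |w|) = r. The point z' lies at depth r on the ray of a, or is 0, with the ball as tent,
    once r >= 1. *)
Lemma tent_sub_carleson (K : R) (z : V) : 1 <= K ->
  exists z' : V, [/\ unit_ball z', 1 - hnorm z' <= (4 * K + 2) * pdefect z &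
    tent pdist pdefect K z `&` unit_ball `<=` carleson_tent z'].
Proof.
move=> K1; pose w := ball_proj z.
have wB : unit_ball w := ball_proj_ball z.
have w1 := ltW wB.
have [a [a1 wa]] := @direction_exists R n (ltn0Sn m) w.
have /andP[d1 d2] := one_sub_hnorm_le w1.
pose r := (4 * K + 2) * (1 - hnorm w).
have r0 : 0 < r by rewrite mulr_gt0 ?subr_gt0//; lra.
have rd : r <= (4 * K + 2) * pdefect z by rewrite ler_pM2l//; lra.
have sub x : tent pdist pdefect K z x -> unit_ball x -> hdist x a < r.
  rewrite /tent/= /pdist /pdefect => xz xB; rewrite (ball_proj_id xB) -/w in xz.
  have := @hdist_triangle R n w x a (ltW xB); rewrite a1 => /(_ (lexx _) w1).
  rewrite (hdist_direction w1 a1 wa) /r.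
  have : K * defect w <= K * (2 * (1 - hnorm w)) by rewrite ler_pM2l//; lra.
  move: xz; rewrite -/w; lra.
have [rl|rl] := ltP r 1; last first.
  exists 0; split.
  - by rewrite /unit_ball/= hnorm0.
  - by rewrite hnorm0 subr0 (le_trans rl).
  - by rewrite /carleson_tent eqxx => x [].
have nz : hnorm ((1 - r)%:C *: a) = 1 - r.
  by rewrite hnormZ a1 mulr1 ger0_norm// subr_ge0 ltW.
exists ((1 - r)%:C *: a); split.
- by rewrite /unit_ball/= nz; lra.
- by rewrite nz; lra.
- move=> x [xz xB]; rewrite /carleson_tent -hnorm_eq0 nz gt_eqF ?subr_gt0//.
  split => //; rewrite scalerA -rmorphM/= mulVf ?gt_eqF ?subr_gt0// scale1r.
  rewrite -/(hdist a x) hdistC; have := sub x xz xB; lra.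
Qed.

End ball_integrals.

(** * The characteristic of a weight *)

Lemma mule_fin_regroup (R : realType) (a c e f : R) (x y : \bar R) :
  (a%:E * (x * c%:E * (e%:E * y * f%:E)) = (a * c * e * f)%:E * (x * y))%E.
Proof.
rewrite [(x * _)%E]muleC [(e%:E * y * _)%E]muleAC muleACA -!EFinM.
rewrite [RHS](_ : _ = (a * (c * (e * f)))%:E * (x * y))%E; last by rewrite !mulrA.
by rewrite (EFinM a) -muleA.
Qed.

Section characteristic.
Context {R : realType} {m : nat}.
Local Notation n := m.+1.
Local Notation V := 'rV[R[i]]_n.
Variables (b p : R).
Hypothesis b1 : -1 < b.
Hypothesis p1 : 1 < p.
Local Notation N := (n%:R + 1 + b).
Local Notation t' := (p * N + b).

Let p0 : 0 < p. Proof. exact: lt_trans p1. Qed.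
Let p10 : 0 < p - 1. Proof. by rewrite subr_gt0. Qed.
Let N0 : 0 < N. Proof. exact: ball_dim_gt0. Qed.
Let t'1 : -1 < t'. Proof. by rewrite (lt_trans b1)// ltrDr mulr_gt0. Qed.

(** The weights sigma and, below, U = u rho^(pN), composed with the retraction so as to be positive
    on the whole space; [vol] does not see the complement of the ball. *)
Definition pdual (u : V -> R) (x : V) : R := dual_weight p u (ball_proj x).
Definition pweight (u : V -> R) (x : V) : R := u (ball_proj x) * pdefect x `^ (p * N).
Definition char_ratio : R := vol_const n t' / vol_const n b.

Lemma char_ratio_gt0 : 0 < char_ratio.
Proof. by rewrite divr_gt0// vol_const_gt0. Qed.

Section weights.
Variable u : V -> R.
Hypothesis hu : weight u.

Lemma weight_proj_gt0 x : 0 < u (ball_proj x).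
Proof. by have [u0 _ _] := hu; apply: u0; exact: ball_proj_ball. Qed.

Lemma measurable_dual_weight : measurable_fun unit_ball (dual_weight p u).
Proof. by have [_ mu _] := hu; exact: (measurableT_comp (measurable_powR _) mu). Qed.

Lemma measurable_pdual : measurable_fun [set: V] (pdual u).
Proof. exact: measurable_comp_ball_proj measurable_dual_weight. Qed.

Lemma pdual_gt0 x : 0 < pdual u x.
Proof. by rewrite powR_gt0// weight_proj_gt0. Qed.

Lemma pdefect_gt0 (x : V) : 0 < pdefect x.
Proof. by have /andP[] := unit_ball_defect (ball_proj_ball x). Qed.

Lemma measurable_weight_proj : measurable_fun [set: V] (fun x => u (ball_proj x)).
Proof. by have [_ mu _] := hu; exact: measurable_comp_ball_proj. Qed.

Lemma measurable_pweight : measurable_fun [set: V] (pweight u).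
Proof.
apply: measurable_funM; first exact: measurable_weight_proj.
exact: (measurableT_comp (measurable_powR _) measurable_pdefect).
Qed.

Lemma pweight_gt0 x : 0 < pweight u x.
Proof. by rewrite mulr_gt0 ?weight_proj_gt0// powR_gt0// pdefect_gt0. Qed.

Lemma dual_exponent : - (p / (p - 1) / p) = - (p - 1)^-1.
Proof. by field; rewrite !gt_eqF. Qed.

Lemma pdual_pweight x : pdual u x `^ (p - 1) * pweight u x = pdefect x `^ (N * p).
Proof.
rewrite /pdual /dual_weight dual_exponent -powRrM mulNr mulVf ?gt_eqF//.
rewrite /pweight mulrA powR_inv1 ?(ltW (weight_proj_gt0 _))// mulVf ?mul1r.
  by rewrite mulrC.
by rewrite gt_eqF// weight_proj_gt0.
Qed.

Lemma integral_dualE (A : set V) : measurable A ->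
  (\int[vol b]_(x in A) (pdual u x)%:E =
   \int[vol b]_(x in A `&` unit_ball) (dual_weight p u x)%:E)%E.
Proof.
move=> mA; rewrite -(@integral_ball_proj R m b A (fun x => (dual_weight p u x)%:E))//.
- by apply/measurable_EFinP; exact: measurable_dual_weight.
- by move=> x _; rewrite lee_fin powR_ge0.
Qed.

Lemma integral_weightE (A : set V) : measurable A ->
  (\int[vol t']_(x in A `&` unit_ball) (u x)%:E =
   char_ratio%:E * \int[vol b]_(x in A) (pweight u x)%:E)%E.
Proof.
move=> mA; have [u0 mu _] := hu.
rewrite (@integral_vol_change R m b t' A u)//; last by move=> x xB; rewrite ltW// u0.
congr (_ * _)%E; apply: eq_integral => x _.
by rewrite /pweight (_ : t' - b = p * N)//; ring.
Qed.

End weights.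

(** The masses stay extended reals, so that the identity can be read both ways: to extract
    finiteness from the characteristic, and to bound a characteristic not yet known to be finite. *)
Lemma average_tentE u z : weight u -> unit_ball z ->
  0 < fine (vol b (carleson_tent z)) /\ 0 < fine (vol t' (carleson_tent z)) /\
  (average b (carleson_tent z) (dual_weight p u) `^ (p - 1) *
   average t' (carleson_tent z) u =
   (char_ratio / (fine (vol b (carleson_tent z)) `^ (p - 1) *
     fine (vol t' (carleson_tent z))))%:E *
   ((\int[vol b]_(x in carleson_tent z) (pdual u x)%:E) `^ (p - 1) *
    \int[vol b]_(x in carleson_tent z) (pweight u x)%:E))%E.
Proof.
move=> hu zB; set T := carleson_tent z.
have mT : measurable T := measurable_carleson_tent z.
have TB : T `&` unit_ball = T by apply/setIidl; exact: carleson_tent_ball.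
have r0 : 0 < 1 - hnorm z by rewrite subr_gt0.
have cr0 := char_ratio_gt0.
have vT t : -1 < t -> 0 < fine (vol t T) /\ vol t T = (fine (vol t T))%:E.
  move=> t1; have [c [C [c0 C0 /(_ z zB)[h1 h2]]]] := @vol_carleson_tent R m t t1.
  have Tpos : (0 < vol t T)%E.
    by apply: lt_le_trans h1; rewrite lte_fin mulr_gt0// powR_gt0.
  have Tfin : vol t T \is a fin_num by exact: fin_num_measure.
  by rewrite fineK// fine_gt0// Tpos ltey_eq Tfin.
have [v10 v1E] := vT b b1; have [v20 v2E] := vT t' t'1.
set v1 := fine (vol b T) in v10 v1E *; set v2 := fine (vol t' T) in v20 v2E *.
split => //; split => //.
have vI t v : vol t T = v%:E -> (\int[vol t]_(x in T) 1 = v%:E)%E.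
  by move=> <-; rewrite integral_cst// mul1e.
set S := (\int[vol b]_(x in T) (pdual u x)%:E)%E.
set W := (\int[vol b]_(x in T) (pweight u x)%:E)%E.
have avS : average b T (dual_weight p u) = (S / v1%:E)%E.
  rewrite /average; congr (_ / _)%E; last exact: vI v1E.
  by rewrite /S integral_dualE// TB.
have avW : average t' T u = (char_ratio%:E * W / v2%:E)%E.
  rewrite /average; congr (_ / _)%E; last exact: vI v2E.
  by rewrite /W -integral_weightE// TB.
rewrite avS avW.
have S0 : (0 <= S)%E by apply: integral_ge0 => x _; rewrite lee_fin ltW// pdual_gt0.
rewrite !inver !gt_eqF// poweRM ?lee_fin ?invr_ge0 ?(ltW v10)// poweR_EFin.
rewrite -[LHS]mul1e mule_fin_regroup; congr (_%:E * _)%E.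
have -> : v1^-1 `^ (p - 1) = (v1 `^ (p - 1))^-1.
  by rewrite -powR_inv1 ?(ltW v10)// -powRrM mulN1r powRN.
by rewrite invfM; ring.
Qed.

Lemma char_le_tent u (K : R) z : weight u -> (Cpb_char p b u <= K%:E)%E ->
  unit_ball z ->
  ((\int[vol b]_(x in carleson_tent z) (pdual u x)%:E) `^ (p - 1) *
   \int[vol b]_(x in carleson_tent z) (pweight u x)%:E <=
   (K * (fine (vol b (carleson_tent z)) `^ (p - 1) *
     fine (vol t' (carleson_tent z))) / char_ratio)%:E)%E.
Proof.
move=> hu hK zB; have [v10 [v20 avE]] := average_tentE hu zB.
have : (average b (carleson_tent z) (dual_weight p u) `^ (p - 1) *
    average t' (carleson_tent z) u <= K%:E)%E.
  by apply: le_trans hK; apply: ereal_sup_ubound; exists z.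
rewrite avE; have cr0 := char_ratio_gt0.
move: (fine _) v10 => v1 v10; move: (fine _) v20 => v2 v20.
have d0 : 0 < v1 `^ (p - 1) * v2 by rewrite mulr_gt0// powR_gt0.
move: (_ * v2) d0 => D D0; move: (char_ratio) cr0 => cr cr0 h.
have k0 : (0 <= (D / cr)%:E)%E by rewrite lee_fin divr_ge0// ltW.
have := lee_wpmul2l k0 h; rewrite muleA -!EFinM.
have -> : D / cr * (cr / D) = 1 by field; rewrite !gt_eqF.
by rewrite mul1e (_ : D / cr * K = K * D / cr)//; ring.
Qed.
End characteristic.

Lemma mule_powR_lty {R : realType} (S W : \bar R) (q M : R) : 0 < q ->
  (0 < S)%E -> (0 < W)%E -> (S `^ q * W <= M%:E)%E -> (S < +oo)%E /\ (W < +oo)%E.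
Proof.
move=> q0 S0 W0 h; split; rewrite ltey; apply/eqP => E; move: h.
  by rewrite E poweRyr ?gt_eqF// gt0_mulye.
by rewrite E gt0_muley// poweR_gt0.
Qed.

Section dual_pair_of_characteristic.
Context {R : realType} {m : nat}.
Local Notation n := m.+1.
Local Notation V := 'rV[R[i]]_n.
Variables (b p : R).
Hypothesis b1 : -1 < b.
Hypothesis p1 : 1 < p.
Local Notation N := (n%:R + 1 + b).
Local Notation t' := (p * N + b).

Let mball : measurable (@unit_ball R n) := @measurable_unit_ball R n.

Let p0 : 0 < p. Proof. exact: lt_trans p1. Qed.
Let p10 : 0 < p - 1. Proof. by rewrite subr_gt0. Qed.
Let N0 : 0 < N. Proof. exact: ball_dim_gt0. Qed.
Let t'1 : -1 < t'. Proof. by rewrite (lt_trans b1)// ltrDr mulr_gt0. Qed.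

Lemma integral_setI_ball t (A : set V) (f : V -> \bar R) : measurable A ->
  measurable_fun [set: V] f -> (forall x, 0 <= f x)%E ->
  (\int[vol t]_(x in A `&` unit_ball) f x = \int[vol t]_(x in A) f x)%E.
Proof.
move=> mA mf f0.
rewrite [RHS](@ge0_negligible_integral _ _ _ (vol t) A (~` unit_ball))//.
- by rewrite setDE setCK.
- exact: measurableC.
- exact: measurable_funTS.
- exact: vol_setC_ball.
Qed.

Lemma vol_carleson_gt0 t (z : V) : -1 < t -> unit_ball z ->
  (0 < vol t (carleson_tent z))%E.
Proof.
move=> t1 zB; have [c [C [c0 C0 /(_ z zB)[h1 _]]]] := @vol_carleson_tent R m t t1.
by apply: lt_le_trans h1; rewrite lte_fin mulr_gt0// powR_gt0// subr_gt0.
Qed.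

Lemma pdual_tent_gt0 u (z : V) : weight u -> unit_ball z ->
  (0 < \int[vol b]_(x in carleson_tent z) (pdual p u x)%:E)%E.
Proof.
move=> hu zB; apply: integral_pos_gt0.
- exact: measurable_carleson_tent.
- exact: measurable_pdual.
- by move=> x; exact: pdual_gt0.
- exact: vol_carleson_gt0.
Qed.

Lemma pweight_tent_gt0 u (z : V) : weight u -> unit_ball z ->
  (0 < \int[vol b]_(x in carleson_tent z) (pweight b p u x)%:E)%E.
Proof.
move=> hu zB; apply: integral_pos_gt0.
- exact: measurable_carleson_tent.
- exact: measurable_pweight.
- by move=> x; exact: pweight_gt0.
- exact: vol_carleson_gt0.
Qed.

Lemma unit_ball0 : unit_ball (0 : V).
Proof. by rewrite /unit_ball/= hnorm0. Qed.

Lemma carleson_tent0 : carleson_tent (0 : V) = unit_ball.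
Proof. by rewrite /carleson_tent eqxx. Qed.

(** The tent of 0 is the ball, so the characteristic bounds a product of powers of the total masses
    of both weights. As both are positive, neither is infinite. *)
Lemma char_finite u (K : R) : weight u -> (Cpb_char p b u <= K%:E)%E ->
  pos_mfun (@vol R n b) (pdual p u) /\ pos_mfun (@vol R n b) (pweight b p u).
Proof.
move=> hu hK.
have := char_le_tent b1 p1 hu hK unit_ball0.
move=> /(mule_powR_lty p10 (pdual_tent_gt0 hu unit_ball0) (pweight_tent_gt0 hu unit_ball0)).
rewrite carleson_tent0 => -[h1 h2].
have mS := measurable_pdual p hu; have mW := measurable_pweight b p hu.
split; split => //.
- by move=> x; exact: pdual_gt0.
- rewrite -(@integral_setI_ball b setT)// ?setTI//.
    exact/measurable_EFinP.
  by move=> x; rewrite lee_fin ltW// pdual_gt0.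
- by move=> x; exact: pweight_gt0.
- rewrite -(@integral_setI_ball b setT)// ?setTI//.
    exact/measurable_EFinP.
  by move=> x; rewrite lee_fin ltW// pweight_gt0.
Qed.

Lemma mass_setI_ball (w : V -> R) (A : set V) : nonneg_mfun w -> measurable A ->
  mass (vol b) w (A `&` unit_ball) = mass (vol b) w A.
Proof.
move=> [mw w0] mA; congr fine; apply: integral_setI_ball => //.
exact/measurable_EFinP.
Qed.

(** An 18-fold tent lies in a Carleson tent of comparable height ([D] is the constant of
    [tent_sub_carleson] for the aperture 18 * 100), where the characteristic applies. The volumes
    contribute the powers N (p - 1) and N + pN of that height, in total 2 N p. *)
Lemma dual_pair_of_char : exists2 C : R, 0 < C &
  forall u K, weight u -> 0 <= K -> (Cpb_char p b u <= K%:E)%E ->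
  dual_pair (@vol R n b) pdist pdefect N 100 p (C * K) (pdual p u) (pweight b p u).
Proof.
have [e1 [C1 [_ C10 H1]]] := @vol_carleson_tent R m b b1.
have [e2 [C2 [_ C20 H2]]] := @vol_carleson_tent R m t' t'1.
have cr0 := @char_ratio_gt0 R m b p b1 p1.
have [c0 [C0 Hts]] := @ball_tent_space R m b b1.
pose D : R := 4 * (18 * 100) + 2.
have D0 : 0 < D by rewrite /D; lra.
exists (C1 `^ (p - 1) * C2 / @char_ratio R m b p * D `^ (2 * N * p)).
  by apply: mulr_gt0; [apply: divr_gt0 => //; rewrite mulr_gt0// powR_gt0|rewrite powR_gt0].
move=> u K hu K0 hK; split.
  by move=> x; exact: pdual_pweight.
have [pS pW] := char_finite hu hK.
have nS := pos_nonneg_mfun pS; have nW := pos_nonneg_mfun pW.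
have [mS S0 Sfin] := pS; have [mW W0 Wfin] := pW.
move=> z; have K1 : 1 <= 18 * 100 :> R by lra.
have [z' [z'B zz' sub]] := tent_sub_carleson z K1.
have mT : measurable (tent pdist pdefect (18 * 100) z) := measurable_tent Hts _ z.
have mTc := measurable_carleson_tent z'.
have mle w : pos_mfun (@vol R n b) w -> mass (vol b) w (tent pdist pdefect (18 * 100) z) <=
    mass (vol b) w (carleson_tent z').
  move=> pw; have nw := pos_nonneg_mfun pw; have [_ _ wfin] := pw.
  by rewrite -mass_setI_ball//; apply: le_mass => //; exact: measurableI.
have leS := mle _ pS; have leW := mle _ pW.
pose r := 1 - hnorm z'.
have r0 : 0 < r by rewrite subr_gt0.
have d0 := @pdefect_gt0 R m z.
have v1 : fine (vol b (carleson_tent z')) <= C1 * r `^ N.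
  by rewrite -lee_fin fineK ?fin_num_measure//; have [_] := H1 z' z'B.
have v2 : fine (vol t' (carleson_tent z')) <= C2 * r `^ (n%:R + 1 + t').
  by rewrite -lee_fin fineK ?fin_num_measure//; have [_] := H2 z' z'B.
have key : mass (vol b) (pdual p u) (carleson_tent z') `^ (p - 1) *
    mass (vol b) (pweight b p u) (carleson_tent z') <=
    K * (fine (vol b (carleson_tent z')) `^ (p - 1) *
      fine (vol t' (carleson_tent z'))) / @char_ratio R m b p.
  have := char_le_tent b1 p1 hu hK z'B.
  rewrite -(massE nS Sfin mTc) -(massE nW Wfin mTc) poweR_EFin -EFinM lee_fin.
  exact.
have v10 : 0 <= fine (vol b (carleson_tent z')) by rewrite fine_ge0.
have v20 : 0 <= fine (vol t' (carleson_tent z')) by rewrite fine_ge0.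
have mS0 A : 0 <= mass (vol b) (pdual p u) A by exact: mass_ge0.
have mW0 A : 0 <= mass (vol b) (pweight b p u) A by exact: mass_ge0.
move: (mS0 (tent pdist pdefect (18 * 100) z)) (mS0 (carleson_tent z')) leS key.
move: (mW0 (tent pdist pdefect (18 * 100) z)) (mW0 (carleson_tent z')) leW.
move: (mass _ _ _) => w1; move: (mass _ _ _) => w2 w10 w20 w12.
move: (mass _ _ _) => s1; move: (mass _ _ _) => s2 s10 s20 s12.
move: v10 v20 v1 v2; move: (fine _) => v1; move: (fine _) => v2.
move=> v10 v20 v1C v2C key.
have rd : r <= D * pdefect z by [].
clearbody r.
move: cr0 key; move: (@char_ratio R m b p) => cr cr0 key.
have p10' := ltW p10.
apply: (@le_trans _ _ (s2 `^ (p - 1) * w2)).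
  by apply: ler_pM; rewrite ?powR_ge0// ge0_ler_powR// nnegrE.
apply: (le_trans key).
have C1r : 0 <= C1 * r `^ N by rewrite mulr_ge0 ?powR_ge0// ltW.
apply: (@le_trans _ _ (K * ((C1 * r `^ N) `^ (p - 1) * (C2 * r `^ (n%:R + 1 + t'))) / cr)).
  rewrite ler_wpM2r ?invr_ge0 ?(ltW cr0)// ler_wpM2l//.
  by apply: ler_pM; rewrite ?powR_ge0// ge0_ler_powR// nnegrE.
have -> : (C1 * r `^ N) `^ (p - 1) * (C2 * r `^ (n%:R + 1 + t')) =
    C1 `^ (p - 1) * C2 * r `^ (2 * N * p).
  rewrite powRM ?powR_ge0 ?(ltW C10)// -powRrM.
  have -> : r `^ (2 * N * p) = r `^ (N * (p - 1)) * r `^ (n%:R + 1 + t').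
    by rewrite -powRD ?(gt_eqF r0) ?implybT//; congr powR; ring.
  by ring.
have -> : K * (C1 `^ (p - 1) * C2 * r `^ (2 * N * p)) / cr =
    C1 `^ (p - 1) * C2 / cr * K * r `^ (2 * N * p) by ring.
have -> : C1 `^ (p - 1) * C2 / cr * D `^ (2 * N * p) * K * pdefect z `^ (2 * N * p) =
    C1 `^ (p - 1) * C2 / cr * K * (D * pdefect z) `^ (2 * N * p).
  by rewrite powRM ?(ltW D0) ?(ltW d0)//; ring.
rewrite ler_wpM2l//.
  by rewrite !mulr_ge0 ?powR_ge0 ?invr_ge0// ltW.
apply: ge0_ler_powR; rewrite ?nnegrE ?(ltW r0)//.
  by rewrite !mulr_ge0 ?(ltW N0) ?(ltW p0).
by rewrite mulr_ge0// ltW.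
Qed.

End dual_pair_of_characteristic.

(** * The upper bound *)

(** Tonelli for the positive and the negative part separately; the [fine] of their difference is
    measurable without any integrability, so the transform of every measurable f is measurable. *)
Lemma measurable_Rintegral_param d1 d2 (T1 : measurableType d1)
    (T2 : measurableType d2) (R : realType)
    (v : {sigma_finite_measure set T2 -> \bar R}) (D : set T2)
    (g : T1 * T2 -> R) : measurable D -> measurable_fun [set: T1 * T2] g ->
  measurable_fun [set: T1] (fun x => \int[v]_(y in D) g (x, y)).
Proof.
move=> mD mg; apply: (measurableT_comp (fine_measurable measurableT)).
have part (h : T1 * T2 -> R) : measurable_fun [set: T1 * T2] h -> (forall z, 0 <= h z) ->
    measurable_fun [set: T1] (fun x => \int[v]_(y in D) (h (x, y))%:E)%E.
  move=> mh h0.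
  have := @measurable_fun_fubini_tonelli_F _ _ T1 T2 R v
    (fun z => (h z * \1_D z.2)%:E).
  rewrite /fubini_F [X in _ -> _ -> measurable_fun _ X](_ : _ =
    (fun x => \int[v]_(y in D) (h (x, y))%:E)%E); last first.
    by apply/funext => x; rewrite -[RHS]integral_mul_indic.
  apply; last by move=> z; rewrite lee_fin mulr_ge0// indicE.
  apply/measurable_EFinP/measurable_funM => //.
  exact: (measurableT_comp (measurable_indic mD) measurable_snd).
have posE (h : T1 * T2 -> R) (x : T1) : (\int[v]_(y in D) ((fun y => (h (x, y))%:E)^\+)%E y =
    \int[v]_(y in D) (Num.max (h (x, y)) 0)%:E)%E.
  by apply: eq_integral => y _; rewrite funeposE -EFin_max.
have mmax (h : T1 * T2 -> R) : measurable_fun [set: T1 * T2] h ->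
    measurable_fun [set: T1] (fun x => \int[v]_(y in D) (Num.max (h (x, y)) 0)%:E)%E.
  move=> mh; apply: (part (fun z => Num.max (h z) 0)) => [|z].
    exact: measurable_maxr.
  by rewrite le_max lexx orbT.
rewrite (_ : (fun x => _) = (fun x => \int[v]_(y in D) (Num.max (g (x, y)) 0)%:E -
    \int[v]_(y in D) (Num.max (- g (x, y)) 0)%:E)%E).
  apply: emeasurable_funB; first exact: mmax.
  by apply: (mmax (fun z => - g z)); exact: measurableT_comp.
apply/funext => x; rewrite integralE posE; congr (_ - _)%E.
by apply: eq_integral => y _; rewrite funenegE -EFinN -EFin_max.
Qed.

(** Real and imaginary parts are bounded separately, which costs a factor 2. *)
Lemma normc_cintegral_le d (T : measurableType d) (R : realType)
    (mu : {measure set T -> \bar R}) (D : set T) (f : T -> R[i]) : measurable D ->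
  cintegrable mu D f ->
  normc (cintegral mu D f) <= 2 * fine (\int[mu]_(x in D) (normc (f x))%:E)%E.
Proof.
move=> mD [mf ffin].
have part (h : R[i] -> R) : measurable_fun setT h -> (forall z, `|h z| <= normc z) ->
    `|\int[mu]_(x in D) h (f x)| <= fine (\int[mu]_(x in D) (normc (f x))%:E)%E.
  move=> mh hle.
  have mhf : measurable_fun D (fun x => h (f x)) by exact: (measurableT_comp mh mf).
  have mnf : measurable_fun D (fun x => normc (f x)).
    exact: (measurableT_comp (@measurable_normc R) mf).
  have int_h : mu.-integrable D (EFin \o (fun x => h (f x))).
    apply/integrableP; split; first exact/measurable_EFinP.
    apply: le_lt_trans ffin; apply: ge0_le_integral => //.
    - by apply/measurable_EFinP; exact: measurableT_comp.
    - exact/measurable_EFinP.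
    - by move=> x _; rewrite lee_fin.
  have nfin : (\int[mu]_(x in D) (normc (f x))%:E)%E \is a fin_num.
    rewrite ge0_fin_numE//; apply: integral_ge0 => x _; rewrite lee_fin.
    exact: normc_ge0.
  apply: le_trans (le_normr_Rintegral mD int_h) _.
  have le : (\int[mu]_(x in D) `|h (f x)|%:E <= \int[mu]_(x in D) (normc (f x))%:E)%E.
    apply: ge0_le_integral => //.
    - by apply/measurable_EFinP; exact: measurableT_comp.
    - exact/measurable_EFinP.
    - by move=> x _; rewrite lee_fin.
  apply: fine_le => //; rewrite ge0_fin_numE ?(le_lt_trans le)//.
  by apply: integral_ge0 => x _; rewrite lee_fin.
rewrite (le_trans (normc_le_ReIm _))// (_ : 2 = 1 + 1)// mulrDl mul1r lerD//.
- exact: part (@measurable_Re R) (@Re_le_normc R).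
- exact: part (@measurable_Im R) (@Im_le_normc R).
Qed.

Lemma eq_cintegral d (T : measurableType d) (R : realType)
    (mu : {measure set T -> \bar R}) (D : set T) (f g : T -> R[i]) :
  (forall x, D x -> f x = g x) -> cintegral mu D f = cintegral mu D g.
Proof.
move=> fg; rewrite /cintegral; congr Complex; apply: eq_Rintegral => x;
  by rewrite inE => /fg ->.
Qed.

Section berezin_pointwise_bound.
Context {R : realType} {m : nat}.
Local Notation n := m.+1.
Local Notation V := 'rV[R[i]]_n.
Variables (b p : R).
Hypothesis p1 : 1 < p.
Local Notation N := (n%:R + 1 + b).

Let mball : measurable (@unit_ball R n) := @measurable_unit_ball R n.

Let p0 : 0 < p. Proof. exact: lt_trans p1. Qed.
Let p10 : 0 < p - 1. Proof. by rewrite subr_gt0. Qed.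

Lemma normc_berezin_integrand (f : V -> R[i]) (z w : V) :
  normc (berezin_integrand b f z w) = normc (f w) * hdist z w `^ (- (2 * N)).
Proof.
rewrite /berezin_integrand powRN -/(hdist z w) -fmorphV/= normcM normc_real.
by rewrite ger0_norm// invr_ge0 powR_ge0.
Qed.

Lemma measurable_berezin_integrand_proj (f : V -> R[i]) : measurable_fun unit_ball f ->
  measurable_fun [set: V * V]
    (fun z => berezin_integrand b f (ball_proj z.1) (ball_proj z.2)).
Proof.
move=> mf; apply: measurable_complexM.
  exact: (measurableT_comp (measurable_comp_ball_proj mf) measurable_snd).
rewrite (_ : (fun z : V * V => _) =
  (fun z : V * V => (pdist z.1 z.2 `^ (- (2 * N)))%:C)); last first.
  by apply/funext => z; rewrite -fmorphV/= -powRN.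
apply: measurable_fun_complex => //=.
exact: (measurableT_comp (measurable_powR _) measurable_pdist).
Qed.

Lemma berezin_ball_projE (f : V -> R[i]) (z : V) : unit_ball z ->
  berezin b f z = (pdefect z `^ N)%:C * cintegral (vol b) unit_ball
    (fun w => berezin_integrand b f (ball_proj z) (ball_proj w)).
Proof.
move=> zB; have e : pdefect z = 1 - hnorm z ^+ 2 by rewrite /pdefect (ball_proj_id zB).
have ec : cintegral (vol b) unit_ball (berezin_integrand b f z) =
    cintegral (vol b) unit_ball
    (fun w => berezin_integrand b f (ball_proj z) (ball_proj w)).
  by apply: eq_cintegral => w wB; rewrite (ball_proj_id wB) (ball_proj_id zB).
by rewrite /berezin ec e.
Qed.

Lemma measurable_berezin (f : V -> R[i]) : measurable_fun unit_ball f ->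
  measurable_fun unit_ball (berezin b f).
Proof.
move=> mf.
apply: (@eq_measurable_fun _ _ _ _ _ (fun z => (pdefect z `^ N)%:C *
    cintegral (vol b) unit_ball
    (fun w => berezin_integrand b f (ball_proj z) (ball_proj w)))).
  by move=> z; rewrite inE => zB; rewrite -berezin_ball_projE.
apply: measurable_funTS; apply: measurable_complexM.
  apply: measurable_fun_complex => //=.
  exact: (measurableT_comp (measurable_powR _) measurable_pdefect).
have mB := measurable_berezin_integrand_proj mf.
apply: measurable_fun_complex => /=.
  apply: (@measurable_Rintegral_param _ _ _ _ _ (@vol R n b) unit_ball
    (fun z => complex.Re (berezin_integrand b f (ball_proj z.1) (ball_proj z.2)))) => //.
  exact: (measurableT_comp (@measurable_Re R)).
apply: (@measurable_Rintegral_param _ _ _ _ _ (@vol R n b) unit_ball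
  (fun z => complex.Im (berezin_integrand b f (ball_proj z.1) (ball_proj z.2)))) => //.
exact: (measurableT_comp (@measurable_Im R)).
Qed.

Section transform.
Variables (u : V -> R) (f : V -> R[i]).
Hypothesis hu : weight u.
Hypothesis mf : measurable_fun unit_ball f.

Let sg := pdual p u.
Let F (x : V) : R := normc (f (ball_proj x)) / sg x.

Let sg0 x : 0 < sg x. Proof. exact: pdual_gt0. Qed.

Let mnf : measurable_fun unit_ball (fun x => normc (f x)).
Proof. exact: (measurableT_comp (@measurable_normc R) mf). Qed.

Let nF : nonneg_mfun F.
Proof.
split => [|x]; last by rewrite divr_ge0 ?normc_ge0// ltW.
apply: measurable_funM; first exact: (measurable_comp_ball_proj mnf).
rewrite (_ : (fun x => _) = (fun x => sg x `^ (-1))).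
  exact: (measurableT_comp (measurable_powR _) (measurable_pdual p hu)).
by apply/funext => x; rewrite powR_inv1// ltW.
Qed.

Lemma quotient_dualE x : F x * sg x = normc (f (ball_proj x)).
Proof. by rewrite /F divfK// gt_eqF. Qed.

(** The substitution |f| = F sigma passes to the two-weight form, because sigma^(1-p) = u. *)
Lemma quotient_powR x : F x `^ p * sg x = normc (f (ball_proj x)) `^ p * u (ball_proj x).
Proof.
have g0 := normc_ge0 (f (ball_proj x)); have s0 := sg0 x.
have u0 := weight_proj_gt0 hu x.
rewrite /F powRM ?invr_ge0 ?(ltW s0)// -mulrA; congr (_ * _).
rewrite -powR_inv1 ?(ltW s0)// -powRrM mulN1r -{2}(powRr1 (ltW s0)).
rewrite -powRD ?(gt_eqF s0) ?implybT// /sg /pdual /dual_weight dual_exponent//.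
rewrite -powRrM (_ : _ * _ = 1) ?powRr1 ?(ltW u0)//; field.
by rewrite gt_eqF.
Qed.

Lemma integral_quotient_powR :
  (\int[vol b]_x (F x `^ p * sg x)%:E = Lp_integral b p u f)%E.
Proof.
have [u0 mu _] := hu.
under eq_integral do rewrite quotient_powR.
rewrite (@integral_ball_proj R m b setT (fun x => (normc (f x) `^ p * u x)%:E)) ?setTI//.
- by apply/measurable_EFinP/measurable_funM => //; exact: (measurableT_comp (measurable_powR _)).
- by move=> x xB; rewrite lee_fin mulr_ge0 ?powR_ge0// ltW// u0.
Qed.

(** F sigma is (F^p sigma)^(1/p) times sigma^(1/p'), and sigma has finite mass, so Hoelder's
    inequality applies. With [potential_lty] this gives the absolute convergence that [berezin_dom]
    demands. *)
Lemma integrable_quotient : pos_mfun (@vol R n b) sg -> (Lp_integral b p u f < +oo)%E ->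
  integrable_mfun (@vol R n b) sg F.
Proof.
move=> ps Ifin; split => //.
have ns := pos_nonneg_mfun ps; have [_ _ sfin] := ps.
have q0 : 0 < p / (p - 1) by rewrite divr_gt0.
have e1 : p^-1 + (p / (p - 1))^-1 = 1 by field; rewrite !gt_eqF.
apply: le_lt_trans (@hoelder_mass _ _ _ (@vol R n b) setT (fun x => F x * sg x)
  (fun x => F x `^ p * sg x) sg p (p / (p - 1)) measurableT _ ns p0 q0 e1 _) _.
- by apply: nonneg_mfunM => //; exact: nonneg_mfun_powR.
- move=> x _; have [_ /(_ x) F0] := nF; have s0 := ltW (sg0 x).
  rewrite powRM ?powR_ge0// -powRrM mulfV ?gt_eqF// powRr1// -mulrA; congr (_ * _).
  by rewrite -powRD ?e1 ?powRr1// oner_eq0.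
- rewrite integral_quotient_powR lte_mul_pinfty ?poweR_ge0//.
    rewrite ge0_fin_numE ?poweR_ge0// poweR_lty//.
  by rewrite poweR_lty.
Qed.

Let P (z : V) := potential (@vol R n b) pdist N sg F z.

Lemma integral_normc_berezin_integrand (z : V) : unit_ball z ->
  (\int[vol b]_(w in unit_ball) (normc (berezin_integrand b f z w))%:E = P z)%E.
Proof.
move=> zB; rewrite /P /potential.
under [RHS]eq_integral => x _.
  rewrite quotient_dualE /pdist (ball_proj_id zB) hdistC -normc_berezin_integrand.
over.
rewrite (@integral_ball_proj R m b setT
  (fun w => (normc (berezin_integrand b f z w))%:E)) ?setTI//.
  apply/measurable_EFinP; under eq_fun do rewrite normc_berezin_integrand.
  apply: measurable_funM => //; apply: (measurableT_comp (measurable_powR _)).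
  apply: measurable_funTS.
  exact: (measurableT_comp (@measurable_hdist R n) (pair1_measurable z)).
by move=> w _; rewrite lee_fin normc_ge0.
Qed.

Lemma cintegrable_berezin_integrand (z : V) : unit_ball z -> (P z < +oo)%E ->
  cintegrable (vol b) unit_ball (berezin_integrand b f z).
Proof.
move=> zB Pfin; split; last by rewrite integral_normc_berezin_integrand.
apply: (@eq_measurable_fun _ _ _ _ _
    (fun w => berezin_integrand b f (ball_proj z) (ball_proj w))).
  by move=> w; rewrite inE => wB; rewrite !ball_proj_id.
apply: measurable_funTS.
exact: (measurableT_comp (measurable_berezin_integrand_proj mf) (pair1_measurable z)).
Qed.

Lemma normc_berezin_le (z : V) : unit_ball z -> (P z < +oo)%E ->
  normc (berezin b f z) <= 2 * (pdefect z `^ N * fine (P z)).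
Proof.
move=> zB Pfin; have ci := cintegrable_berezin_integrand zB Pfin.
rewrite /berezin normcM normc_real ger0_norm ?powR_ge0// /pdefect (ball_proj_id zB).
rewrite mulrCA ler_wpM2l ?powR_ge0//.
by rewrite -integral_normc_berezin_integrand//; exact: normc_cintegral_le.
Qed.

End transform.

End berezin_pointwise_bound.

Section berezin_norm_upper_bound.
Context {R : realType} {m : nat}.
Local Notation n := m.+1.
Local Notation V := 'rV[R[i]]_n.
Variables (b p : R).
Hypothesis b1 : -1 < b.
Hypothesis p1 : 1 < p.
Local Notation N := (n%:R + 1 + b).

Let mball : measurable (@unit_ball R n) := @measurable_unit_ball R n.

Let p0 : 0 < p. Proof. exact: lt_trans p1. Qed.

Lemma Lp_integral_ge0 u (g : V -> R[i]) : weight u -> (0 <= Lp_integral b p u g)%E.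
Proof.
move=> [u0 _ _]; apply: integral_ge0 => x xB.
by rewrite lee_fin mulr_ge0 ?powR_ge0// ltW// u0.
Qed.

Lemma poweR_le_root (c : R) (x y : \bar R) : 0 <= c -> (0 <= x)%E -> (0 <= y)%E ->
  (x <= (c `^ p)%:E * y)%E -> (x `^ p^-1 <= c%:E * y `^ p^-1)%E.
Proof.
move=> c0 x0 y0 xy.
have -> : (c%:E * y `^ p^-1 = ((c `^ p)%:E * y) `^ p^-1)%E.
  rewrite poweRM ?lee_fin ?powR_ge0// poweR_EFin -powRrM mulfV ?gt_eqF//.
  by rewrite powRr1.
have pi0 : 0 <= p^-1 by rewrite invr_ge0 ltW.
apply: (gt0_ler_poweR pi0) => //; rewrite in_itv/= ?leey ?andbT//.
by rewrite mule_ge0// lee_fin powR_ge0.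
Qed.

(** The factor rho^N of the transform becomes rho^(pN) in the p-th power and merges with u into
    [pweight]; what remains is [potential_bound] for the pair (sigma, U). The factor 2 is that of
    [normc_cintegral_le]. *)
Lemma berezin_bounded : exists2 C : R, 0 < C &
  forall u K (f : V -> R[i]), weight u -> 0 <= K -> (Cpb_char p b u <= K%:E)%E ->
    Lp_space b p u f ->
  [/\ berezin_dom b f, Lp_space b p u (berezin b f) &
    (Lp_norm b p u (berezin b f) <=
     (C * K `^ Num.max 1 (p - 1)^-1)%:E * Lp_norm b p u f)%E].
Proof.
have [Cd Cd0 Hd] := @dual_pair_of_char R m b p b1 p1.
have [c0 [C0 Hts]] := @ball_tent_space R m b b1.
have [Cp Cp0 Hp] := potential_bound Hts p1.
set e := Num.max 1 (p - 1)^-1 in Hp *.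
exists (2 * (Cp * Cd `^ e)); first by rewrite !mulr_gt0// powR_gt0.
move=> u K f hu K0 hK [mf Ifin].
have [pS pW] := char_finite b1 p1 hu hK.
have nS := pos_nonneg_mfun pS; have nW := pos_nonneg_mfun pW.
have dp := Hd u K hu K0 hK.
have iF := integrable_quotient p1 hu mf pS Ifin.
set F := fun x => _ in iF.
pose P z := potential (@vol R n b) pdist N (pdual p u) F z.
have Pfin z : (P z < +oo)%E by apply: (potential_lty Hts).
have P0 z : (0 <= P z)%E by apply: potential_ge0 => //; have [] := iF.
have CdK0 : 0 <= Cd * K by rewrite mulr_ge0// ltW.
have hF := @integral_quotient_powR R m b p p1 u f hu mf.
have := Hp (pdual p u) (pweight b p u) F (Cd * K) CdK0 pS pW dp iF.
rewrite [X in (X < _)%E -> _]hF [X in _ -> (_ <= _ * X)%E]hF => /(_ Ifin) key.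
have mB := measurable_berezin b mf.
have mP : measurable_fun setT (fun z => fine (P z)).
  apply: (measurableT_comp (fine_measurable measurableT)).
  by apply: (measurable_potential Hts) => //; have [] := iF.
have mPp : measurable_fun setT (fun z => fine (P z) `^ p).
  exact: (measurableT_comp (measurable_powR _)).
have [mW W0] := nW.
have le : (Lp_integral b p u (berezin b f) <=
    ((2 * (Cp * Cd `^ e) * K `^ e) `^ p)%:E * Lp_integral b p u f)%E.
  apply: (@le_trans _ _ ((2 `^ p)%:E *
    \int[vol b]_z (fine (P z) `^ p * pweight b p u z)%:E)%E); last first.
    have e2 : (2 * (Cp * Cd `^ e) * K `^ e) `^ p = 2 `^ p * (Cp * (Cd * K) `^ e) `^ p.
      rewrite (powRM _ (ltW Cd0) K0) mulrA -(powRM p) ?mulr_ge0 ?powR_ge0 ?(ltW Cp0)//.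
      by congr (_ `^ _); ring.
    rewrite e2 EFinM -muleA; apply: lee_wpmul2l; last exact: key.
    by rewrite lee_fin powR_ge0.
  have [u0 mu _] := hu.
  apply: (@le_trans _ _ (\int[vol b]_(z in unit_ball)
      ((2 `^ p)%:E * (fine (P z) `^ p * pweight b p u z)%:E))%E).
    apply: ge0_le_integral => //.
    - by move=> x xB; rewrite lee_fin mulr_ge0 ?powR_ge0// ltW// u0.
    - apply/measurable_EFinP/measurable_funM => //.
      apply: (measurableT_comp (measurable_powR _)).
      exact: (measurableT_comp (@measurable_normc R)).
    - apply: measurable_funTS; apply: emeasurable_funM => //.
      by apply/measurable_EFinP; exact: measurable_funM.
    - move=> z zB; rewrite -EFinM lee_fin.
      have := normc_berezin_le hu mf zB (Pfin z); rewrite -/(P z) => hz.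
      have d0 := ltW (@pdefect_gt0 R m z).
      have fP0 : 0 <= fine (P z) by apply: fine_ge0.
      have uz := ltW (u0 z zB).
      rewrite /pweight (ball_proj_id zB).
      apply: (@le_trans _ _ ((2 * (pdefect z `^ N * fine (P z))) `^ p * u z)).
        rewrite ler_wpM2r//; apply: ge0_ler_powR; rewrite ?nnegrE ?normc_ge0 ?(ltW p0)//.
        by rewrite !mulr_ge0 ?powR_ge0.
      rewrite powRM ?mulr_ge0 ?powR_ge0// (powRM p (powR_ge0 _ _) fP0) -powRrM.
      by rewrite (mulrC N) le_eqVlt; apply/orP; left; apply/eqP; ring.
  have mI : measurable_fun setT (fun z => fine (P z) `^ p * pweight b p u z).
    exact: measurable_funM.
  have I0 z : 0 <= fine (P z) `^ p * pweight b p u z by rewrite mulr_ge0 ?powR_ge0.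
  apply: (@le_trans _ _ (\int[vol b]_z
      ((2 `^ p)%:E * (fine (P z) `^ p * pweight b p u z)%:E))%E).
    apply: ge0_subset_integral => //.
    - apply: emeasurable_funM => //; exact/measurable_EFinP.
    - by move=> x _; rewrite mule_ge0// lee_fin// powR_ge0.
  rewrite le_eqVlt; apply/orP; left; apply/eqP.
  apply: ge0_integralZl_EFin => //; rewrite ?powR_ge0//.
    by move=> x _; rewrite lee_fin.
  exact/measurable_EFinP.
have CK0 : 0 <= 2 * (Cp * Cd `^ e) * K `^ e by rewrite !mulr_ge0 ?powR_ge0 ?(ltW Cp0).
split.
- by move=> z zB; exact: (cintegrable_berezin_integrand hu mf zB (Pfin z)).
- split; [exact: mB|apply: le_lt_trans le _].
  by rewrite lte_mul_pinfty ?lee_fin ?powR_ge0.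
- by apply: poweR_le_root => //; exact: Lp_integral_ge0.
Qed.

Lemma Cpb_char_ge0 (u : V -> R) : weight u -> (0 <= Cpb_char p b u)%E.
Proof.
move=> [u0 _ _].
apply: (@le_trans _ _ (average b (carleson_tent 0) (dual_weight p u) `^ (p - 1) *
    average (p * N + b) (carleson_tent 0) u)%E); last first.
  by apply: ereal_sup_ubound; exists 0 => //; exact: unit_ball0.
rewrite mule_ge0 ?poweR_ge0// /average carleson_tent0 mule_ge0//.
  by apply: integral_ge0 => x xB; rewrite lee_fin ltW// u0.
by rewrite inve_ge0 integral_ge0.
Qed.

Lemma berezin_norm_le : exists C : R, 0 < C /\
  forall u : V -> R, weight u ->
    (berezin_norm b p u <= C%:E * Cpb_char p b u `^ (Num.max 1%R ((p - 1)^-1)%R))%E.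
Proof.
have [C C0 HC] := berezin_bounded; exists C; split => // u hu.
have c0 := Cpb_char_ge0 hu.
have e0 : 0 < Num.max 1 (p - 1)^-1 by rewrite lt_max ltr01.
(* An infinite characteristic makes the right-hand side infinite, since the constant and the
   exponent are positive. *)
have := leey (Cpb_char p b u); rewrite le_eqVlt => /predU1P[->|cfin].
  by rewrite poweRyr ?gt_eqF// gt0_muley ?lte_fin// leey.
have cE : Cpb_char p b u = (fine (Cpb_char p b u))%:E by rewrite fineK// ge0_fin_numE.
have K0 : 0 <= fine (Cpb_char p b u) by exact: fine_ge0.
rewrite cE poweR_EFin -EFinM; apply: ereal_inf_lbound => /=.
exists (C * fine (Cpb_char p b u) `^ Num.max 1 (p - 1)^-1); last by [].
split.
  by rewrite mulr_ge0 ?powR_ge0// ltW.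
by move=> f hf; apply: HC => //; rewrite -cE.
Qed.

End berezin_norm_upper_bound.

(** * The lower bound *)

Lemma ge0_integral_le_truncated d (T : measurableType d) (R : realType)
    (v : {measure set T -> \bar R}) (A : set T) (h : T -> R) (M : \bar R) :
  measurable A -> measurable_fun [set: T] h -> (forall x, 0 <= h x) ->
  (forall k : nat, (\int[v]_(x in A `&` [set x | (h x <= k%:R)%R]) (h x)%:E <= M)%E) ->
  (\int[v]_(x in A) (h x)%:E <= M)%E.
Proof.
move=> mA mh h0 hM; pose B k := [set x | h x <= k%:R].
have mB k : measurable (B k) by exact: measurable_set_ler.
pose g k x := (h x * \1_(B k) x)%:E.
have mono x : {homo g^~ x : k l / (k <= l)%N >-> (k <= l)%E}.
  move=> k l kl; rewrite lee_fin ler_wpM2l// !indicE.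
  have [/set_mem hk|//] := boolP (x \in B k).
  by rewrite mem_set// /B/= (le_trans hk)// ler_nat.
have glim x : limn (g^~ x) = (h x)%:E.
  apply: lim_near_cst; first exact: ereal_hausdorff.
  near=> k; rewrite /g indicE mem_set ?mulr1// /B/=.
  rewrite (le_trans (ltW (archi_boundP (h0 x))))// ler_nat.
  by near: k; exact: nbhs_infty_ge.
have mg k : measurable_fun A (g k).
  apply/measurable_funTS/measurable_EFinP/measurable_funM => //.
have := @cvg_monotone_convergence _ _ _ v A mA g mg _ (fun x _ => mono x).
under [X in _ -> _ --> X]eq_integral do rewrite glim.
move=> /(_ _)/cvg_lim <-//; last first.
  by move=> k x _; rewrite lee_fin mulr_ge0// indicE.
apply: lime_le.
  apply: ereal_nondecreasing_is_cvgn => k l kl; apply: ge0_le_integral => //.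
  - by move=> x _; rewrite lee_fin mulr_ge0// indicE.
  - by move=> x _; exact: mono.
near=> k; apply: le_trans (hM k); rewrite le_eqVlt; apply/orP; left; apply/eqP.
rewrite integral_mkcondr; apply: eq_integral => x _.
by rewrite /g indicE patchE; case: ifPn => _; rewrite (mulr1,mulr0).
Unshelve. all: by end_near. Qed.

Section truncated_dual_weights.
Context {R : realType} {m : nat}.
Local Notation n := m.+1.
Local Notation V := 'rV[R[i]]_n.
Variables (b p : R).
Hypothesis b1 : -1 < b.
Hypothesis p1 : 1 < p.
Local Notation N := (n%:R + 1 + b).

Let mball : measurable (@unit_ball R n) := @measurable_unit_ball R n.

Let p0 : 0 < p. Proof. exact: lt_trans p1. Qed.
Let p10 : 0 < p - 1. Proof. by rewrite subr_gt0. Qed.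
Let N0 : 0 < N. Proof. exact: ball_dim_gt0. Qed.

Section test_function.
Variables (u : V -> R) (A : set V).
Hypothesis hu : weight u.
Hypothesis mA : measurable A.
Hypothesis AB : A `<=` unit_ball.

(* [A] will be a tent truncated where the dual weight is large: the test function
   is then in L^p before the dual mass of the tent is known to be finite. *)
Definition test_fun (w : V) : R[i] := (dual_weight p u w * \1_A w)%:C.

(** The exponents add up: -p/(p-1) + 1 = -1/(p-1). Hence the p-th power of the norm of the test
    function is just the dual mass of A. *)
Lemma dual_weight_powR (w : V) : unit_ball w ->
  dual_weight p u w `^ p * u w = dual_weight p u w.
Proof.
move=> wB; have [u0 _ _] := hu; have uw := u0 w wB.
rewrite /dual_weight dual_exponent// -powRrM -{2}(powRr1 (ltW uw)).
rewrite -powRD ?(gt_eqF uw) ?implybT//; congr (_ `^ _); field.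
by rewrite gt_eqF.
Qed.

Lemma normc_test_fun w : normc (test_fun w) = dual_weight p u w * \1_A w.
Proof. by rewrite normc_real ger0_norm// mulr_ge0 ?powR_ge0// indicE. Qed.

Lemma measurable_test_fun : measurable_fun unit_ball test_fun.
Proof.
apply: (@eq_measurable_fun _ _ _ _ _ (fun w => (pdual p u w * \1_A w)%:C)).
  by move=> w; rewrite inE => wB; rewrite /pdual ball_proj_id.
apply: measurable_funTS; apply: measurable_fun_complex => //=.
apply: measurable_funM; first exact: measurable_pdual.
exact: measurable_indic.
Qed.

Lemma integral_ball_dual (h : V -> R) : (forall x, 0 <= h x) ->
  measurable_fun setT h ->
  (\int[vol b]_(w in unit_ball) (h w * \1_A w)%:E = \int[vol b]_(w in A) (h w)%:E)%E.
Proof.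
move=> h0 mh; rewrite -(integral_mul_indic _ A) -(@integral_setI_ball R m b setT) ?setTI//.
  by apply/measurable_EFinP; apply: measurable_funM => //; exact: measurable_indic.
by move=> x; rewrite lee_fin mulr_ge0// indicE.
Qed.

Lemma Lp_integral_test_fun :
  Lp_integral b p u test_fun = (\int[vol b]_(w in A) (pdual p u w)%:E)%E.
Proof.
rewrite -integral_ball_dual; first last.
- exact: measurable_pdual.
- by move=> x; rewrite powR_ge0.
apply: eq_integral => w; rewrite inE => wB; congr EFin.
rewrite normc_test_fun /pdual (ball_proj_id wB) indicE; case: (w \in A).
  by rewrite !mulr1 dual_weight_powR.
by rewrite !mulr0 powR0 ?gt_eqF// mul0r.
Qed.

Lemma berezin_integrand_test_fun (y w : V) :
  berezin_integrand b test_fun y w = (normc (berezin_integrand b test_fun y w))%:C.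
Proof.
rewrite normc_berezin_integrand normc_test_fun rmorphM/=.
by rewrite /berezin_integrand -fmorphV/= -/(hdist y w) -powRN.
Qed.

(** The integrand is real and nonnegative, so nothing cancels, and the kernel is at least r^(-2N) on
    A. *)
Lemma normc_berezin_test_fun (y : V) (r : R) : 0 < r ->
  cintegrable (vol b) unit_ball (berezin_integrand b test_fun y) ->
  (\int[vol b]_(w in A) (pdual p u w)%:E < +oo)%E ->
  (forall w, A w -> 0 < hdist y w <= r) ->
  (1 - hnorm y ^+ 2) `^ N * (r `^ (- (2 * N)) * mass (@vol R n b) (pdual p u) A) <=
    normc (berezin b test_fun y).
Proof.
move=> r0 [mI Ifin] Sfin hr.
have mnI : measurable_fun unit_ball (fun w => normc (berezin_integrand b test_fun y w)).
  exact: (measurableT_comp (@measurable_normc R) mI).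
rewrite /berezin normcM normc_real ger0_norm ?powR_ge0// ler_wpM2l ?powR_ge0//.
apply: le_trans (Re_le_normc _).
apply: le_trans (ler_norm _).
have -> : complex.Re (cintegral (vol b) unit_ball (berezin_integrand b test_fun y)) =
    \int[vol b]_(w in unit_ball) normc (berezin_integrand b test_fun y w).
  transitivity (\int[vol b]_(w in unit_ball) complex.Re (berezin_integrand b test_fun y w)).
    by [].
  by apply: eq_Rintegral => w _; rewrite [in LHS]berezin_integrand_test_fun.
have S0 : (0 <= \int[vol b]_(w in A) (pdual p u w)%:E)%E.
  by apply: integral_ge0 => x _; rewrite lee_fin powR_ge0.
rewrite -[leLHS]/(fine (r `^ (- (2 * N)) * mass (vol b) (pdual p u) A)%:E).
apply: fine_le => //.
  by rewrite ge0_fin_numE//; apply: integral_ge0 => x _; rewrite lee_fin normc_ge0.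
rewrite EFinM fineK ?ge0_fin_numE//.
apply: (@le_trans _ _ (\int[vol b]_(w in A)
    ((r `^ (- (2 * N)))%:E * (pdual p u w)%:E))%E).
  rewrite le_eqVlt; apply/orP; left; apply/eqP; symmetry.
  apply: ge0_integralZl_EFin => //; rewrite ?powR_ge0//.
  - by move=> x _; rewrite lee_fin powR_ge0.
  - by apply/measurable_funTS/measurable_EFinP; exact: measurable_pdual.
apply: (@le_trans _ _ (\int[vol b]_(w in A)
    (normc (berezin_integrand b test_fun y w))%:E)%E).
  apply: ge0_le_integral => //.
  - by move=> x _; rewrite -EFinM lee_fin mulr_ge0 ?powR_ge0.
  - apply: measurable_funTS; apply: emeasurable_funM => //.
    by apply/measurable_EFinP; exact: measurable_pdual.
  - by apply/measurable_EFinP; exact: measurable_funS mnI.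
  - move=> w Aw; rewrite -EFinM lee_fin normc_berezin_integrand normc_test_fun.
    rewrite indicE mem_set// mulr1 /pdual (ball_proj_id (AB Aw)) mulrC.
    rewrite ler_wpM2l ?powR_ge0//; have /andP[d0 dr] := hr w Aw.
    by apply: ler_powR_neg => //; rewrite oppr_le0 mulr_ge0// ltW.
apply: ge0_subset_integral => //; first exact/measurable_EFinP.
by move=> x _; rewrite lee_fin normc_ge0.
Qed.

End test_function.

End truncated_dual_weights.

Section ereal_powers.
Context {R : realType}.
Implicit Types (W S : \bar R).

(** Division by s, while W may be infinite; at s = 0 the left-hand side is 0, as 0^(p-1) = 0 and 0
    times infinity is 0. *)
Lemma cancel_powR_mule W (p s D : R) : 1 < p -> 0 <= s -> 0 <= D ->
  ((s `^ p)%:E * W <= (D * s)%:E)%E -> ((s `^ (p - 1))%:E * W <= D%:E)%E.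
Proof.
move=> p1; rewrite le_eqVlt => /predU1P[<- D0 _|s0 D0 h].
  by rewrite powR0 ?subr_eq0 ?(gt_eqF p1)// mul0e lee_fin.
have k0 : (0 <= (s^-1)%:E)%E by rewrite lee_fin invr_ge0 ltW.
have := lee_wpmul2l k0 h; rewrite muleA -!EFinM.
rewrite (_ : s^-1 * s `^ p = s `^ (p - 1)).
  by rewrite (_ : s^-1 * (D * s) = D)//; field; rewrite gt_eqF.
rewrite powRB ?(gt_eqF s0) ?implybT// powRr1 ?(ltW s0)//.
by rewrite mulrC.
Qed.

(** S is at most the supremum of the s k, expressed through upper bounds so as to fit
    [ge0_integral_le_truncated]. If W were infinite, every s k would vanish and S could not be
    positive; so W is finite and can be divided out. *)
Lemma mule_powR_sup S W (q M : R) (s : nat -> R) : 0 < q -> 0 <= M ->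
  (0 < S)%E -> (0 < W)%E -> (forall k, 0 <= s k) ->
  (forall c : \bar R, (forall k, ((s k)%:E <= c)%E) -> (S <= c)%E) ->
  (forall k, ((s k `^ q)%:E * W <= M%:E)%E) -> (S `^ q * W <= M%:E)%E.
Proof.
move=> q0 M0 S0 W0 s0 hS h; case: W W0 h => [w| |]// W0 h; last first.
  have s_eq0 k : (s k)%:E = 0%:E.
    congr EFin; apply/eqP; rewrite eq_le s0 andbT leNgt; apply/negP => sk.
    by move: (h k); rewrite gt0_muley// lte_fin powR_gt0.
  have : (S <= 0)%E by apply: hS => k; rewrite s_eq0.
  by rewrite leNgt S0.
rewrite lte_fin in W0.
have Mw0 : 0 <= M / w by rewrite divr_ge0// ltW.
have : (S <= ((M / w) `^ q^-1)%:E)%E.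
  apply: hS => k; rewrite lee_fin; have := h k; rewrite -EFinM lee_fin => hk.
  rewrite -(powRr1 (s0 k)) -(mulfV (negbT (gt_eqF q0))) powRrM.
  apply: ge0_ler_powR; rewrite ?nnegrE ?powR_ge0// ?invr_ge0 ?(ltW q0)//.
  by rewrite ler_pdivlMr.
case: S S0 {hS} => [S| |]// S0; rewrite lee_fin => hS; rewrite lte_fin in S0.
rewrite poweR_EFin -EFinM lee_fin -ler_pdivlMr//.
rewrite -[leRHS](powRr1 Mw0) -(mulVf (negbT (gt_eqF q0))) powRrM.
by apply: ge0_ler_powR; rewrite ?nnegrE ?powR_ge0 ?(ltW q0) ?(ltW S0).
Qed.

Lemma root_le_poweR (p c : R) (x y : \bar R) : 0 < p -> 0 <= c ->
  (0 <= x)%E -> (0 <= y)%E ->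
  (x `^ p^-1 <= c%:E * y `^ p^-1)%E -> (x <= (c `^ p)%:E * y)%E.
Proof.
move=> p0 c0 x0 y0 h.
have pK (z : \bar R) : (0 <= z)%E -> ((z `^ p^-1) `^ p = z)%E.
  by move=> z0; rewrite -poweRrM mulVf ?gt_eqF// poweRe1.
rewrite -[leLHS](pK _ x0) -[X in (_ <= _ * X)%E](pK _ y0) -poweR_EFin.
rewrite -poweRM ?lee_fin ?poweR_ge0//.
apply: (gt0_ler_poweR (ltW p0)) => //; rewrite in_itv/= ?leey ?andbT ?poweR_ge0//.
by rewrite mule_ge0 ?poweR_ge0// lee_fin.
Qed.

End ereal_powers.

Section testing.
Context {R : realType} {m : nat}.
Local Notation n := m.+1.
Local Notation V := 'rV[R[i]]_n.
Variables (b p : R).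
Hypothesis b1 : -1 < b.
Hypothesis p1 : 1 < p.
Local Notation N := (n%:R + 1 + b).

Let mball : measurable (@unit_ball R n) := @measurable_unit_ball R n.

Let p0 : 0 < p. Proof. exact: lt_trans p1. Qed.
Let p10 : 0 < p - 1. Proof. by rewrite subr_gt0. Qed.
Let N0 : 0 < N. Proof. exact: ball_dim_gt0. Qed.

Lemma hdist_gt0_ball (x y : V) : unit_ball x -> unit_ball y -> 0 < hdist x y.
Proof.
move=> xB yB; rewrite -(pmulr_rgt0 _ (ltr0Sn R 1)).
have /andP[d0 _] := unit_ball_defect xB.
exact: (lt_le_trans d0 (defect_le_hdist _ (ltW yB))).
Qed.

(** The test function is sigma on the part A of the tent T where sigma <= k. Distances within T are
    at most r = 4 (1 - |z|), so its transform at y in T is at least rho(y)^N r^(-2N) sigma(A).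
    Taking p-th powers against u gives r^(-2Np) sigma(A)^p U(T) <= C^p sigma(A); one factor
    sigma(A), finite by truncation, is cancelled before k grows. *)
Lemma norm_bound_tent (u : V -> R) (C : R) (z : V) : weight u -> 0 <= C ->
  (forall f, Lp_space b p u f -> [/\ berezin_dom b f, Lp_space b p u (berezin b f) &
     (Lp_norm b p u (berezin b f) <= C%:E * Lp_norm b p u f)%E]) ->
  unit_ball z ->
  ((\int[vol b]_(x in carleson_tent z) (pdual p u x)%:E) `^ (p - 1) *
   \int[vol b]_(x in carleson_tent z) (pweight b p u x)%:E <=
   ((C * (4 * (1 - hnorm z)) `^ (2 * N)) `^ p)%:E)%E.
Proof.
move=> hu C0 HC zB; set T := carleson_tent z.
have mT : measurable T := measurable_carleson_tent z.
have TB : T `<=` unit_ball by exact: carleson_tent_ball.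
have mS := measurable_pdual p hu; have mW := measurable_pweight b p hu.
have S0 x : 0 <= pdual p u x by rewrite ltW// pdual_gt0.
have W0 x : 0 <= pweight b p u x by rewrite ltW// pweight_gt0.
pose A (k : nat) := T `&` [set x | pdual p u x <= k%:R].
have mA k : measurable (A k) by apply: measurableI => //; exact: measurable_set_ler.
pose s k := mass (@vol R n b) (pdual p u) (A k).
have Afin k : (\int[vol b]_(x in A k) (pdual p u x)%:E < +oo)%E.
  apply: (@le_lt_trans _ _ (\int[vol b]_(x in A k) k%:R%:E)%E).
    apply: ge0_le_integral => //.
    - by move=> x _; rewrite lee_fin.
    - by apply/measurable_funTS/measurable_EFinP.
    - by move=> x [_ /= xk]; rewrite lee_fin.
  rewrite integral_cst// lte_mul_pinfty ?lee_fin//.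
  by rewrite ltey_eq fin_num_measure.
have sE k : (\int[vol b]_(x in A k) (pdual p u x)%:E = (s k)%:E)%E.
  rewrite /s /mass fineK// ge0_fin_numE//.
  by apply: integral_ge0 => x _; rewrite lee_fin.
apply: (@mule_powR_sup _ _ _ _ _ s) => //.
- exact: powR_ge0.
- exact: pdual_tent_gt0.
- exact: pweight_tent_gt0.
- by move=> k; apply: mass_ge0.
- move=> c hc; apply: ge0_integral_le_truncated => // k.
  by rewrite -/(A k) sE.
move=> k.
pose r := 4 * (1 - hnorm z).
have r0 : 0 < r by rewrite mulr_gt0// subr_gt0.
have AB : A k `<=` unit_ball by move=> x [/TB].
have [a [_ _ _ hT]] := carleson_tentP zB.
have sk0 : 0 <= s k by apply: mass_ge0.
apply: cancel_powR_mule => //; first exact: powR_ge0.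
pose f := test_fun p u (A k).
have LpE : Lp_integral b p u f = (s k)%:E by rewrite Lp_integral_test_fun// sE.
have fL : Lp_space b p u f by split; [exact: measurable_test_fun|rewrite LpE ltry].
have [fd [mBf BfI] le] := HC f fL.
have {}le := root_le_poweR p0 C0 (Lp_integral_ge0 b p _ hu) (Lp_integral_ge0 b p _ hu) le.
pose a0 := r `^ (- (2 * N)) * s k.
have a00 : 0 <= a0 by rewrite mulr_ge0 ?powR_ge0.
have ge : ((a0 `^ p)%:E * \int[vol b]_(x in T) (pweight b p u x)%:E <=
    Lp_integral b p u (berezin b f))%E.
  have [u0 mu _] := hu.
  have mI : measurable_fun unit_ball (fun x => (normc (berezin b f x) `^ p * u x)%:E).
    apply/measurable_EFinP/measurable_funM => //.
    apply: (measurableT_comp (measurable_powR _)).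
    exact: (measurableT_comp (@measurable_normc R)).
  apply: (@le_trans _ _ (\int[vol b]_(x in T) ((a0 `^ p)%:E * (pweight b p u x)%:E))%E).
    rewrite le_eqVlt; apply/orP; left; apply/eqP; symmetry.
    apply: ge0_integralZl_EFin => //; rewrite ?powR_ge0//.
      by move=> x _; rewrite lee_fin.
    by apply/measurable_funTS/measurable_EFinP.
  apply: (@le_trans _ _ (\int[vol b]_(x in T) (normc (berezin b f x) `^ p * u x)%:E)%E).
    apply: ge0_le_integral => //.
    - by move=> x _; rewrite -EFinM lee_fin mulr_ge0 ?powR_ge0.
    - by apply: measurable_funTS; apply: emeasurable_funM => //; apply/measurable_EFinP.
    - exact: measurable_funS mI.
    - move=> y Ty; have yB := TB y Ty; rewrite -EFinM lee_fin.
      have d0 : 0 <= pdefect y by rewrite ltW// pdefect_gt0.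
      rewrite /pweight (ball_proj_id yB) mulrCA mulrC ler_wpM2r ?(ltW (u0 y yB))//.
      rewrite mulrC (mulrC p) powRrM -(powRM p (powR_ge0 _ _) a00).
      apply: ge0_ler_powR; rewrite ?nnegrE ?(ltW p0) ?normc_ge0//.
        by rewrite mulr_ge0 ?powR_ge0.
      rewrite /pdefect (ball_proj_id yB).
      apply: normc_berezin_test_fun => //; first exact: fd.
      move=> w [Tw _]; rewrite hdist_gt0_ball//=; last exact: TB.
      exact: hT.
  apply: ge0_subset_integral => //.
  by move=> x xB; rewrite lee_fin mulr_ge0 ?powR_ge0// ltW// u0.
have {le ge} := le_trans ge le; rewrite LpE.
move: (integral _ _ _) => W h.
have k0 : (0 <= ((r `^ (2 * N)) `^ p)%:E)%E by rewrite lee_fin powR_ge0.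
have := lee_wpmul2l k0 h; rewrite !muleA -!EFinM.
have -> : (r `^ (2 * N)) `^ p * a0 `^ p = s k `^ p.
  rewrite -powRM ?powR_ge0// /a0 mulrA -powRD ?(gt_eqF r0) ?implybT//.
  by rewrite subrr powRr0 mul1r.
by rewrite -powRM ?powR_ge0// (mulrC (r `^ _)).
Qed.

End testing.

Section berezin_norm_lower_bound.
Context {R : realType} {m : nat}.
Local Notation n := m.+1.
Local Notation V := 'rV[R[i]]_n.
Variables (b p : R).
Hypothesis b1 : -1 < b.
Hypothesis p1 : 1 < p.
Local Notation N := (n%:R + 1 + b).
Local Notation t' := (p * N + b).

Let mball : measurable (@unit_ball R n) := @measurable_unit_ball R n.

Let p0 : 0 < p. Proof. exact: lt_trans p1. Qed.
Let p10 : 0 < p - 1. Proof. by rewrite subr_gt0. Qed.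
Let N0 : 0 < N. Proof. exact: ball_dim_gt0. Qed.
Let t'1 : -1 < t'. Proof. by rewrite (lt_trans b1)// ltrDr mulr_gt0. Qed.

(** The power (1 - |z|)^(2Np) in [norm_bound_tent] is exactly the order of the volumes in the
    averages, so the bound is uniform in z. *)
Lemma char_le_norm : exists2 C1 : R, 0 < C1 & forall (u : V -> R) (C : R),
  weight u -> 0 <= C ->
  (forall f, Lp_space b p u f -> [/\ berezin_dom b f, Lp_space b p u (berezin b f) &
     (Lp_norm b p u (berezin b f) <= C%:E * Lp_norm b p u f)%E]) ->
  (Cpb_char p b u <= (C1 * C `^ p)%:E)%E.
Proof.
have [c1 [D1 [c10 _ H1]]] := @vol_carleson_tent R m b b1.
have [c2 [D2 [c20 _ H2]]] := @vol_carleson_tent R m t' t'1.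
have cr0 := @char_ratio_gt0 R m b p b1 p1.
exists (@char_ratio R m b p * 4 `^ (2 * N * p) / (c1 `^ (p - 1) * c2)).
  by rewrite divr_gt0// mulr_gt0// powR_gt0.
move=> u C hu C0 HC; apply: ge_ereal_sup => _ [z zB <-].
have [v10 [v20 ->]] := average_tentE b1 p1 hu zB.
have bt := norm_bound_tent b1 p1 hu C0 HC zB.
have r0 : 0 < 1 - hnorm z by rewrite subr_gt0.
have v1 : c1 * (1 - hnorm z) `^ N <= fine (vol b (carleson_tent z)).
  rewrite -lee_fin fineK; first by have [] := H1 z zB.
  by apply: fin_num_measure; exact: measurable_carleson_tent.
have v2 : c2 * (1 - hnorm z) `^ (n%:R + 1 + t') <= fine (vol t' (carleson_tent z)).
  rewrite -lee_fin fineK; first by have [] := H2 z zB.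
  by apply: fin_num_measure; exact: measurable_carleson_tent.
move: (fine _) v10 v1 => w1 w10 w1r; move: (fine _) v20 v2 => w2 w20 w2r.
move: (@char_ratio R m b p) cr0 => cr cr0.
move: (1 - hnorm z) r0 w1r w2r bt => r r0 w1r w2r bt.
have vv : c1 `^ (p - 1) * c2 * r `^ (2 * N * p) <= w1 `^ (p - 1) * w2.
  have -> : c1 `^ (p - 1) * c2 * r `^ (2 * N * p) =
      (c1 * r `^ N) `^ (p - 1) * (c2 * r `^ (n%:R + 1 + t')).
    rewrite powRM ?powR_ge0 ?(ltW c10)// -powRrM.
    have -> : r `^ (2 * N * p) = r `^ (N * (p - 1)) * r `^ (n%:R + 1 + t').
      by rewrite -powRD ?(gt_eqF r0) ?implybT//; congr powR; ring.
    by ring.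
  have c1r : 0 <= c1 * r `^ N by rewrite mulr_ge0 ?powR_ge0// ltW.
  have c2r : 0 <= c2 * r `^ (n%:R + 1 + t') by rewrite mulr_ge0 ?powR_ge0// ltW.
  by apply: ler_pM; rewrite ?powR_ge0//; apply: ge0_ler_powR; rewrite ?nnegrE ?(ltW p10) ?(ltW w10).
have k0 : (0 <= (cr / (w1 `^ (p - 1) * w2))%:E)%E.
  by rewrite lee_fin divr_ge0 ?(ltW cr0)// mulr_ge0 ?powR_ge0// ltW.
apply: le_trans (lee_wpmul2l k0 bt) _; rewrite -EFinM lee_fin.
have c0 : 0 < c1 `^ (p - 1) * c2 by rewrite mulr_gt0// powR_gt0.
have w0 : 0 < w1 `^ (p - 1) * w2 by rewrite mulr_gt0// powR_gt0.
rewrite (powRM _ C0 (powR_ge0 _ _)) -powRrM (powRM _ (ler0n R 4) (ltW r0)).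
move: (c1 `^ (p - 1) * c2) c0 vv => c c0 vv; move: (w1 `^ (p - 1) * w2) w0 vv => w w0 vv.
move: (C `^ p) (powR_ge0 C p) => Cp Cp0; move: (4 `^ _) (powR_ge0 4 (2 * N * p)) => q q0.
rewrite [leLHS]mulrAC [leRHS]mulrAC ler_pdivrMr// [leRHS]mulrAC ler_pdivlMr//.
have -> : cr * (Cp * (q * r `^ (2 * N * p))) * c = cr * q * Cp * (c * r `^ (2 * N * p)) by ring.
by apply: ler_wpM2l => //; rewrite !mulr_ge0// ltW.
Qed.

(** The supremum is bounded below by its term at z = 0. There rho^N = (sigma^(p-1) U)^(1/p), so by
    Hoelder's inequality the masses satisfy sigma(B)^(p-1) U(B) >= J^p, with J the integral of
    rho^N, independent of u. *)
Lemma char_ge : exists2 c : R, 0 < c & forall u : V -> R, weight u ->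
  (c%:E <= Cpb_char p b u)%E.
Proof.
pose J := (\int[vol b]_(x in (unit_ball : set V)) (pdefect x `^ N)%:E)%E.
have mJ : measurable_fun [set: V] (fun x : V => pdefect x `^ N).
  exact: (measurableT_comp (measurable_powR _) measurable_pdefect).
have J0 : (0 < J)%E.
  apply: integral_pos_gt0 => //.
  - by move=> x; rewrite powR_gt0// pdefect_gt0.
  - rewrite -carleson_tent0; apply: vol_carleson_gt0 => //; exact: unit_ball0.
have Jfin : (J < +oo)%E.
  apply: (@le_lt_trans _ _ (\int[vol b]_(x in (unit_ball : set V)) 1)%E).
    apply: ge0_le_integral => //.
    - by move=> x _; rewrite lee_fin powR_ge0.
    - exact/measurable_funTS/measurable_EFinP.
    - move=> x xB; rewrite lee_fin.
      apply: (@le_trans _ _ (1 `^ N)); last by rewrite powR1.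
      apply: ge0_ler_powR; rewrite ?nnegrE ?(ltW N0) ?(ltW (pdefect_gt0 _))//.
      by rewrite /pdefect; have /andP[] := unit_ball_defect (ball_proj_ball x).
  by rewrite integral_cst// mul1e ltey_eq fin_num_measure.
have JE : J = (fine J)%:E by rewrite fineK// ge0_fin_numE// ltW.
have j0 : 0 < fine J by rewrite -lte_fin -JE.
have cr0 := @char_ratio_gt0 R m b p b1 p1.
have v0 t : -1 < t -> 0 < fine (vol t (carleson_tent (0 : V))).
  move=> t1; rewrite fine_gt0// vol_carleson_gt0//=; last exact: unit_ball0.
  by rewrite ltey_eq fin_num_measure//; exact: measurable_carleson_tent.
have v10 := v0 b b1; have v20 := v0 t' t'1.
pose k := @char_ratio R m b p / (fine (vol b (carleson_tent (0 : V))) `^ (p - 1) *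
  fine (vol t' (carleson_tent (0 : V)))).
have k0 : 0 < k by rewrite divr_gt0// mulr_gt0// powR_gt0.
exists (k * fine J `^ p); first by rewrite mulr_gt0// powR_gt0.
move=> u hu.
apply: (@le_trans _ _ (average b (carleson_tent 0) (dual_weight p u) `^ (p - 1) *
    average t' (carleson_tent 0) u)%E); last first.
  by apply: ereal_sup_ubound; exists 0 => //; exact: unit_ball0.
have [_ [_ ->]] := average_tentE b1 p1 hu unit_ball0.
rewrite -/k EFinM; apply: lee_wpmul2l; first by rewrite lee_fin ltW.
rewrite carleson_tent0 -poweR_EFin -JE.
have mS := measurable_pdual p hu; have mW := measurable_pweight b p hu.
have S0 x : 0 <= pdual p u x by rewrite ltW// pdual_gt0.
have W0 x : 0 <= pweight b p u x by rewrite ltW// pweight_gt0.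
have q0 : 0 < p / (p - 1) by rewrite divr_gt0.
have e1 : (p / (p - 1))^-1 + p^-1 = 1 by field; rewrite !gt_eqF.
have split_root (y w : R) : 0 <= w ->
    (y `^ (p - 1) * w) `^ p^-1 = y `^ (p / (p - 1))^-1 * w `^ p^-1.
  by move=> w0; rewrite powRM ?powR_ge0// -powRrM invf_div.
have hJ : (J <= (\int[vol b]_(x in unit_ball) (pdual p u x)%:E) `^ (p / (p - 1))^-1 *
    (\int[vol b]_(x in unit_ball) (pweight b p u x)%:E) `^ p^-1)%E.
  apply: hoelder_mass => // x _.
  have := pdual_pweight b p1 hu x => /(congr1 (fun y => y `^ p^-1)).
  rewrite -powRrM -mulrA mulfV ?gt_eqF// mulr1 => <-.
  exact: split_root.
set S := (integral _ _ _) in hJ *; set W := (integral _ _ (fun x => (pweight _ _ _ _)%:E)) in hJ *.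
have Sg : (0 <= S)%E by apply: integral_ge0 => x _; rewrite lee_fin.
have Wg : (0 <= W)%E by apply: integral_ge0 => x _; rewrite lee_fin.
have -> : (S `^ (p - 1) * W = (S `^ (p / (p - 1))^-1 * W `^ p^-1) `^ p)%E.
  rewrite poweRM ?poweR_ge0// -!poweRrM mulVf ?gt_eqF// poweRe1//.
  by congr (_ `^ _ * _)%E; field; rewrite !gt_eqF.
apply: (gt0_ler_poweR (ltW p0)) => //; rewrite in_itv/= ?leey ?andbT ?(ltW J0)//.
by rewrite mule_ge0 ?poweR_ge0.
Qed.

Lemma berezin_norm_ge : exists C : R, 0 < C /\
  forall u : V -> R, weight u ->
    (Cpb_char p b u `^ ((2 * p)^-1) <= C%:E * berezin_norm b p u)%E.
Proof.
have [C1 C10 H1] := char_le_norm; have [c2 c20 H2] := char_ge.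
have pi0 : 0 < p^-1 by rewrite invr_gt0.
pose D := C1 `^ p^-1 * c2 `^ (- (2 * p)^-1).
have D0 : 0 < D by rewrite mulr_gt0// powR_gt0.
exists D; split => // u hu; rewrite -lee_pdivrMl//.
(* It suffices to treat each admissible C, which bounds the characteristic and makes it finite; if
   there is none, the norm is the infimum of the empty set, +oo. *)
apply: le_ereal_inf_tmp => _ [C [C0 HC] <-].
have h := H1 u C hu C0 HC; have h2 := H2 u hu.
have : Cpb_char p b u \is a fin_num.
  by rewrite ge0_fin_numE ?(le_lt_trans h) ?ltry// (le_trans _ h2)// lee_fin ltW.
case: (Cpb_char p b u) h h2 => [x| |]// h h2 _; rewrite lee_fin in h; rewrite lee_fin in h2.
rewrite lee_pdivrMl// poweR_EFin -EFinM lee_fin.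
have x0 : 0 < x by exact: lt_le_trans h2.
have xE : x `^ (2 * p)^-1 = x `^ p^-1 * x `^ (- (2 * p)^-1).
  by rewrite -powRD ?(gt_eqF x0) ?implybT//; congr powR; field; rewrite gt_eqF.
have -> : D * C = (C1 `^ p^-1 * C) * c2 `^ (- (2 * p)^-1) by rewrite /D; ring.
rewrite xE; apply: ler_pM; rewrite ?powR_ge0//.
  rewrite -[X in _ * X](powRr1 C0) -(mulfV (negbT (gt_eqF p0))) powRrM.
  rewrite -powRM ?(ltW C10) ?powR_ge0//.
  apply: ge0_ler_powR; rewrite ?nnegrE ?(ltW pi0) ?(ltW x0)//.
  by rewrite mulr_ge0 ?powR_ge0// ltW.
by apply: ler_powR_neg => //; rewrite oppr_le0 invr_ge0 mulr_ge0// ltW.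
Qed.

End berezin_norm_lower_bound.

Local Close Scope classical_set_scope.
Theorem theorem3 (R : realType) (n : nat) (b p : R)
    (hn : (1 <= n)%N) (hb : -1 < b) (hp : 1 < p) :
  (exists C : R, 0 < C /\
    forall u : 'rV[R[i]]_n -> R, weight u ->
      (Cpb_char p b u `^ ((2 * p)^-1) <= C%:E * berezin_norm b p u)%E) /\
  (exists C : R, 0 < C /\
    forall u : 'rV[R[i]]_n -> R, weight u ->
      (berezin_norm b p u
         <= C%:E * Cpb_char p b u `^ (Num.max 1%R ((p - 1)^-1)%R))%E).
Proof.
case: n hn => // m _; split; first exact: berezin_norm_ge.
exact: berezin_norm_le.
Qed.
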